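(* Let $\nu$ be either a real number with $0\le\nu<\frac12$ or a purely imaginary number, and let $\mathcal{K}_\nu$ be the integral operator on $\mathbb{R}_{>0}=(0,+\infty)$ with the Macdonald kernel $\mathcal{K}_\nu(u,v)$ (see context). (1) The operator $\mathcal{K}_\nu$ commutes with the second order differential operator $$\mathfrak{D}=-\frac{d}{du}\,u^2\frac{d}{du}+\frac14u^2,$$ that is, $\mathfrak{D}_u\mathcal{K}_\nu(u,v)=\mathfrak{D}_v\mathcal{K}_\nu(u,v)$, where the subscript $u$ or $v$ indicates the variable on which the differential operator acts. (2) For every $m\ge0$, the function $f_m(u)=\frac1uW_{0,im}(u)$ satisfies $$\mathfrak{D}f_m=\Big(m^2+\frac14\Big)f_m,\qquad \mathcal{K}_\nu f_m=\frac{\cos(\pi\nu)}{\cos(\pi\nu)+\cosh(\pi m)}\,f_m.$$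
   Context: The Macdonald kernel is $$\mathcal{K}_\nu(u,v)=\frac{\sqrt{uv}\,\cos(\pi\nu)}{\pi^2}\,\frac{u\,K_{\nu+1}(\frac u2)K_\nu(\frac v2)-v\,K_{\nu+1}(\frac v2)K_\nu(\frac u2)}{u^2-v^2},\qquad u,v>0,$$ where $K_\nu$ is the Macdonald function (modified Bessel function of the second kind), and for $u=v$ the value is the limit $v\to u$. Equivalently, $$\mathcal{K}_\nu(u,v)=\frac{\cos(\pi\nu)}{\pi}\,\frac{2W_{1,\nu}(u)W_{0,\nu}(v)-2W_{1,\nu}(v)W_{0,\nu}(u)-(u-v)W_{0,\nu}(u)W_{0,\nu}(v)}{u^2-v^2}.$$ The operator acts by $(\mathcal{K}_\nu f)(u)=\int_0^\infty\mathcal{K}_\nu(u,v)f(v)\,dv$. $W_{\kappa,\mu}(u)$ is the classical Whittaker function (the solution of $W''=\big(\frac14-\frac{\kappa}{u}-\frac{1/4-\mu^2}{u^2}\big)W$ with $W_{\kappa,\mu}(u)\sim u^\kappa e^{-u/2}$ as $u\to+\infty$); $i=\sqrt{-1}$. *)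

(* Defs.v *)
From HB Require Import structures.
From mathcomp Require Import all_boot all_order all_algebra.
From mathcomp Require Import all_classical all_reals all_analysis.
From mathcomp Require Import complex.

Set Implicit Arguments.
Unset Strict Implicit.
Unset Printing Implicit Defensive.

Import Order.TTheory GRing.Theory Num.Theory.
Import numFieldNormedType.Exports.

Local Open Scope classical_set_scope.
Local Open Scope ring_scope.
Local Open Scope complex_scope.

(* MathComp-Analysis does not make R[i] a normed space over R, so derivatives
   and integrals of maps R -> R[i] are taken on real and imaginary parts; the
   limits of such maps below are limits in the field topology of R[i], which the
   library puts on R[i]^o. *)

Section Complex_valued.
Context {R : realType}.
Implicit Types (f : R -> R[i]) (x : R) (z : R[i]) (D : set R).

Definition cosh x : R := (expR x + expR (- x)) / 2.

Definition cexp z : R[i] :=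
  (expR (complex.Re z))%:C *
  (cos (complex.Im z) +i* sin (complex.Im z)).

Definition ccos z : R[i] := (cexp ('i%C * z) + cexp (- ('i%C * z))) / 2.

Definition ccosh z : R[i] := (cexp z + cexp (- z)) / 2.

Definition cderivable f x : Prop :=
  derivable (fun y => complex.Re (f y)) x 1 /\
  derivable (fun y => complex.Im (f y)) x 1.

Definition cderive f x : R[i] :=
  derive1 (fun y => complex.Re (f y)) x +i*
  derive1 (fun y => complex.Im (f y)) x.

(* On an open set, such as the half-line used below, this is twice
   differentiability at every point.                                         *)
Definition ctwice_derivable_on D f : Prop :=
  forall x, D x -> cderivable f x /\ cderivable (cderive f) x.

Definition cintegrable D f : Prop :=
  lebesgue_measure.-integrable D (fun x => (complex.Re (f x))%:E) /\
  lebesgue_measure.-integrable D (fun x => (complex.Im (f x))%:E).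

Definition cintegral D f : R[i] :=
  (\int[lebesgue_measure]_(x in D) complex.Re (f x)) +i*
  (\int[lebesgue_measure]_(x in D) complex.Im (f x)).

End Complex_valued.

Section Special_functions.
Context {R : realType}.
Implicit Types (x u : R) (nu kappa mu : R[i]) (W : R -> R[i]).

(* K_nu(x) = int_0^oo exp(- x cosh t) cosh(nu t) dt for x > 0 and every complex
   order nu (the integral converges absolutely).                             *)
Definition macdonaldK nu x : R[i] :=
  cintegral `[0, +oo[ (fun t => (expR (- (x * cosh t)))%:C * ccosh (nu * t%:C)).

(* u ^ kappa is exp (kappa ln u). The solution is unique on u > 0: solutions
   independent of it grow like u ^ (- kappa) exp (u / 2). The last clause only
   fixes the values of the total function W outside its domain.              *)
Definition is_whittakerW kappa mu W : Prop :=
  [/\ ctwice_derivable_on `]0, +oo[ W,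
      (forall u, 0 < u ->
         cderive (cderive W) u =
         (4^-1 - kappa / u%:C - (4^-1 - mu ^+ 2) / u%:C ^+ 2) * W u),
      W u / (cexp (kappa * (ln u)%:C) * (expR (- (u / 2)))%:C)
        @[u --> +oo] --> (1 : R[i]^o) &
      (forall u, u <= 0 -> W u = 0)].

Definition whittakerW kappa mu : R -> R[i] :=
  xget (fun=> 0) [set W | is_whittakerW kappa mu W].

End Special_functions.

Section Macdonald_kernel.
Context {R : realType}.
Implicit Types (u v : R) (nu : R[i]) (f : R -> R[i]).

Definition macdonald_kernel_offdiag nu u v : R[i] :=
  (Num.sqrt (u * v))%:C * ccos (pi%:C * nu) / pi%:C ^+ 2 *
  ((u%:C * macdonaldK (nu + 1) (u / 2) * macdonaldK nu (v / 2) -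
    v%:C * macdonaldK (nu + 1) (v / 2) * macdonaldK nu (u / 2)) /
   (u%:C ^+ 2 - v%:C ^+ 2)).

Definition macdonald_kernel nu u v : R[i] :=
  if u == v then lim ((macdonald_kernel_offdiag nu u w : R[i]^o) @[w --> u^'])
  else macdonald_kernel_offdiag nu u v.

Definition macdonald_op nu f u : R[i] :=
  cintegral `]0, +oo[ (fun v => macdonald_kernel nu u v * f v).

Definition macdonald_diffop f u : R[i] :=
  - cderive (fun x => (x ^+ 2)%:C * cderive f x) u + (u ^+ 2 / 4)%:C * f u.

End Macdonald_kernel.

(* Main.v *)
Require Import Defs.
From HB Require Import structures.
From mathcomp Require Import all_boot all_order all_algebra.
From mathcomp Require Import all_classical all_reals all_analysis.
From mathcomp Require Import measurable_realfun.
From mathcomp Require Import complex.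
From mathcomp Require Import ring lra.

(** The Macdonald function at u / 2 is the integral of exp (- (u / 2) cosh t) c t
    over t > 0, where c t is cosh (r t) for nu = r and cos (s t) for nu = i s.
    Everything therefore takes place in the real numbers. The function
    phi u = sqrt u K_nu (u / 2) solves phi'' = (1/4 + (nu^2 - 1/4) / u^2) phi, and
    comparison with the order 1/2, where the integral is elementary, shows that
    phi u and - 2 phi' u are asymptotic to sqrt pi exp (- u / 2) at infinity. With
    the recurrence K_(nu + 1) = - K_nu' + (nu / x) K_nu, the numerator of the
    kernel becomes, up to a constant factor, the Wronskian of t -> phi (u t) and
    t -> phi (v t) at t = 1, and integrating the derivative of this Wronskian over
    t > 1 gives (Phi_wron, kernelE)
      K (u, v) = cos (pi nu) / (2 pi^2) Phi (u, v),
      Phi (u, v) = int_1^oo phi (u t) phi (v t) dt,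
    a formula without a singularity on the diagonal.

    Commutation. The operator D in the variable u acts on phi (u t) as
    d/dt (1 - t^2) d/dt - (nu^2 - 1/4) / t^2, an operator in t that does not
    involve u and is symmetric on the half-line t > 1, because 1 - t^2 vanishes at
    its end (Phi_commute).

    Eigenfunctions. Let h be the function phi of order i m. A solution of this
    differential equation with the decay of h is determined by its leading term,
    as the Wronskian with h shows (recessive_unique); so the Whittaker function of
    the theorem is h / sqrt pi (whittakerWE), and the equation D f = (m^2 + 1/4) f
    is that of h. The function g = K f again satisfies D g = (m^2 + 1/4) g, by the
    commutation relation and integration by parts in v (eig_ode), and by dominated
    convergence u g (u) / h (u) has a limit at infinity. Hence g is a multiple of
    f, and the limit, computed from the leading behaviour of Phi (u, v) as u tends
    to infinity, is the factor (eig_eq): the eigenvalue is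
      cos (pi nu) / pi^2 times int_0^oo K_nu (v / 2) K_im (v / 2) dv.

    The integral. Fubini's theorem turns it into half the integral of
    c s cos (m t) / (cosh t + cosh s) over the plane (mac_product_integral). Since
    cosh t + cosh s = 2 cosh ((t + s) / 2) cosh ((s - t) / 2), this separates into
    X^2 + Y^2 for real nu and X^2 - Y^2 for imaginary nu (cosh_sum_integral), with
    integrals X and Y over the line against 1 / cosh. They are obtained from
      int exp (al t) / cosh t dt = pi / cos (pi al / 2), al = r + i m, |r| <= 1/2,
    which is proved by moving the line of integration to the height s: the
    integral does not change, and as s tends to pi / 2 the average over the
    heights s and - s concentrates at t = 0 (contour_value). The outcome is
    pi^2 / (cos (pi nu) + cosh (pi m)) (mac_integral_real, mac_integral_imag). *)

Import Order.TTheory GRing.Theory Num.Theory.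
Import numFieldNormedType.Exports.

Local Open Scope classical_set_scope.
Local Open Scope ring_scope.

Notation intble D f := (lebesgue_measure.-integrable D (EFin \o f)).
Notation "\int_ D f" := (Rintegral lebesgue_measure D f)
  (at level 36, D at level 0, f at level 36).

(** * Derivatives and improper integrals *)

Section Derivatives.
Context {R : realType}.
Implicit Types (f g : R -> R) (x a b c : R).

(** A relation rather than an operator: the calculus rules produce the derivative
    in whatever form they like, and has_der_eq turns it into the one wanted. *)
Definition has_der f x a := is_derive (x : R^o) (1 : R^o) (f : R^o -> R^o) a.

Lemma has_der_eq {f x a} b : has_der f x a -> a = b -> has_der f x b.
Proof. by move=> ? <-. Qed.

Lemma derC c x : has_der (fun=> c) x 0.
Proof. exact: is_derive_cst. Qed.

Lemma derX x : has_der (fun y => y) x 1.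
Proof. exact: is_derive_id. Qed.

Lemma derD {f g x a b} : has_der f x a -> has_der g x b ->
  has_der (fun y => f y + g y) x (a + b).
Proof. by move=> ? ?; exact: is_deriveD. Qed.

Lemma derN {f x a} : has_der f x a -> has_der (fun y => - f y) x (- a).
Proof. by move=> ?; exact: is_deriveN. Qed.

Lemma derM {f g x a b} : has_der f x a -> has_der g x b ->
  has_der (fun y => f y * g y) x (a * g x + f x * b).
Proof.
move=> fa gb; apply: has_der_eq; first exact: (is_deriveM fa gb).
by rewrite addrC [a * _]mulrC.
Qed.

Lemma derV {f x a} : f x != 0 -> has_der f x a ->
  has_der (fun y => (f y)^-1) x (- a / f x ^+ 2).
Proof.
move=> f0 fa; apply: has_der_eq; first exact: (is_deriveV f0 fa).
by rewrite /GRing.scale /=; field.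
Qed.

Lemma der_comp {f g x a b} : has_der f (g x) a -> has_der g x b ->
  has_der (fun y => f (g y)) x (a * b).
Proof. by move=> fa gb; exact: is_derive1_comp. Qed.

Lemma der_cont {f x a} : has_der f x a -> {for x, continuous f}.
Proof. by case=> /derivable1_diffP/differentiable_continuous. Qed.

Lemma der_near {f g x a} : (\forall y \near x, f y = g y) ->
  has_der f x a -> has_der g x a.
Proof. by move=> fg fa; exact: near_eq_is_derive fg fa. Qed.

Lemma derX2 x : has_der (fun y => y ^+ 2) x (2 * x).
Proof.
apply: has_der_eq; first exact: (derM (derX x) (derX x)).
by rewrite mul1r mulr1 mulr_natl mulr2n.
Qed.

Lemma der_exp {f x a} : has_der f x a ->
  has_der (fun y => expR (f y)) x (expR (f x) * a).
Proof. by apply: der_comp; exact: is_derive_expR. Qed.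

Lemma der_cos {f x a} : has_der f x a ->
  has_der (fun y => cos (f y)) x (- sin (f x) * a).
Proof. by apply: der_comp; exact: is_derive_cos. Qed.

Lemma der_sin {f x a} : has_der f x a ->
  has_der (fun y => sin (f y)) x (cos (f x) * a).
Proof. by apply: der_comp; exact: is_derive_sin. Qed.

End Derivatives.

Section ImproperIntegrals.
Context {R : realType}.
Implicit Types (f F : R -> R) (D : set R).

Lemma dominated_cvg_Rintegral D (f_ : nat -> R -> R) f (g : R -> R) :
  measurable D ->
  (forall n, measurable_fun D (f_ n)) ->
  (forall x, D x -> f_ n x @[n --> \oo] --> f x) ->
  (forall n x, D x -> `|f_ n x| <= g x) -> intble D g ->
  intble D f /\ \int_ D (f_ n) @[n --> \oo] --> \int_ D f.
Proof.
move=> mD mf ff fg ig.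
have mlim : measurable_fun D f by exact: (measurable_fun_cvg mf ff).
have mf_ n : measurable_fun D (EFin \o f_ n) by exact/measurable_EFinP.
have mf' : measurable_fun D (EFin \o f) by exact/measurable_EFinP.
have cvf : {ae lebesgue_measure, forall x, D x ->
    (EFin \o f_ n) x @[n --> \oo] --> (EFin \o f) x}.
  by apply: aeW => x Dx; apply: cvg_EFin; [exact: nearW|exact: ff].
have domf : {ae lebesgue_measure, forall x n, D x ->
    (`|(EFin \o f_ n) x| <= (EFin \o g) x)%E}.
  by apply: aeW => x n Dx; rewrite /= lee_fin fg.
have [iff _ cv] := @dominated_convergence _ _ R lebesgue_measure D mD _ _ _ mf_ mf' cvf ig domf.
split=> //; apply: fine_cvg; rewrite fineK//.
exact: integrable_fin_num.
Qed.

(** Open intervals, bounded or not, are swept out by compact ones; this turns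
    improper integrals over them into limits of the fundamental theorem. *)
Definition exhausts (a b : nat -> R) D :=
  [/\ {homo a : m n / (m <= n)%N >-> n <= m},
      {homo b : m n / (m <= n)%N >-> m <= n},
      (forall n, a n < b n) & D = \bigcup_n [set` `[a n, b n]]].

Lemma FTC_segment {f F a b} : a < b ->
  (forall x, a <= x <= b -> has_der F x (f x)) ->
  (forall x, a <= x <= b -> {for x, continuous f}) ->
  (\int[lebesgue_measure]_(x in `[a, b]) (f x)%:E = (F b - F a)%:E)%E.
Proof.
move=> ab dF cf; rewrite EFinB; apply: continuous_FTC2 => //.
- apply: continuous_in_subspaceT => x; rewrite inE/= in_itv/= => xab.
  exact: cf.
- split=> [x|  |].
  + by rewrite in_itv/= => /andP[/ltW ax /ltW xb]; case: (dF x); rewrite ?ax.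
  + by apply: cvg_at_right_filter; apply: der_cont; apply: dF; rewrite lexx ltW.
  + by apply: cvg_at_left_filter; apply: der_cont; apply: dF; rewrite lexx ltW.
- move=> x; rewrite in_itv/= => /andP[/ltW ax /ltW xb].
  by rewrite derive1E; apply: derive_val; apply: dF; rewrite ax.
Qed.

Section Exhausted.
Context {a b : nat -> R} {D : set R}.
Hypothesis abD : exhausts a b D.

Lemma exhausts_measurable : measurable D.
Proof. by case: abD => _ _ _ ->; exact: bigcup_measurable. Qed.

Lemma exhausts_sub n x : a n <= x <= b n -> D x.
Proof. by case: abD => _ _ _ -> xab; exists n => //=; rewrite in_itv. Qed.

Lemma exhausts_incl m n : (m <= n)%N -> `[a m, b m] `<=` `[a n, b n].
Proof.
case: abD => da ib _ _ mn x /=; rewrite !in_itv/= => /andP[ax xb].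
by rewrite (le_trans (da _ _ mn) ax) (le_trans xb (ib _ _ mn)).
Qed.

Lemma exhausts_continuous_measurable f :
  (forall x, D x -> {for x, continuous f}) -> measurable_fun D f.
Proof.
move=> cf; case: (abD) => _ _ _ DE; rewrite DE.
apply/measurable_fun_bigcup => // n.
apply: subspace_continuous_measurable_fun => //.
apply: continuous_in_subspaceT => x; rewrite inE/= in_itv/= => xab.
by apply: cf; exact: exhausts_sub xab.
Qed.

(** A nonnegative function with a primitive bounded by M is integrable: its
    integral over each compact interval is at most 2 M, and these increase to the
    integral over D. *)
Lemma integrable_bounded_primitive {f F} (M : R) :
  (forall x, D x -> 0 <= f x) ->
  (forall x, D x -> has_der F x (f x)) ->
  (forall x, D x -> {for x, continuous f}) ->
  (forall x, D x -> `|F x| <= M) -> intble D f.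
Proof.
move=> f0 dF cf FM; have mf := exhausts_continuous_measurable _ cf.
apply/integrableP; split; first exact/measurable_EFinP.
have -> : (\int[lebesgue_measure]_(x in D) `|(EFin \o f) x| =
    \int[lebesgue_measure]_(x in D) (f x)%:E)%E.
  by apply: eq_integral => x /set_mem Dx; rewrite /= ger0_norm// f0.
have fD0 x : D x -> (0 <= (f x)%:E)%E by move=> ?; rewrite lee_fin f0.
have [_ _ lab DE] := abD.
have cvD : (\int[lebesgue_measure]_(x in `[a n, b n]) (f x)%:E)%E @[n --> \oo] -->
    (\int[lebesgue_measure]_(x in D) (f x)%:E)%E.
  rewrite [in X in _ --> X]DE.
  apply: (@ge0_nondecreasing_set_cvg_integral _ (measurableTypeR R) R
    (fun n => [set` `[a n, b n]]) (EFin \o f) lebesgue_measure) => //=.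
  - by move=> m n mn; apply/subsetPset; exact: exhausts_incl.
  - move=> n; apply/measurable_EFinP; apply: measurable_funS mf.
    + exact: exhausts_measurable.
    + by move=> x /=; rewrite in_itv/=; exact: exhausts_sub.
  - by move=> n x /=; rewrite in_itv/= => /exhausts_sub; exact: fD0.
apply: (@le_lt_trans _ _ (M + M)%:E); last exact: ltry.
rewrite -(cvg_lim _ cvD)//.
apply: lime_le.
  apply: ereal_nondecreasing_is_cvgn => m n mn; apply: ge0_subset_integral => //=.
  - apply/measurable_EFinP; apply: measurable_funS mf.
    + exact: exhausts_measurable.
    + by move=> x /=; rewrite in_itv/=; exact: exhausts_sub.
  - by move=> x; rewrite in_itv/= => /exhausts_sub; exact: fD0.
  - exact: exhausts_incl.
near=> n; rewrite (FTC_segment (lab n) (F := F)); first last.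
- by move=> x /exhausts_sub; exact: cf.
- by move=> x /exhausts_sub; exact: dF.
have Dab x : (x = a n) \/ (x = b n) -> `|F x| <= M.
  by case=> ->; apply: FM; apply: (@exhausts_sub n); rewrite lexx ltW.
rewrite lee_fin (le_trans (ler_norm _))// (le_trans (ler_normB _ _))//.
by apply: lerD; apply: Dab; [right|left].
Unshelve. all: by end_near. Qed.

Lemma FTC_exhausted {f F} {l0 l1 : R} : intble D f ->
  (forall x, D x -> has_der F x (f x)) ->
  (forall x, D x -> {for x, continuous f}) ->
  F (a n) @[n --> \oo] --> l0 -> F (b n) @[n --> \oo] --> l1 ->
  \int_ D f = l1 - l0.
Proof.
move=> intf dF cf Fa Fb; have [_ _ lab DE] := abD.
have mf := exhausts_continuous_measurable _ cf.
have mD := exhausts_measurable.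
pose f_ n := f \_ [set` `[a n, b n]].
have mf_ n : measurable_fun D (f_ n).
  apply/(measurable_restrict _ _ _) => //.
  by apply: measurable_funS mf => //; exact: subIsetl.
have ff x : D x -> f_ n x @[n --> \oo] --> f x.
  rewrite DE => -[n _ xab]; apply: cvg_near_cst; exists n => // m /= nm.
  by rewrite /f_ patchE mem_set//; exact: exhausts_incl xab.
have domf n x : D x -> `|f_ n x| <= `|f x|.
  by move=> _; rewrite /f_ patchE; case: ifP => //; rewrite normr0.
have [_ cv] := dominated_cvg_Rintegral D f_ f _ mD mf_ ff domf (integrable_norm intf).
have intn n : \int_ D (f_ n) = F (b n) - F (a n).
  rewrite -Rintegral_mkcondr setIidr; last first.
    by move=> x /=; rewrite in_itv/=; exact: exhausts_sub.
  rewrite /Rintegral (FTC_segment (lab n) (F := F)) //.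
  - by move=> x /exhausts_sub; exact: dF.
  - by move=> x /exhausts_sub; exact: cf.
have cvF : \int_ D (f_ n) @[n --> \oo] --> l1 - l0.
  by under eq_fun do rewrite intn; exact: cvgB.
by rewrite -(cvg_lim _ cvF)// -(cvg_lim _ cv).
Qed.

End Exhausted.

Lemma cvgr_idSn : n.+1%:R @[n --> \oo] --> (+oo : set_system R).
Proof.
have := @cvgr_idn R; rewrite -(cvg_shiftS (fun n => n%:R : R)); exact.
Qed.

Lemma cvgr_idS2n : n.+2%:R @[n --> \oo] --> (+oo : set_system R).
Proof. by have := cvgr_idSn; rewrite -(cvg_shiftS (fun n => n.+1%:R : R)). Qed.

Lemma exhausts_setT : exhausts (fun n => - n.+1%:R) (fun n => n.+1%:R) [set: R].
Proof.
split=> [m n mn|m n mn|n|]; rewrite ?lerN2 ?ler_nat ?ltr_nat//.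
- by rewrite gtrN// ltr0n.
- apply/seteqP; split=> // x _.
  exists (Num.truncn `|x|) => //=; rewrite in_itv/= -ler_norml ltW//.
  exact: truncnS_gt.
Qed.

(** The right ends are a + n + 2 so that they exceed the left ends, which are at
    most a + 1. *)
Lemma exhausts_oy (a : R) :
  exhausts (fun n => a + n.+1%:R^-1) (fun n => a + n.+2%:R) `]a, +oo[.
Proof.
split=> [m n mn|m n mn|n|].
- by rewrite lerD2l lef_pV2 ?posrE ?ltr0n// ler_nat.
- by rewrite lerD2l ler_nat.
- rewrite ltrD2l (@le_lt_trans _ _ 1)// ?invf_le1 ?ltr0n ?ler1n//.
  by rewrite ltr1n.
- apply/seteqP; split=> x /=; rewrite in_itv/= ?andbT.
    move=> ax; exists (maxn (Num.truncn (x - a)^-1) (Num.truncn (x - a))) => //=.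
    have xa : 0 < x - a by rewrite subr_gt0.
    rewrite in_itv/= -lerBrDl -(lerBlDl _ a); apply/andP; split.
      rewrite -[leRHS]invrK lef_pV2 ?posrE ?invr_gt0 ?ltr0n//.
      apply: (le_trans (ltW (truncnS_gt _))).
      by rewrite ler_nat ltnS leq_maxl.
    apply: (le_trans (ltW (truncnS_gt _))).
    by rewrite ler_nat ltnS ltnW// ltnS leq_maxr.
  move=> [n _ /=]; rewrite in_itv/= => /andP[+ _].
  by apply: lt_le_trans; rewrite ltrDl invr_gt0 ltr0n.
Qed.

Lemma FTC_line {f F} (l0 l1 : R) : intble setT f ->
  (forall x, has_der F x (f x)) -> continuous f ->
  F x @[x --> -oo] --> l0 -> F x @[x --> +oo] --> l1 -> \int_ setT f = l1 - l0.
Proof.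
move=> intf dF cf F0 F1; apply: (FTC_exhausted exhausts_setT intf (F := F)).
- by move=> x _; exact: dF.
- by move=> x _; exact: cf.
- apply: cvg_comp F0; apply/cvgNrNy.
  exact: cvgr_idSn.
- by apply: cvg_comp F1; exact: cvgr_idSn.
Qed.

Lemma FTC_halfline {f F} (a l0 l1 : R) : intble `]a, +oo[ f ->
  (forall x, a < x -> has_der F x (f x)) ->
  (forall x, a < x -> {for x, continuous f}) ->
  F x @[x --> a^'+] --> l0 -> F x @[x --> +oo] --> l1 ->
  \int_ `]a, +oo[ f = l1 - l0.
Proof.
move=> intf dF cf F0 F1; apply: (FTC_exhausted (exhausts_oy a) intf (F := F)).
- by move=> x /=; rewrite in_itv/= andbT; exact: dF.
- by move=> x /=; rewrite in_itv/= andbT; exact: cf.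
- move/cvg_at_rightP : F0; apply; split=> [n|].
    by rewrite ltrDl invr_gt0 ltr0n.
  rewrite -[X in _ --> X]addr0; apply: cvgD; [exact: cvg_cst|].
  exact: cvg_harmonic.
- apply: cvg_comp F1; apply: cvg_comp (cvg_addrl _).
  exact: cvgr_idS2n.
Qed.

End ImproperIntegrals.

(** * Parameter integrals, Fubini's theorem, substitution *)

Section IntegralTools.
Context {R : realType}.
Implicit Types (f g A B : R -> R) (D : set R).

Lemma integrable_dom {D f} g : measurable D -> measurable_fun D f ->
  (forall x, D x -> `|f x| <= g x) -> intble D g -> intble D f.
Proof.
move=> mD mf fg; apply: le_integrable => //; first exact/measurable_EFinP.
by move=> x Dx; rewrite /= lee_fin (le_trans (fg _ Dx))// ler_norm.
Qed.

Lemma measurable_halfline {f} (a : R) :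
  (forall x, a < x -> {for x, continuous f}) -> measurable_fun `]a, +oo[ f.
Proof.
move=> cf; apply: (exhausts_continuous_measurable (exhausts_oy a)) => x /=.
by rewrite in_itv/= andbT; exact: cf.
Qed.

Lemma intbleD {D f g} : measurable D -> intble D f -> intble D g ->
  intble D (fun x => f x + g x).
Proof.
move=> mD; exact: (@integrableD _ _ _ lebesgue_measure D mD (EFin \o f) (EFin \o g)).
Qed.

Lemma intbleZ {D f} (k : R) : measurable D -> intble D f ->
  intble D (fun x => k * f x).
Proof.
move=> mD; exact: (@integrableZl _ _ _ lebesgue_measure D mD k (EFin \o f)).
Qed.

Lemma intbleN {D f} : measurable D -> intble D f -> intble D (fun x => - f x).
Proof. by move=> mD; exact: (@integrableN _ _ _ lebesgue_measure D (EFin \o f)). Qed.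

Lemma intbleB {D f g} : measurable D -> intble D f -> intble D g ->
  intble D (fun x => f x - g x).
Proof. by move=> mD fi gi; apply: intbleD => //; exact: intbleN. Qed.

Lemma Rint_add {D f g} : measurable D -> intble D f -> intble D g ->
  \int_ D (fun x => f x + g x) = \int_ D f + \int_ D g.
Proof. move=> mD; exact: (@RintegralD _ _ _ lebesgue_measure D f g mD). Qed.

Lemma Rint_sub {D f g} : measurable D -> intble D f -> intble D g ->
  \int_ D (fun x => f x - g x) = \int_ D f - \int_ D g.
Proof. move=> mD; exact: (@RintegralB _ _ _ lebesgue_measure D f g mD). Qed.

Lemma Rint_scale {D f} (k : R) : measurable D -> intble D f ->
  \int_ D (fun x => k * f x) = k * \int_ D f.
Proof. by move=> mD fi; exact: (@RintegralZl _ _ _ lebesgue_measure D f k mD fi). Qed.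

Lemma norm_Rintegral_le {D f g} : measurable D -> intble D f -> intble D g ->
  (forall x, D x -> `|f x| <= g x) -> `|\int_ D f| <= \int_ D g.
Proof.
move=> mD fi gi fg; apply: (le_trans (le_normr_Rintegral _ _)) => //.
by apply: le_Rintegral => //; exact: integrable_norm fi.
Qed.

(** Differentiation under the integral sign, restated for has_der,
    so that the derivative of the integrand is supplied by the calculus rules. *)
Lemma der_under_integral {D} {f df : R -> R -> R} {G} (u v : R) {a} :
  measurable D -> u < a < v ->
  (forall x, u < x < v -> intble D (f x)) ->
  (forall x y, u < x < v -> D y -> has_der (f^~ y) x (df x y)) ->
  (forall x y, u < x < v -> D y -> `|df x y| <= G y) -> intble D G ->
  has_der (fun x => \int_ D (f x)) a (\int_ D (df a)).
Proof.
move=> mD auv fi fd dfG Gi.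
have d1 x y : u < x < v -> D y -> partial1of2 f x y = df x y.
  by move=> xuv Dy; rewrite partial1of2E; apply: derive_val; exact: fd.
have Ia : [set` `]u, v[%R] a by rewrite /= in_itv.
have H1 x : [set` `]u, v[%R] x -> intble D (f x).
  by rewrite /= in_itv; exact: fi.
have H2 x y : [set` `]u, v[%R] x -> D y -> derivable (f ^~ y) x 1.
  by rewrite /= in_itv/= => xuv Dy; case: (fd x y xuv Dy).
have G0 y : 0 <= `|G y| by [].
have iG : intble D (fun y => `|G y|) by exact: integrable_norm Gi.
have H3 x y : [set` `]u, v[%R] x -> D y -> `|partial1of2 f x y| <= `|G y|.
  rewrite /= in_itv/= => xuv Dy; rewrite d1//.
  by apply: le_trans (ler_norm _); exact: dfG.
have E := @differentiation_under_integral R _ (measurableTypeR R) lebesgue_measure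
  _ _ mD _ _ _ Ia H1 H2 _ G0 iG H3.
have K := @derivable_under_integral R _ (measurableTypeR R) lebesgue_measure
  _ _ mD _ _ _ Ia H1 H2 _ G0 iG H3.
apply: DeriveDef => //; rewrite -derive1E E.
by apply: eq_Rintegral => y /set_mem Dy; exact: d1.
Qed.

(** Fubini's theorem for real-valued iterated integrals. The majorant B of the
    inner integrals of |F| gives integrability on the plane, by Tonelli. *)
Lemma Rintegral_swap {F : R -> R -> R} {B} :
  measurable_fun [set: measurableTypeR R * measurableTypeR R]
    (fun z => F z.1 z.2) ->
  (forall y, (\int[lebesgue_measure]_(x in [set: R]) `|F x y|%:E <= (B y)%:E)%E) ->
  intble [set: R] B ->
  \int_ [set: R] (fun x => \int_ [set: R] (F x)) =
  \int_ [set: R] (fun y => \int_ [set: R] (F^~ y)).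
Proof.
move=> mF FB iB.
pose T := measurableTypeR R.
pose m : {sigma_finite_measure set T -> \bar R} := @lebesgue_measure R.
pose f := EFin \o (fun z : T * T => F z.1 z.2).
have mf : measurable_fun setT f by exact/measurable_EFinP.
have mnf : measurable_fun setT (abse \o f) by exact: measurableT_comp.
have mG := @measurable_fun_fubini_tonelli_G _ _ T T R m (abse \o f) mnf
  (fun=> abse_ge0 _).
have iF : (m \x m)%E.-integrable setT f.
  apply: (proj2 (@integrable21ltyP _ _ T T R m m f mf)).
  apply: (@le_lt_trans _ _ (\int[m]_y `|B y|%:E)%E); last first.
    by have /integrableP[_] := iB.
  apply: ge0_le_integral => //=.
  - by move=> y _; apply: integral_ge0.
  - apply/measurable_EFinP; apply: measurableT_comp => //.
    by apply/measurable_EFinP; have /integrableP[] := iB.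
  - move=> y _; apply: le_trans (FB y) _; rewrite lee_fin; exact: ler_norm.
have key := Fubini iF.
have m1 := measurable_fubini_F iF; have m2 := measurable_fubini_G iF.
rewrite /Rintegral; congr fine.
transitivity (\int[m]_x \int[m]_y f (x, y))%E.
  apply: ae_eq_integral => //.
    by apply/measurable_EFinP; apply: measurableT_comp.
  have := ae_integrable1 iF; apply: filterS => x ix _ /=.
  by rewrite fineK//; exact: integrable_fin_num.
rewrite key; apply: ae_eq_integral => //.
  by apply/measurable_EFinP; apply: measurableT_comp.
have := ae_integrable2 iF; apply: filterS => x ix _ /=.
by rewrite fineK//; exact: integrable_fin_num.
Qed.

Lemma intble_restrict {D f} : measurable D -> intble D f ->
  intble [set: R] (f \_ D).
Proof.
move=> mD fi; have -> : EFin \o (f \_ D) = (EFin \o f) \_ D.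
  by rewrite restrict_EFin.
exact: (proj1 (@integrable_mkcond _ (measurableTypeR R) R lebesgue_measure D _ mD)).
Qed.

(** The dominated form of Fubini's theorem for a majorant in product form. *)
Lemma Rintegral_swap_dom {D1 D2} {F : R -> R -> R} {A B} :
  measurable D1 -> measurable D2 ->
  measurable_fun [set: measurableTypeR R * measurableTypeR R]
    (fun z => F z.1 z.2) ->
  (forall x y, D1 x -> D2 y -> `|F x y| <= A x * B y) ->
  intble D1 A -> intble D2 B ->
  (forall x, D1 x -> 0 <= A x) -> (forall y, D2 y -> 0 <= B y) ->
  \int_ D1 (fun x => \int_ D2 (F x)) = \int_ D2 (fun y => \int_ D1 (F^~ y)).
Proof.
move=> mD1 mD2 mF FAB iA iB A0 B0.
pose A' := A \_ D1; pose B' := B \_ D2.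
have iA' : intble [set: R] A'.
  exact: intble_restrict.
have iB' : intble [set: R] B'.
  exact: intble_restrict.
pose F' x y := \1_D1 x * (\1_D2 y * F x y).
pose K := \int_ [set: R] A'.
have mF' : measurable_fun [set: measurableTypeR R * measurableTypeR R]
    (fun z => F' z.1 z.2).
  by do 2 (apply: measurable_funM => //; first exact: measurableT_comp).
have A'0 x : 0 <= A' x.
  by rewrite /A' patchE; case: ifPn => // /set_mem; exact: A0.
have B'0 x : 0 <= B' x.
  by rewrite /B' patchE; case: ifPn => // /set_mem; exact: B0.
have F'AB x y : `|F' x y| <= A' x * B' y.
  rewrite /F' /A' /B' !patchE !indicE; case: ifPn => [/set_mem D1x|]; last first.
    by rewrite !mul0r normr0.
  case: ifPn => [/set_mem D2y|]; last by rewrite mul0r !mulr0 normr0.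
  by rewrite !mul1r FAB.
have mA' : measurable_fun setT (EFin \o A') by have /integrableP[] := iA'.
have -> : \int_ D1 (fun x => \int_ D2 (F x)) =
    \int_ [set: R] (fun x => \int_ [set: R] (F' x)).
  rewrite Rintegral_mkcond; apply: eq_Rintegral => x _; rewrite patchE.
  case: ifPn => D1x; last first.
    under eq_Rintegral do rewrite /F' indicE (negbTE D1x) mul0r.
    by rewrite Rintegral_cst// mul0r.
  rewrite Rintegral_mkcond; apply: eq_Rintegral => y _.
  rewrite /F' patchE !indicE D1x mul1r; case: ifPn => _; by rewrite ?mul1r ?mul0r.
have -> : \int_ D2 (fun y => \int_ D1 (F^~ y)) =
    \int_ [set: R] (fun y => \int_ [set: R] (F'^~ y)).
  rewrite Rintegral_mkcond; apply: eq_Rintegral => y _; rewrite patchE.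
  case: ifPn => D2y; last first.
    under eq_Rintegral do rewrite /F' [\1_D2 _]indicE (negbTE D2y) mul0r mulr0.
    by rewrite Rintegral_cst// mul0r.
  rewrite Rintegral_mkcond; apply: eq_Rintegral => x _.
  rewrite /F' patchE !indicE D2y mul1r; case: ifPn => _; by rewrite ?mul1r ?mul0r.
apply: (@Rintegral_swap _ (fun y => K * B' y)) => //; last exact: intbleZ.
move=> y.
have -> : (K * B' y)%:E = (\int[lebesgue_measure]_(x in [set: R]) (A' x * B' y)%:E)%E.
  rewrite EFinM /K /Rintegral fineK; last exact: integrable_fin_num.
  by rewrite -integralZr//.
apply: ge0_le_integral => //=.
- apply/measurable_EFinP; apply: measurableT_comp => //.
  exact: (measurableT_comp mF' (pair2_measurable y)).
- apply/measurable_EFinP; apply: measurable_funM => //.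
  exact/measurable_EFinP.
- by move=> x _; rewrite lee_fin.
Qed.

Lemma ge0_integral_affine {f} (a b : R) : 0 < a -> continuous f ->
  (forall x, 0 <= f x) ->
  (\int[lebesgue_measure]_x (f x)%:E =
   \int[lebesgue_measure]_x (f (a * x + b) * a)%:E)%E.
Proof.
move=> a0 cf f0; pose F x := a * x + b.
have dF x : has_der F x a.
  apply: has_der_eq; first exact: (derD (derM (derC a x) (derX x)) (derC b x)).
  by rewrite mul0r add0r mulr1 addr0.
have dF1 : derive1 F = fun=> a.
  by apply/funext => x; rewrite derive1E; apply: derive_val; exact: dF.
rewrite (@increasing_ge0_integration_by_substitutionT _ F f) ?dF1//.
- by move=> x y xy; rewrite ltrD2r ltr_pM2l.
- by move=> x; exact: cvg_cst.
- exact: is_cvg_cst.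
- exact: is_cvg_cst.
- apply: (cvg_comp (fun x => a * x) (fun x => x + b)); last exact: cvg_addrr_Ny.
  by apply: gt0_cvgMrNy => //; exact: cvg_id.
- apply: (cvg_comp (fun x => a * x) (fun x => x + b)); last exact: cvg_addrr.
  by apply: gt0_cvgMry => //; exact: cvg_id.
Qed.

(** Both sides are split at 0, where the substitution theorem applies to each of
    the two half-lines. *)
Lemma ge0_integral_reflect {f} : continuous f -> (forall x, 0 <= f x) ->
  (\int[lebesgue_measure]_x (f x)%:E = \int[lebesgue_measure]_x (f (- x))%:E)%E.
Proof.
move=> cf f0.
have cfN : continuous (fun x => f (- x)).
  by move=> x; apply: (@continuous_comp _ _ _ -%R f); [exact: opp_continuous|exact: cf].
have H g : continuous g -> (forall x, 0 <= g x) ->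
    (\int[lebesgue_measure]_x (g x)%:E =
     \int[lebesgue_measure]_(x in `[0%R, +oo[) (g (- x))%:E +
     \int[lebesgue_measure]_(x in `[0%R, +oo[) (g x)%:E)%E.
  move=> cg g0; have mg : measurable_fun setT g by exact: continuous_measurable_fun.
  rewrite -{1}(set_itvNyy R) (@itv_bndbnd_setU _ _ _ (BLeft 0))//.
  rewrite ge0_integral_setU//=.
  - congr (_ + _)%E.
    rewrite integral_itv_bndo_bndc; last exact/measurable_EFinP/measurable_funTS.
    rewrite -{1}oppr0 ge0_integration_by_substitutionNy//.
    exact: continuous_subspaceT.
  - by apply/measurable_EFinP; apply: measurable_funTS.
  - by move=> x _; rewrite lee_fin.
  - rewrite disj_set2E; apply/eqP; rewrite -subset0 => x /= [].
    rewrite !in_itv/= andbT => x0 x1.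
    by have := lt_le_trans x0 x1; rewrite ltxx.
rewrite (H f)// (H (fun x => f (- x)))// addeC; congr (_ + _)%E.
by apply: eq_integral => x _; rewrite opprK.
Qed.

(** A substitution rule proved for nonnegative integrands extends to signed
    ones through f = |f| - (|f| - f), whose two terms are continuous. *)
Lemma Rintegral_subst_signed {f} (s : R -> R) (k : R) : continuous s ->
  (forall g : R -> R, continuous g -> (forall x, 0 <= g x) ->
   (\int[lebesgue_measure]_x (g x)%:E =
    \int[lebesgue_measure]_x (g (s x) * k)%:E)%E) ->
  continuous f -> intble [set: R] f -> 0 <= k ->
  \int_ [set: R] f = \int_ [set: R] (fun x => f (s x) * k) /\
  intble [set: R] (fun x => f (s x) * k).
Proof.
move=> cs subst cf fi k0.
pose p x := `|f x|; pose q x := `|f x| - f x.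
have cp : continuous p.
  by move=> x; apply: (@continuous_comp _ _ _ f); [exact: cf|exact: norm_continuous].
have cq : continuous q by move=> x; apply: cvgB; [exact: cp|exact: cf].
have p0 x : 0 <= p x by exact: normr_ge0.
have q0 x : 0 <= q x by rewrite subr_ge0 ler_norm.
have pi_ : intble [set: R] p by exact: integrable_norm fi.
have qi : intble [set: R] q by exact: intbleB.
have half g : continuous g -> (forall x, 0 <= g x) -> intble [set: R] g ->
    intble [set: R] (fun x => g (s x) * k).
  move=> cg g0 /integrableP[_ gi]; apply/integrableP; split.
    apply/measurable_EFinP; apply: measurable_funM => //.
    apply: continuous_measurable_fun => x.
    by apply: (@continuous_comp _ _ _ s g); [exact: cs|exact: cg].
  move: gi; congr (_ < _)%E; rewrite (_ : (fun x => `|(EFin \o g) x|)%E = EFin \o g).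
    rewrite (subst g)//; apply: eq_integral => x _ /=.
    by rewrite ger0_norm// mulr_ge0.
  by apply/funext => x /=; rewrite ger0_norm.
have fpq x : f (s x) * k = p (s x) * k - q (s x) * k by rewrite /p /q; ring.
have pis := half _ cp p0 pi_; have qis := half _ cq q0 qi.
split; last first.
  by rewrite (_ : (fun x => _) = fun x => p (s x) * k - q (s x) * k);
    [exact: intbleB|exact/funext].
under [RHS]eq_Rintegral do rewrite fpq.
rewrite RintegralB// /Rintegral -(subst p)// -(subst q)//.
rewrite -[LHS]/(\int_ [set: R] f) -[X in _ = X - _]/(\int_ [set: R] p).
rewrite -[X in _ = _ - X]/(\int_ [set: R] q) -RintegralB//.
by apply: eq_Rintegral => x _; rewrite /p /q; ring.
Qed.

Lemma Rintegral_affine {f} (a b : R) : 0 < a -> continuous f ->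
  intble [set: R] f ->
  \int_ [set: R] f = \int_ [set: R] (fun x => f (a * x + b) * a).
Proof.
move=> a0 cf fi; apply: (Rintegral_subst_signed (fun x => a * x + b) a _ _ _ _ _).1
  => //; last exact: ltW.
- move=> x; apply: der_cont; exact: (derD (derM (derC a x) (derX x)) (derC b x)).
- by move=> g cg g0; exact: ge0_integral_affine.
Qed.

Lemma Rintegral_reflect {f} : continuous f -> intble [set: R] f ->
  \int_ [set: R] f = \int_ [set: R] (fun x => f (- x)).
Proof.
move=> cf fi.
have subst (g : R -> R) : continuous g -> (forall x, 0 <= g x) ->
   (\int[lebesgue_measure]_x (g x)%:E =
    \int[lebesgue_measure]_x (g (- x) * 1)%:E)%E.
  move=> cg g0; rewrite ge0_integral_reflect//.
  by apply: eq_integral => x _; rewrite mulr1.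
have cN : continuous (-%R : R -> R) by move=> x; exact: opp_continuous.
rewrite (Rintegral_subst_signed -%R 1 cN subst cf fi ler01).1.
by apply: eq_Rintegral => x _; rewrite mulr1.
Qed.

Lemma Rintegral_odd {f} : continuous f -> intble [set: R] f ->
  (forall x, f (- x) = - f x) -> \int_ [set: R] f = 0.
Proof.
move=> cf fi fN; have := Rintegral_reflect cf fi.
under [RHS]eq_Rintegral do rewrite fN -mulN1r.
rewrite RintegralZl// mulN1r => /eqP; rewrite -addr_eq0 -mulr2n mulrn_eq0/=.
by move/eqP.
Qed.

End IntegralTools.

(** * Hyperbolic functions and exponential bounds *)

Section Hyperbolic.
Context {R : realType}.
Implicit Types x y t : R.

Definition sinh x : R := (expR x - expR (- x)) / 2.

Lemma cosh_cont : continuous (@cosh R).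
Proof.
by move=> x; apply: cvgM; [apply: cvgD|exact: cvg_cst];
  [exact: continuous_expR|apply: (@continuous_comp _ _ _ -%R expR);
  [exact: opp_continuous|exact: continuous_expR]].
Qed.

Lemma der_cosh {f x a} : has_der f x a ->
  has_der (fun y => cosh (f y)) x (sinh (f x) * a).
Proof.
move=> fa; apply: has_der_eq.
  exact: (derM (derD (der_exp fa) (der_exp (derN fa))) (derC 2^-1 x)).
by rewrite /sinh; field.
Qed.

Lemma der_sinh {f x a} : has_der f x a ->
  has_der (fun y => sinh (f y)) x (cosh (f x) * a).
Proof.
move=> fa; apply: has_der_eq.
  exact: (derM (derD (der_exp fa) (derN (der_exp (derN fa)))) (derC 2^-1 x)).
by rewrite /cosh; field.
Qed.

Lemma coshN x : cosh (- x) = cosh x.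
Proof. by rewrite /cosh opprK addrC. Qed.

Lemma sinhN x : sinh (- x) = - sinh x.
Proof. by rewrite /sinh opprK -mulNr opprB. Qed.

Lemma cosh0 : cosh (0 : R) = 1.
Proof. by rewrite /cosh oppr0 expR0; lra. Qed.

Lemma sinh0 : sinh 0 = 0.
Proof. by rewrite /sinh oppr0 subrr mul0r. Qed.

Lemma coshD x y : cosh (x + y) = cosh x * cosh y + sinh x * sinh y.
Proof. by rewrite /cosh /sinh opprD !expRD; field. Qed.

Lemma sinhD x y : sinh (x + y) = sinh x * cosh y + cosh x * sinh y.
Proof. by rewrite /cosh /sinh opprD !expRD; field. Qed.

Lemma cosh2_sinh2 x : cosh x ^+ 2 - sinh x ^+ 2 = 1.
Proof.
have e : expR x * expR (- x) = 1 by rewrite -expRD subrr expR0.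
have -> : cosh x ^+ 2 - sinh x ^+ 2 = expR x * expR (- x).
  by rewrite /cosh /sinh; field.
by [].
Qed.

Lemma coshE_half x : cosh x = 2 * cosh (x / 2) ^+ 2 - 1.
Proof.
have -> : cosh x = cosh (x / 2 + x / 2) by congr cosh; field.
by rewrite coshD -!expr2; have := cosh2_sinh2 (x / 2); lra.
Qed.

Lemma cosh_dup x : cosh (2 * x) = 2 * cosh x ^+ 2 - 1.
Proof. by rewrite coshE_half; congr (2 * cosh _ ^+ 2 - 1); field. Qed.

Lemma coshE_half_sinh x : cosh x = 1 + 2 * sinh (x / 2) ^+ 2.
Proof. by rewrite coshE_half; have := cosh2_sinh2 (x / 2); lra. Qed.

Lemma cosh_ge1 x : 1 <= cosh x.
Proof. by rewrite coshE_half_sinh lerDl mulr_ge0// sqr_ge0. Qed.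

Lemma cosh_gt0 x : 0 < cosh x.
Proof. exact: lt_le_trans (cosh_ge1 x). Qed.

Lemma cosh_neq0 x : cosh x != 0.
Proof. by rewrite gt_eqF// cosh_gt0. Qed.

Lemma sinh_ge x : 0 <= x -> x <= sinh x.
Proof.
move=> x0; pose f y : R := sinh y - y.
have df y : has_der f y (cosh y - 1).
  apply: has_der_eq; first exact: (derD (der_sinh (derX y)) (derN (derX y))).
  by rewrite mulr1.
have : f 0 <= f x.
  move: x0; rewrite le_eqVlt => /predU1P[<-//|x0].
  have [c _] := MVT x0 (fun y _ => df y)
    (derivable_within_continuous (fun y _ => let: DeriveDef h _ := df y in h)).
  rewrite subr0 => fE; rewrite -subr_ge0 fE mulr_ge0 ?(ltW x0)//.
  by rewrite subr_ge0 cosh_ge1.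
by rewrite /f sinh0 subr0 subr_ge0.
Qed.

Lemma sqr_sinh_ge x : x ^+ 2 <= sinh x ^+ 2.
Proof.
wlog x0 : x / 0 <= x => [H|].
  by have [/H//|/ltW x0] := leP 0 x; rewrite -sqrrN -[leRHS]sqrrN -sinhN;
    apply: H; rewrite oppr_ge0.
by rewrite lerXn2r ?nnegrE//; [apply: le_trans (sinh_ge _ x0)|exact: sinh_ge].
Qed.

(** A quadratic lower bound is all the growth of cosh that integrability on the
    line requires. *)
Lemma cosh_ge x : 1 + x ^+ 2 / 2 <= cosh x.
Proof.
rewrite coshE_half_sinh lerD2l; have := sqr_sinh_ge (x / 2).
by rewrite expr_div_n; lra.
Qed.

Lemma cosh_half_sqr x : cosh (x / 2) ^+ 2 <= cosh x.
Proof. by have := cosh_ge1 (x / 2); rewrite (coshE_half x); nra. Qed.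

Lemma cosh_le_sqr x : cosh x <= 2 * cosh (x / 2) ^+ 2.
Proof. by rewrite (coshE_half x); lra. Qed.

Lemma cosh_half_le x : cosh (x / 2) <= cosh x.
Proof.
by apply: le_trans (cosh_half_sqr x); rewrite expr2 ler_peMl// ?cosh_ge1// ltW ?cosh_gt0.
Qed.

Lemma cosh_abs_le x y : `|x| <= `|y| -> cosh x <= cosh y.
Proof.
move=> xy; suff H (a b : R) : 0 <= a -> a <= b -> cosh a <= cosh b.
  have E (z : R) : cosh z = cosh `|z|.
    by have [z0|z0] := leP 0 z; rewrite ?(ger0_norm z0)// (ltr0_norm z0) coshN.
  by rewrite (E x) (E y); exact: H.
move=> a0 ab; have -> : cosh b = cosh ((b + a) / 2 + (b - a) / 2).
  by congr cosh; field.
have -> : cosh a = cosh ((b + a) / 2 - (b - a) / 2) by congr cosh; field.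
rewrite !coshD coshN sinhN mulrN lerD2l.
have s0 z : 0 <= z -> 0 <= sinh z by move=> z0; exact: le_trans (sinh_ge _ z0).
have := s0 ((b + a) / 2); have := s0 ((b - a) / 2).
move=> /(_ ltac:(lra)) h1 /(_ ltac:(lra)) h2.
by have := mulr_ge0 h2 h1; lra.
Qed.

Lemma sinh_abs_le x : `|sinh x| <= cosh x.
Proof.
rewrite -(ger0_norm (ltW (cosh_gt0 x))) -ler_sqr ?nnegrE// !real_normK ?num_real//.
by have := cosh2_sinh2 x; lra.
Qed.

(** The elementary majorant in which all integrals over the line are compared:
    the hyperbolic cosine of t / 4 beats a quadratic polynomial. *)
Lemma one_sqr_le_cosh t : 1 + t ^+ 2 <= 32 * cosh (t / 4).
Proof. by have := cosh_ge (t / 4); rewrite expr_div_n; nra. Qed.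

Lemma integrable_cauchy : intble [set: R] (fun t => (1 + t ^+ 2)^-1).
Proof.
apply: (integrable_bounded_primitive exhausts_setT (F := atan) (pi / 2)).
- by move=> x _; rewrite invr_ge0 addr_ge0 ?sqr_ge0.
- by move=> x _; exact: is_derive1_atan.
- move=> x _; apply: cvgV; first by rewrite gt_eqF// ltr_pwDl// sqr_ge0.
  by apply: cvgD; [exact: cvg_cst|exact: exprn_continuous].
- by move=> x _; rewrite ler_norml !ltW// ?atan_gtNpi2 ?atan_ltpi2.
Qed.

Lemma integrable_le_sech {f : R -> R} (M : R) : measurable_fun [set: R] f ->
  (forall t, `|f t| <= M / cosh (t / 4)) -> intble [set: R] f.
Proof.
move=> mf fM.
apply: (integrable_dom (fun t => (M * 32) * (1 + t ^+ 2)^-1)) => //; last first.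
  by apply: intbleZ => //; exact: integrable_cauchy.
move=> t _; apply: le_trans (fM t) _; rewrite -mulrA ler_wpM2l//.
  have := le_trans (normr_ge0 _) (fM t).
  by rewrite pmulr_lge0// invr_gt0 cosh_gt0.
rewrite -[leLHS]mul1r ler_pdivrMr ?cosh_gt0// mulrAC ler_pdivlMr.
  by rewrite mul1r one_sqr_le_cosh.
by rewrite ltr_pwDl// sqr_ge0.
Qed.

Lemma half_over_cosh x : cosh (x / 2) / cosh x <= (cosh (x / 4))^-1.
Proof.
rewrite ler_pdivrMr ?cosh_gt0// [leRHS]mulrC ler_pdivlMr ?cosh_gt0//.
apply: le_trans (cosh_half_sqr x); rewrite expr2 ler_wpM2l ?(ltW (cosh_gt0 _))//.
by have -> : x / 4 = x / 2 / 2 by [field]; exact: cosh_half_le.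
Qed.

Lemma over_cosh_sum_int {f : R -> R} t : continuous f ->
  (forall s, `|f s| <= cosh (s / 2)) ->
  intble [set: R] (fun s => f s / (cosh t + cosh s)).
Proof.
move=> cf fle; have C0 s : 0 < cosh t + cosh s by rewrite addr_gt0 ?cosh_gt0.
apply: (integrable_le_sech 1).
  apply: continuous_measurable_fun => s; apply: cvgM; first exact: cf.
  apply: cvgV; first exact: lt0r_neq0.
  by apply: cvgD; [exact: cvg_cst|exact: cosh_cont].
move=> s; rewrite mul1r; apply: le_trans (half_over_cosh s).
rewrite normrM normfV (gtr0_norm (C0 s)); apply: ler_pM => //.
  by rewrite invr_ge0 ltW.
by rewrite lef_pV2 ?posrE ?cosh_gt0// lerDr ltW// cosh_gt0.
Qed.

(** The same majorant also controls the boundary terms. *)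
Lemma vanish_le_sech {F : R -> R} {K : R} : (forall t, `|F t| <= K / cosh (t / 4)) ->
  F t @[t --> +oo] --> 0 /\ F t @[t --> -oo] --> 0.
Proof.
have half (G : R -> R) : (forall t, `|G t| <= K / cosh (t / 4)) ->
    G t @[t --> +oo] --> 0.
  move=> GK; have K0 : 0 <= K.
    have := le_trans (normr_ge0 _) (GK 0).
    by rewrite pmulr_lge0// invr_gt0 cosh_gt0.
  apply: norm_cvg0.
  have c0 : K * 4 * t^-1 @[t --> +oo] --> (0 : R).
    rewrite -[X in _ --> X](mulr0 (K * 4)); apply: cvgMr.
    apply/gtr0_cvgV0; first by near=> t; near: t; exact: nbhs_pinfty_gt.
    exact: cvg_id.
  apply: (squeeze_cvgr _ _ c0); last exact: (cvg_cst 0).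
  near=> t; rewrite normr_ge0/= (le_trans (GK t))// -mulrA ler_wpM2l//.
  have t0 : 0 < t by near: t; exact: nbhs_pinfty_gt.
  rewrite -[leLHS]mul1r ler_pdivrMr ?cosh_gt0// mulrAC ler_pdivlMr// mul1r.
  by have := cosh_ge (t / 4); rewrite expr_div_n; nra.
move=> FK; split; first exact: half.
apply/cvgNy_compNP; apply: half => t /=.
by rewrite -(coshN (t / 4)) -mulNr; exact: FK.
Unshelve. all: by end_near. Qed.

Lemma Rintegral_derivative0 {f F : R -> R} {K : R} : intble [set: R] f ->
  (forall x, has_der F x (f x)) -> continuous f ->
  (forall t, `|F t| <= K / cosh (t / 4)) -> \int_ [set: R] f = 0.
Proof.
move=> fi dF cf /vanish_le_sech[Fy FNy].
by rewrite (FTC_line 0 0 fi dF cf)// subrr.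
Qed.

End Hyperbolic.

Section ExponentialBounds.
Context {R : realType}.
Implicit Types x y u : R.

(** One term of the exponential series is at most its sum. *)
Lemma powM_expN_le n y : 0 <= y -> y ^+ n.+1 * expR (- y) <= n.+1`!%:R.
Proof.
move=> y0; rewrite expRN ler_pdivrMr ?expR_gt0// mulrC -ler_pdivrMr ?ltr0n ?fact_gt0//.
by apply: le_trans (expR_ge1Dxn n y0); rewrite lerDr.
Qed.

Lemma powRM_expN_le p y : 0 <= p <= 2 -> 0 < y -> y `^ p * expR (- y) <= 2.
Proof.
move=> /andP[p0 p2] y0; rewrite expRN ler_pdivrMr ?expR_gt0//.
apply: (@le_trans _ _ (2 + y ^+ 2)); last first.
  by have := expR_ge1Dxn 1 (ltW y0); rewrite /= (_ : 2`!%:R = 2 :> R)//; lra.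
have [y1|y1] := leP y 1.
  apply: (@le_trans _ _ 1); last by have := sqr_ge0 y; lra.
  by rewrite -(powRr0 y); apply: ger_powR => //; rewrite y0.
apply: (@le_trans _ _ (y ^+ 2)); last by rewrite lerDr.
by rewrite -(powR_mulrn 2 (ltW y0)); apply: ler_powR => //; exact: ltW.
Qed.

End ExponentialBounds.

(** * Laplace transforms in the hyperbolic cosine *)

Section Laplace.
Context {R : realType}.
Implicit Types (a c : R -> R) (t u x : R).

Definition kern u t : R := expR (- (u / 2 * cosh t)).

(** For even c this is the integral over t > 0, and for c t = cosh (nu t) the
    Macdonald function of order nu at u / 2. Integrating over the whole line
    removes the boundary terms at 0 from all integrations by parts. *)
Definition lap c u : R := 2^-1 * \int_ [set: R] (fun t => kern u t * c t).

Lemma kern_cont u : continuous (kern u).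
Proof.
move=> t; apply: (@continuous_comp _ _ _ (fun t => - (u / 2 * cosh t)) expR).
  by apply: cvgN; apply: cvgM; [exact: cvg_cst|exact: cosh_cont].
exact: continuous_expR.
Qed.

Lemma kern_gt0 u t : 0 < kern u t. Proof. exact: expR_gt0. Qed.

Lemma kern_le u x t : u <= x -> kern x t <= kern u t.
Proof.
move=> ux; rewrite ler_expR lerN2 ler_wpM2r ?(ltW (cosh_gt0 _))//.
by rewrite ler_wpM2r.
Qed.

(** The fourth power of y = (u / 2) cosh t is absorbed by exp (- y), with
    24 = 4!; three of the four factors cosh t remain for the integrand. *)
Lemma kern_cosh_le u t : 0 < u ->
  kern u t * cosh t ^+ 3 <= 24 * (2 / u) ^+ 4 / cosh (t / 4).
Proof.
move=> u0; have C0 := cosh_gt0 t; pose y := u / 2 * cosh t.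
have y0 : 0 <= y by rewrite mulr_ge0 ?(ltW C0)// ltW// divr_gt0.
have := powM_expN_le 3 y y0; rewrite (_ : 4`!%:R = 24 :> R)// => h.
have q : cosh (t / 4) <= cosh t.
  apply: cosh_abs_le; rewrite normrM [`|4^-1|]ger0_norm//.
  by have := normr_ge0 t; lra.
rewrite ler_pdivlMr ?cosh_gt0//.
apply: (@le_trans _ _ (kern u t * cosh t ^+ 4)).
  rewrite -mulrA ler_wpM2l ?(ltW (kern_gt0 _ _))// [leRHS]exprSr.
  by rewrite ler_wpM2l// exprn_ge0// ltW.
have -> : kern u t * cosh t ^+ 4 = y ^+ 4 * expR (- y) * (2 / u) ^+ 4.
  rewrite -/(kern u t) /y; field; exact: lt0r_neq0.
by rewrite ler_wpM2r// exprn_ge0// divr_ge0// ltW.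
Qed.

Lemma lap_bound {a} {M} u t : 0 < u -> (forall t, `|a t| <= M * cosh t ^+ 3) ->
  `|kern u t * a t| <= M * (24 * (2 / u) ^+ 4) / cosh (t / 4).
Proof.
move=> u0 aM; have M0 : 0 <= M.
  have := le_trans (normr_ge0 _) (aM 0).
  by rewrite cosh0 expr1n mulr1.
rewrite normrM (ger0_norm (ltW (kern_gt0 _ _))).
apply: (@le_trans _ _ (kern u t * (M * cosh t ^+ 3))).
  by rewrite ler_wpM2l ?(ltW (kern_gt0 _ _)).
by rewrite mulrCA -mulrA ler_wpM2l// kern_cosh_le.
Qed.

Lemma kernM_cont {a} u : continuous a -> continuous (fun t => kern u t * a t).
Proof. by move=> ca t; apply: cvgM; [exact: kern_cont|exact: ca]. Qed.

Lemma lap_integrable {c} {M} u : continuous c ->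
  (forall t, `|c t| <= M * cosh t ^+ 3) -> 0 < u ->
  intble [set: R] (fun t => kern u t * c t).
Proof.
move=> cc cM u0; apply: (integrable_le_sech (M * (24 * (2 / u) ^+ 4))).
  by apply: continuous_measurable_fun; exact: kernM_cont.
by move=> t; exact: lap_bound.
Qed.

(** Differentiation brings down - cosh t / 2. On (u / 2, u + 1) the integrands
    are dominated by the one at u / 2. *)
Lemma lap_der {c} {M} u : continuous c -> (forall t, `|c t| <= M * cosh t ^+ 2) ->
  0 < u -> has_der (lap c) u (- (lap (fun t => cosh t * c t) u / 2)).
Proof.
move=> cc cM u0.
have M0 : 0 <= M.
  by have := le_trans (normr_ge0 _) (cM 0); rewrite cosh0 expr1n mulr1.
have cM3 t : `|c t| <= M * cosh t ^+ 3.
  apply: le_trans (cM t) _; rewrite ler_wpM2l// [leRHS]exprS.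
  by rewrite ler_peMl ?cosh_ge1// exprn_ge0// ltW// cosh_gt0.
have ccM t : `|cosh t * c t| <= M * cosh t ^+ 3.
  rewrite normrM (ger0_norm (ltW (cosh_gt0 _))) exprS mulrCA.
  by rewrite ler_wpM2l// ltW// cosh_gt0.
have ccc : continuous (fun t => cosh t * c t).
  by move=> t; apply: cvgM; [exact: cosh_cont|exact: cc].
pose df x t := kern x t * (- 2^-1 * (cosh t * c t)).
have dfM x t : u / 2 < x < u + 1 -> `|df x t| <= kern (u / 2) t * (M * cosh t ^+ 3).
  move=> /andP[ux _]; rewrite /df normrM (ger0_norm (ltW (kern_gt0 _ _))).
  apply: ler_pM => //; [exact: ltW (kern_gt0 _ _)|by apply: kern_le; exact: ltW|].
  rewrite normrM normrN [`|2^-1|]ger0_norm//; apply: le_trans (ccM t).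
  by rewrite ler_piMl//; lra.
have u2 : 0 < u / 2 by rewrite divr_gt0.
have i3 : intble [set: R] (fun t => kern (u / 2) t * (M * cosh t ^+ 3)).
  apply: (lap_integrable (M := M)) => // [t|t].
    apply: cvgM; first exact: cvg_cst.
    by apply: (@continuous_comp _ _ _ cosh (fun x => x ^+ 3));
      [exact: cosh_cont|exact: exprn_continuous].
  by rewrite ger0_norm// mulr_ge0// exprn_ge0// ltW// cosh_gt0.
have uu : u / 2 < u < u + 1 by apply/andP; split; lra.
have := der_under_integral (D := [set: R]) (f := fun x t => kern x t * c t) _ _
  measurableT uu (df := df) _ _ (fun x t xu _ => dfM x t xu) i3.
move=> /(_ _ _)-H.
apply: has_der_eq; first apply: (derM (derC 2^-1 u) (H _ _)).
- by move=> x /andP[ux _]; apply: lap_integrable cc cM3 _; exact: lt_trans ux.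
- move=> x t _ _; apply: has_der_eq.
    apply: (derM (der_exp (derN (derM (derM (derX x) (derC 2^-1 x)) (derC (cosh t) x)))) (derC (c t) x)).
  by rewrite /df /kern; ring.
- rewrite mul0r add0r /lap /df.
  under eq_Rintegral do rewrite mulrCA.
  rewrite RintegralZl//; last exact: lap_integrable ccc ccM u0.
  by ring.
Qed.

Lemma lapD {a c} {M N} u : continuous a -> (forall t, `|a t| <= M * cosh t ^+ 3) ->
  continuous c -> (forall t, `|c t| <= N * cosh t ^+ 3) -> 0 < u ->
  lap (fun t => a t + c t) u = lap a u + lap c u.
Proof.
move=> ca aM cc cM u0; rewrite /lap -mulrDr -RintegralD//.
- by congr (_ * _); apply: eq_Rintegral => t _; rewrite mulrDr.
- exact: lap_integrable ca aM u0.
- exact: lap_integrable cc cM u0.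
Qed.

Lemma lapZ {a} {M} (k : R) u : continuous a -> (forall t, `|a t| <= M * cosh t ^+ 3) ->
  0 < u -> lap (fun t => k * a t) u = k * lap a u.
Proof.
move=> ca aM u0; rewrite /lap; under eq_Rintegral do rewrite mulrCA.
by rewrite RintegralZl 1?mulrCA//; exact: lap_integrable ca aM u0.
Qed.

Lemma lap_le {a c} {M} u : continuous a -> continuous c ->
  (forall t, `|c t| <= M * cosh t ^+ 3) -> (forall t, `|a t| <= c t) -> 0 < u ->
  `|lap a u| <= lap c u.
Proof.
move=> ca cc cM ac u0; rewrite /lap normrM ger0_norm// ler_wpM2l//.
apply: norm_Rintegral_le => //; [|exact: lap_integrable cc cM u0|].
- apply: (lap_integrable (M := M)) => // t; apply: le_trans (ac t) _.
  exact: le_trans (ler_norm _) (cM t).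
- move=> t _; rewrite normrM (ger0_norm (ltW (kern_gt0 _ _))).
  by rewrite ler_wpM2l ?(ltW (kern_gt0 _ _)).
Qed.

Lemma sinh_cont : continuous (@sinh R).
Proof. by move=> t; apply: der_cont; exact: (der_sinh (derX t)). Qed.

(** Integration by parts against the kernel, the boundary terms vanishing. *)
Lemma lap_parts {a a1} {M N} u : (forall t, has_der a t (a1 t)) ->
  continuous a1 -> (forall t, `|a t| <= M * cosh t ^+ 3) ->
  (forall t, `|a1 t - u / 2 * (sinh t * a t)| <= N * cosh t ^+ 3) -> 0 < u ->
  lap (fun t => a1 t - u / 2 * (sinh t * a t)) u = 0.
Proof.
move=> da ca1 aM a1M u0; rewrite /lap.
have ca : continuous a by move=> t; exact: der_cont (da t).
have cc : continuous (fun t => a1 t - u / 2 * (sinh t * a t)).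
  move=> t; apply: cvgB; first exact: ca1.
  apply: cvgM; first exact: cvg_cst.
  by apply: cvgM; [exact: sinh_cont|exact: ca].
have -> := Rintegral_derivative0 (F := fun t => kern u t * a t)
  (K := M * (24 * (2 / u) ^+ 4)) (lap_integrable u cc a1M u0) _ (kernM_cont u cc) _.
- by rewrite mulr0.
- move=> t; apply: has_der_eq.
    exact: (derM (der_exp (derN (derM (derC (u / 2) t) (der_cosh (derX t))))) (da t)).
  by rewrite /kern; ring.
- by move=> t; exact: lap_bound.
Qed.

End Laplace.

(** * Consequences of the mean value theorem *)

Section Monotone.
Context {R : realType}.
Implicit Types (f g : R -> R) (a b x y : R).

Lemma has_der_unique {f x} {d e : R} : has_der f x d -> has_der f x e -> d = e.
Proof. by case=> _ <- [_ <-]. Qed.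

Lemma der_ge0_le {f} {f1 : R -> R} a b : a <= b ->
  (forall x, a <= x <= b -> has_der f x (f1 x)) ->
  (forall x, a <= x <= b -> 0 <= f1 x) -> f a <= f b.
Proof.
rewrite le_eqVlt => /predU1P[->//|ab] df f0.
have dab x : x \in `]a, b[ -> has_der f x (f1 x).
  by rewrite in_itv/= => /andP[ax xb]; apply: df; rewrite !ltW.
have cab : {within `[a, b], continuous f}.
  apply: continuous_in_subspaceT => x; rewrite inE/= in_itv/= => xab.
  exact: der_cont (df x xab).
have [c cab' fE] := MVT ab dab cab.
rewrite -subr_ge0 fE mulr_ge0 ?subr_ge0 ?(ltW ab)//; apply: f0.
by move: cab'; rewrite in_itv/= => /andP[ac cb]; rewrite !ltW.
Qed.

Lemma der_le_compare {f g} {f1 g1 : R -> R} a b : a <= b ->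
  (forall x, a <= x <= b -> has_der f x (f1 x)) ->
  (forall x, a <= x <= b -> has_der g x (g1 x)) ->
  (forall x, a <= x <= b -> f1 x <= g1 x) -> f b - f a <= g b - g a.
Proof.
move=> ab df dg fg.
have : g a - f a <= g b - f b.
  apply: (der_ge0_le (f := fun x => g x - f x) (f1 := fun x => g1 x - f1 x)) => // x xab.
    by apply: derD; [exact: dg|apply: derN; exact: df].
  by rewrite subr_ge0 fg.
lra.
Qed.

Lemma der0_eq {f} a b : a <= b -> (forall x, a <= x <= b -> has_der f x 0) ->
  f a = f b.
Proof.
move=> ab df; apply/eqP; rewrite eq_le; apply/andP; split.
  exact: (der_ge0_le (f1 := fun=> 0)).
rewrite -lerN2; apply: (der_ge0_le (f := fun x => - f x) (f1 := fun=> 0)) => // x xab.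
by rewrite -oppr0; apply: derN; exact: df.
Qed.

Lemma der0_eq_pos {f} a b : 0 < a -> 0 < b ->
  (forall x, 0 < x -> has_der f x 0) -> f a = f b.
Proof.
move=> a0 b0 df; have [ab|/ltW ba] := leP a b.
  by apply: der0_eq => // x /andP[ax _]; apply: df; exact: lt_le_trans ax.
by apply/esym/der0_eq => // x /andP[bx _]; apply: df; exact: lt_le_trans bx.
Qed.

Lemma sin_abs_le x : `|sin x| <= `|x|.
Proof.
wlog x0 : x / 0 <= x => [H|].
  have [/H//|/ltW x0] := leP 0 x.
  by rewrite -normrN -sinN -[leRHS]normrN; apply: H; rewrite oppr_ge0.
rewrite (ger0_norm x0) ler_norml.
have ds y : has_der sin y (cos y) by exact: is_derive_sin.
have dN y : has_der (fun y => - y) y (-1) by exact: derN (derX y).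
have := der_le_compare 0 x x0 (fun y _ => ds y) (fun y _ => derX y)
  (fun y _ => cos_le1 y).
have := der_le_compare 0 x x0 (fun y _ => dN y) (fun y _ => ds y)
  (fun y _ => cos_geN1 y).
by rewrite sin0; lra.
Qed.

Lemma one_sub_cos_le x : `|cos x - 1| <= x ^+ 2 / 2.
Proof.
have -> : cos x - 1 = - (2 * sin (x / 2) ^+ 2).
  have {1}-> : x = x / 2 + x / 2 by field.
  by rewrite cosD -!expr2; have := cos2Dsin2 (x / 2); lra.
rewrite normrN ger0_norm; last by rewrite mulr_ge0// sqr_ge0.
have h : sin (x / 2) ^+ 2 <= (x / 2) ^+ 2.
  by have := sin_abs_le (x / 2); rewrite -ler_sqr ?nnegrE// !real_normK ?num_real.
by move: h; rewrite expr_div_n; lra.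
Qed.

End Monotone.

(** * Macdonald functions and their asymptotics *)

Section Modes.
Context {R : realType}.
Implicit Types (a c : R -> R) (k M t u : R).

(** The even solutions c of c'' = k c with c 0 = 1 that occur here, cosh (r t)
    for |r| <= 1/2 and cos (s t): all of them are dominated by cosh (t / 2), and
    this is what keeps the Macdonald functions below that of order 1/2, whose
    closed form is elementary. Large arguments only see c near t = 0, where it
    agrees with 1. *)
Record mode c (c1 : R -> R) k M : Prop := Mode {
  mode_der : forall t, has_der c t (c1 t);
  mode_der1 : forall t, has_der c1 t (k * c t);
  mode_le : forall t, `|c t| <= cosh (t / 2);
  mode_le1 : forall t, `|c1 t| <= M * cosh (t / 2);
  mode_near1 : forall t, `|c t - 1| <= M * (cosh t - 1) }.

Lemma mode_cosh (r : R) : 0 <= r <= 2^-1 ->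
  mode (fun t => cosh (r * t)) (fun t => r * sinh (r * t)) (r ^+ 2) 1.
Proof.
move=> /andP[r0 r2].
have rt t : `|r * t| <= `|t / 2|.
  by rewrite !normrM (ger0_norm r0) [`|2^-1|]ger0_norm// mulrC ler_wpM2l.
have drt t := derM (derC r t) (derX t).
split=> t.
- by apply: has_der_eq; first exact: (der_cosh (drt t)); ring.
- by apply: has_der_eq; first exact: (derM (derC r t) (der_sinh (drt t))); rewrite /=; ring.
- by rewrite ger0_norm ?(ltW (cosh_gt0 _))//; exact: cosh_abs_le.
- rewrite normrM (ger0_norm r0); apply: ler_pM => //; first lra.
  by apply: le_trans (sinh_abs_le _) _; exact: cosh_abs_le.
- rewrite mul1r ger0_norm ?subr_ge0 ?cosh_ge1// lerD2r; apply: cosh_abs_le.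
  by apply: le_trans (rt t) _; rewrite normrM [`|2^-1|]ger0_norm//; have := normr_ge0 t; lra.
Qed.

Lemma mode_cos (s : R) :
  mode (fun t => cos (s * t)) (fun t => - s * sin (s * t)) (- s ^+ 2) (`|s| + s ^+ 2).
Proof.
have dst t := derM (derC s t) (derX t).
split=> t.
- by apply: has_der_eq; first exact: (der_cos (dst t)); ring.
- by apply: has_der_eq; first exact: (derM (derC (- s) t) (der_sin (dst t))); rewrite /=; ring.
- by apply: le_trans (cosh_ge1 _); exact: cos_max.
- rewrite normrM normrN; apply: (@le_trans _ _ (`|s| * 1)).
    by rewrite ler_wpM2l// sin_max.
  apply: ler_pM => //; last exact: cosh_ge1.
  by rewrite lerDl sqr_ge0.
- apply: le_trans (one_sub_cos_le _) _.
  apply: (@le_trans _ _ (s ^+ 2 * (cosh t - 1))).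
    rewrite exprMn -mulrA ler_wpM2l ?sqr_ge0//.
    by have := cosh_ge t; lra.
  by rewrite ler_wpM2r ?subr_ge0 ?cosh_ge1// lerDr.
Qed.

(** The mode of order 1/2. Its transform is elementary because the derivative of
    sinh (t / 2) is, up to a factor, this mode again. *)
Definition hmode t : R := cosh (t / 2).

Lemma hmode_cont : continuous hmode.
Proof.
by move=> t; apply: der_cont; exact: (der_cosh (derM (derX t) (derC 2^-1 t))).
Qed.

Lemma hmode_ge1 t : 1 <= hmode t. Proof. exact: cosh_ge1. Qed.

Lemma hmode_ge0 t : 0 <= hmode t. Proof. exact: le_trans (hmode_ge1 t). Qed.

Lemma cosh_powS_le m n t : (m <= n)%N -> cosh t ^+ m <= cosh t ^+ n :> R.
Proof. by move=> mn; apply: ler_weXn2l => //; exact: cosh_ge1. Qed.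

Lemma coshM_cont c : continuous c -> continuous (fun t => cosh t * c t).
Proof. by move=> cc t; apply: cvgM; [exact: cosh_cont|exact: cc]. Qed.

Lemma hmode_abs_le n t : `|hmode t| <= 1 * cosh t ^+ n.+1.
Proof.
rewrite ger0_norm ?hmode_ge0// mul1r; apply: le_trans (cosh_half_le t) _.
exact: (cosh_powS_le 1 n.+1).
Qed.

Lemma excess_cont : continuous (fun t => (cosh t - 1) * hmode t).
Proof.
move=> t; apply: cvgM; last exact: hmode_cont.
by apply: cvgB; [exact: cosh_cont|exact: cvg_cst].
Qed.

Lemma excess_le t : `|(cosh t - 1) * hmode t| <= 1 * cosh t ^+ 3.
Proof.
rewrite normrM mul1r [leRHS]exprS; apply: ler_pM => //.
  by rewrite ger0_norm ?subr_ge0 ?cosh_ge1// gerBl.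
by have := hmode_abs_le 1 t; rewrite mul1r.
Qed.

Definition half u : R := lap hmode u.

(** Integration by parts with sinh (t / 2): the factor sinh t sinh (t / 2) equals
    (cosh t - 1) cosh (t / 2), so the order 1/2 satisfies a relation that closes
    up. *)
Lemma half_excess u : 0 < u -> lap (fun t => (cosh t - 1) * hmode t) u = half u / u.
Proof.
move=> u0; have u20 : 0 <= u / 2 by rewrite divr_ge0// ltW.
pose a t : R := sinh (t / 2); pose a1 t : R := 2^-1 * hmode t.
have da t : has_der a t (a1 t).
  apply: has_der_eq; first exact: (der_sinh (derM (derX t) (derC 2^-1 t))).
  by rewrite /a1 /hmode; ring.
have ca1 : continuous a1 by move=> t; apply: cvgM; [exact: cvg_cst|exact: hmode_cont].
have aE t : a1 t - u / 2 * (sinh t * a t) =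
    2^-1 * hmode t + - (u / 2) * ((cosh t - 1) * hmode t).
  have -> : sinh t = 2 * sinh (t / 2) * cosh (t / 2).
    by rewrite {1}(_ : t = t / 2 + t / 2) ?sinhD; [ring|field].
  by rewrite /a /a1 /hmode (coshE_half_sinh t); ring.
have eM := excess_le; have hM := hmode_abs_le 2; have ce := excess_cont.
have aM t : `|a t| <= 1 * cosh t ^+ 3.
  by apply: le_trans (sinh_abs_le _) _; have := hM t; rewrite ger0_norm// ltW ?cosh_gt0.
have tM t : `|a1 t - u / 2 * (sinh t * a t)| <= (2^-1 + u / 2) * cosh t ^+ 3.
  rewrite aE; apply: le_trans (ler_normD _ _) _; rewrite [leRHS]mulrDl; apply: lerD.
    by rewrite normrM ger0_norm// ler_wpM2l//; have := hM t; rewrite mul1r.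
  rewrite normrM normrN (ger0_norm u20).
  by rewrite ler_wpM2l//; have := eM t; rewrite mul1r.
have := lap_parts u da ca1 aM tM u0.
rewrite (_ : (fun t => _) = fun t => 2^-1 * hmode t + - (u / 2) * ((cosh t - 1) * hmode t)); last exact/funext.
have hM2 t : `|2^-1 * hmode t| <= 2^-1 * cosh t ^+ 3.
  by rewrite normrM ger0_norm// ler_wpM2l//; have := hM t; rewrite mul1r.
have eM2 t : `|- (u / 2) * ((cosh t - 1) * hmode t)| <= (u / 2) * cosh t ^+ 3.
  rewrite normrM normrN (ger0_norm u20).
  by rewrite ler_wpM2l//; have := eM t; rewrite mul1r.
rewrite (lapD u _ hM2 _ eM2 u0).
- rewrite (lapZ _ u hmode_cont hM u0) (lapZ _ u ce eM u0) -/(half u) => h.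
  apply: (mulfI (lt0r_neq0 u0)); rewrite [RHS]mulrC divfK ?lt0r_neq0//; lra.
- exact: ca1.
- by move=> t; apply: cvgM; [exact: cvg_cst|exact: ce].
Qed.

(** The derivative brings down cosh t = 1 + (cosh t - 1), and the excess is
    known: a first order differential equation. *)
Lemma der_half u : 0 < u -> has_der half u (- (1 + u^-1) / 2 * half u).
Proof.
move=> u0.
have hM2 := hmode_abs_le 1.
apply: has_der_eq; first exact: (lap_der u hmode_cont hM2 u0).
rewrite (_ : (fun t => _) = fun t => (cosh t - 1) * hmode t + hmode t); last first.
  by apply/funext => t; ring.
rewrite (lapD u excess_cont excess_le hmode_cont (hmode_abs_le 2) u0) half_excess// -/(half u).
by field; exact: lt0r_neq0.
Qed.

(** The square root of pi, as it occurs in the closed form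
    sqrt pi exp (- u / 2) / sqrt u of the Macdonald function of order 1/2 at
    u / 2. *)
Definition halfC : R := expR 2^-1 * half 1.

Definition decay u : R := halfC * expR (- (u / 2)).

(** The quotient of the two sides has derivative 0. *)
Lemma half_decay u : 0 < u -> Num.sqrt u * half u = decay u.
Proof.
move=> u0; pose F u := Num.sqrt u * half u * expR (u / 2).
have dF x : 0 < x -> has_der F x 0.
  move=> x0.
  have ds : has_der Num.sqrt x (2 * Num.sqrt x)^-1 by exact: is_derive1_sqrt.
  apply: has_der_eq.
    exact: (derM (derM ds (der_half x x0)) (der_exp (derM (derX x) (derC 2^-1 x)))).
  have s0 : Num.sqrt x != 0 by rewrite gt_eqF// sqrtr_gt0.
  have E : x^-1 = (Num.sqrt x ^+ 2)^-1 by rewrite sqr_sqrtr// ltW.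
  by rewrite E /=; field; rewrite s0.
have := der0_eq_pos u 1 u0 ltr01 dF; rewrite /F sqrtr1 !mul1r => h.
apply: (mulIf (lt0r_neq0 (expR_gt0 (u / 2)))).
rewrite h; rewrite /decay -[RHS]mulrA -expRD addNr expR0 mulr1.
by rewrite /halfC mulrC.
Qed.

Lemma halfC_gt0 : 0 < halfC.
Proof.
rewrite mulr_gt0 ?expR_gt0// mulr_gt0//.
pose d : R := expR (- (2^-1 * cosh 1)).
pose ind : R -> R := \1_([set` `[0%R, 1%R]]).
have iI : intble [set: R] ind by exact: integrable_indic_itv.
apply: (@lt_le_trans _ _ (\int_ [set: R] (fun t => d * ind t))).
  rewrite RintegralZl// mulr_gt0 ?expR_gt0// /Rintegral integral_indic// setIT.
  have E : fine (lebesgue_measure [set` `[0%R, 1%R]]) = 1 :> R.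
    by rewrite lebesgue_measure_itv/= lte_fin ltr01 oppr0 adde0.
  by have h := @ltr01 R; rewrite -[X in _ < X]E in h.
apply: le_Rintegral => //; first exact: intbleZ.
  by apply: (lap_integrable (M := 1)) => //; [exact: hmode_cont|exact: (hmode_abs_le 2)].
move=> t _; rewrite /ind indicE.
case: (boolP (t \in _)); last first.
  by rewrite mulr0 => _; rewrite mulr_ge0 ?hmode_ge0// ltW// kern_gt0.
rewrite inE/= in_itv/= mulr1 => /andP[t0 t1].
apply: (@le_trans _ _ (kern 1 t)); last by rewrite ler_peMr ?hmode_ge1// ltW// kern_gt0.
rewrite /d /kern ler_expR lerN2 div1r ler_wpM2l//.
by apply: cosh_abs_le; rewrite !ger0_norm.
Qed.

Lemma decay_gt0 u : 0 < decay u.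
Proof. by rewrite mulr_gt0 ?halfC_gt0 ?expR_gt0. Qed.

(** Only the behaviour of a near t = 0 matters for large u: an integrand that
    agrees with the half mode up to cosh t - 1 has the same leading term. *)
Lemma lap_near_half {a} (N : R) u : continuous a -> 0 <= N ->
  (forall t, `|a t - hmode t| <= N * ((cosh t - 1) * hmode t)) -> 0 < u ->
  `|lap a u - half u| <= N * (half u / u).
Proof.
move=> ca N0 aN u0.
have hM := hmode_abs_le 2; have ce := excess_cont; have eM := excess_le.
have NeM t : `|N * ((cosh t - 1) * hmode t)| <= N * cosh t ^+ 3.
  by rewrite normrM (ger0_norm N0) ler_wpM2l//; have := eM t; rewrite mul1r.
have dM t : `|a t - hmode t| <= N * cosh t ^+ 3.
  by apply: le_trans (aN t) _; apply: le_trans (ler_norm _) (NeM t).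
have cd : continuous (fun t => a t - hmode t).
  by move=> t; apply: cvgB; [exact: ca|exact: hmode_cont].
have cNe : continuous (fun t => N * ((cosh t - 1) * hmode t)).
  by move=> t; apply: cvgM; [exact: cvg_cst|exact: ce].
have -> : lap a u - half u = lap (fun t => a t - hmode t) u.
  rewrite {1}(_ : a = fun t => (a t - hmode t) + hmode t).
    by rewrite (lapD u cd dM hmode_cont hM u0) addrK.
  by apply/funext => t; rewrite subrK.
apply: le_trans (lap_le u cd cNe NeM aN u0) _.
by rewrite (lapZ N u ce eM u0) half_excess.
Qed.

Lemma inv_2sqrt u : 0 < u -> (2 * Num.sqrt u)^-1 = Num.sqrt u / (2 * u).
Proof.
move=> u0; have := sqr_sqrtr (ltW u0); have : 0 < Num.sqrt u by rewrite sqrtr_gt0.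
move: (Num.sqrt u) => s s0 <-; field; exact: lt0r_neq0.
Qed.

Section ModeTransform.
Context {c c1 : R -> R} {k M : R}.
Hypothesis mc : mode c c1 k M.

Lemma mode_M_ge0 : 0 <= M.
Proof.
have := le_trans (normr_ge0 _) (mode_le1 _ _ _ _ mc 0).
by rewrite mul0r cosh0 mulr1.
Qed.

Lemma mode_cont : continuous c.
Proof. by move=> t; exact: der_cont (mode_der _ _ _ _ mc t). Qed.

Lemma mode_cont1 : continuous c1.
Proof. by move=> t; exact: der_cont (mode_der1 _ _ _ _ mc t). Qed.

Lemma mode_le_cosh n t : `|c t| <= cosh t ^+ n.+1.
Proof.
apply: le_trans (mode_le _ _ _ _ mc t) _; apply: le_trans (cosh_half_le t) _.
exact: (cosh_powS_le 1).
Qed.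

Definition mac u := lap c u.
Definition mac1 u := - (lap (fun t => cosh t * c t) u / 2).
Definition mac2 u := lap (fun t => cosh t * (cosh t * c t)) u / 4.

Lemma der_mac u : 0 < u -> has_der mac u (mac1 u).
Proof.
move=> u0; apply: (lap_der (M := 1)) => //; first exact: mode_cont.
by move=> t; rewrite mul1r; exact: (mode_le_cosh 1).
Qed.

Lemma coshc_le t n : `|cosh t * c t| <= 1 * cosh t ^+ n.+2.
Proof.
rewrite normrM (ger0_norm (ltW (cosh_gt0 t))) mul1r exprS.
by rewrite ler_wpM2l ?(ltW (cosh_gt0 t))//; exact: mode_le_cosh.
Qed.

Lemma coshc_cont : continuous (fun t => cosh t * c t).
Proof. exact: coshM_cont mode_cont. Qed.

Lemma der_mac1 u : 0 < u -> has_der mac1 u (mac2 u).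
Proof.
move=> u0; have d := lap_der u coshc_cont (coshc_le^~ 0%N) u0.
apply: has_der_eq; first exact: (derN (derM d (derC 2^-1 u))).
by rewrite /mac2 /=; field.
Qed.

(** Bessel's equation, by integration by parts with (u / 2) sinh t c t + c' t: the
    terms in sinh t c' t cancel, c'' = k c, and sinh^2 = cosh^2 - 1 turns the rest
    into derivatives of the transform. *)
Lemma mac_bessel u : 0 < u ->
  u ^+ 2 * mac2 u + u * mac1 u = (u ^+ 2 / 4 + k) * mac u.
Proof.
move=> u0.
have u20 : 0 <= u / 2 by rewrite divr_ge0// ltW.
pose a t := u / 2 * (sinh t * c t) + c1 t.
pose a1 t := u / 2 * (cosh t * c t + sinh t * c1 t) + k * c t.
have da t : has_der a t (a1 t).
  apply: has_der_eq; first exact: (derD (derM (derC (u / 2) t)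
    (derM (der_sinh (derX t)) (mode_der _ _ _ _ mc t))) (mode_der1 _ _ _ _ mc t)).
  by rewrite /a1 /=; ring.
have cca : continuous (fun t => sinh t * c1 t).
  by move=> t; apply: cvgM; [exact: sinh_cont|exact: mode_cont1].
have ca1 : continuous a1.
  move=> t; apply: cvgD; last by apply: cvgM; [exact: cvg_cst|exact: mode_cont].
  by apply: cvgM; [exact: cvg_cst|apply: cvgD; [exact: coshc_cont|exact: cca]].
pose e t := cosh t * (cosh t * c t).
have ce : continuous e by exact: coshM_cont coshc_cont.
have eM t : `|e t| <= 1 * cosh t ^+ 3.
  rewrite normrM (ger0_norm (ltW (cosh_gt0 t))) mul1r exprS.
  by rewrite ler_wpM2l ?(ltW (cosh_gt0 t))//; have := coshc_le t 0; rewrite mul1r.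
have cM t : `|c t| <= 1 * cosh t ^+ 3 by rewrite mul1r; exact: (mode_le_cosh 2).
have tE t : a1 t - u / 2 * (sinh t * a t) =
    (k + u ^+ 2 / 4) * c t + (u / 2 * (cosh t * c t) + - (u ^+ 2 / 4) * e t).
  rewrite /a1 /a /e; have S := cosh2_sinh2 t.
  have -> : cosh t * (cosh t * c t) = (1 + sinh t ^+ 2) * c t.
    by rewrite -S; ring.
  by field.
have b1 t : `|(k + u ^+ 2 / 4) * c t| <= `|k + u ^+ 2 / 4| * cosh t ^+ 3.
  by rewrite normrM ler_wpM2l//; have := cM t; rewrite mul1r.
have b2 t : `|u / 2 * (cosh t * c t)| <= `|u / 2| * cosh t ^+ 3.
  by rewrite normrM ler_wpM2l//; have := coshc_le t 1; rewrite mul1r.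
have b3 t : `|- (u ^+ 2 / 4) * e t| <= `|- (u ^+ 2 / 4)| * cosh t ^+ 3.
  by rewrite normrM ler_wpM2l//; have := eM t; rewrite mul1r.
have b23 t : `|u / 2 * (cosh t * c t) + - (u ^+ 2 / 4) * e t| <=
    (`|u / 2| + `|- (u ^+ 2 / 4)|) * cosh t ^+ 3.
  by apply: le_trans (ler_normD _ _) _; rewrite [leRHS]mulrDl; exact: lerD.
have tM t : `|a1 t - u / 2 * (sinh t * a t)| <=
    (`|k + u ^+ 2 / 4| + (`|u / 2| + `|- (u ^+ 2 / 4)|)) * cosh t ^+ 3.
  by rewrite tE; apply: le_trans (ler_normD _ _) _; rewrite [leRHS]mulrDl; exact: lerD.
have aM t : `|a t| <= (u / 2 + M) * cosh t ^+ 3.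
  apply: le_trans (ler_normD _ _) _; rewrite [leRHS]mulrDl; apply: lerD.
    rewrite normrM (ger0_norm u20) ler_wpM2l// normrM [leRHS]exprS.
    by apply: ler_pM => //; [exact: sinh_abs_le|exact: (mode_le_cosh 1)].
  apply: le_trans (mode_le1 _ _ _ _ mc t) _; rewrite ler_wpM2l ?mode_M_ge0//.
  by apply: le_trans (cosh_half_le t) _; exact: (cosh_powS_le 1 3).
have := lap_parts u da ca1 aM tM u0.
rewrite (_ : (fun t => _) = fun t => (k + u ^+ 2 / 4) * c t +
  (u / 2 * (cosh t * c t) + - (u ^+ 2 / 4) * e t)); last exact/funext.
have cZ (x : R) (f : R -> R) : continuous f -> continuous (fun t => x * f t).
  by move=> cf t; apply: cvgM; [exact: cvg_cst|exact: cf].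
have cc23 : continuous (fun t => u / 2 * (cosh t * c t) + - (u ^+ 2 / 4) * e t).
  by move=> t; apply: cvgD; [exact: (cZ _ _ coshc_cont)|exact: (cZ _ _ ce)].
rewrite (lapD u (cZ _ _ mode_cont) b1 cc23 b23 u0).
rewrite (lapD u (cZ _ _ coshc_cont) b2 (cZ _ _ ce) b3 u0).
rewrite (lapZ _ u mode_cont cM u0) (lapZ _ u coshc_cont (coshc_le^~ 1%N) u0) (lapZ _ u ce eM u0).
rewrite /mac2 /mac1 /mac -/e; lra.
Qed.

(** The recessive solution phi of phi'' = (1/4 + (k - 1/4) / u^2) phi. *)
Definition phi u := Num.sqrt u * mac u.
Definition phi1 u := phi u / (2 * u) + Num.sqrt u * mac1 u.

Lemma der_phi u : 0 < u -> has_der phi u (phi1 u).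
Proof.
move=> u0; have ds : has_der Num.sqrt u (2 * Num.sqrt u)^-1 by exact: is_derive1_sqrt.
apply: has_der_eq; first exact: (derM ds (der_mac u u0)).
rewrite /phi1 /phi; congr (_ + _).
by rewrite inv_2sqrt//; ring.
Qed.

Lemma der_phi1 u : 0 < u ->
  has_der phi1 u ((4^-1 + (k - 4^-1) / u ^+ 2) * phi u).
Proof.
move=> u0; have un0 : u != 0 by rewrite gt_eqF.
have ds : has_der Num.sqrt u (2 * Num.sqrt u)^-1 by exact: is_derive1_sqrt.
have u2n0 : 2 * u != 0 by rewrite mulf_neq0.
apply: has_der_eq.
  exact: (derD (derM (der_phi u u0) (derV u2n0 (derM (derC 2 u) (derX u))))
    (derM ds (der_mac1 u u0))).
have s0 : Num.sqrt u != 0 by rewrite gt_eqF// sqrtr_gt0.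
have E2 : mac2 u = ((u ^+ 2 / 4 + k) * mac u - u * mac1 u) / u ^+ 2.
  by rewrite -mac_bessel//; field.
by rewrite /phi1 /phi E2 (inv_2sqrt _ u0) /=; field.
Qed.

Lemma mac_le u : 0 < u -> `|mac u| <= half u.
Proof.
move=> u0; apply: (lap_le (M := 1)) => //.
- exact: mode_cont.
- exact: hmode_cont.
- exact: (hmode_abs_le 2).
- exact: mode_le mc.
Qed.

Lemma mac1_le u : 0 < u -> `|mac1 u| <= (1 + u^-1) / 2 * half u.
Proof.
move=> u0; rewrite /mac1 normrN normrM [`|2^-1|]ger0_norm// mulrAC ler_wpM2r//.
have hM2 := hmode_abs_le 1.
have chM t : `|cosh t * hmode t| <= 1 * cosh t ^+ 3.
  rewrite normrM (ger0_norm (ltW (cosh_gt0 t))) mul1r exprS.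
  by rewrite ler_wpM2l ?(ltW (cosh_gt0 t))//; have := hM2 t; rewrite mul1r.
have -> : (1 + u^-1) * half u = lap (fun t => cosh t * hmode t) u.
  have := has_der_unique (lap_der u hmode_cont hM2 u0) (der_half u u0); lra.
apply: (lap_le (M := 1)) => //; [exact: coshc_cont|exact: (coshM_cont _ hmode_cont)|].
move=> t; rewrite normrM (ger0_norm (ltW (cosh_gt0 t))).
by rewrite ler_wpM2l ?(ltW (cosh_gt0 t))//; exact: (mode_le _ _ _ _ mc t).
Qed.

Lemma phi_le u : 0 < u -> `|phi u| <= decay u.
Proof.
move=> u0; rewrite normrM ger0_norm ?sqrtr_ge0// -half_decay//.
by rewrite ler_wpM2l ?sqrtr_ge0// mac_le.
Qed.

Lemma phi1_le u : 0 < u -> `|phi1 u| <= (2^-1 + u^-1) * decay u.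
Proof.
move=> u0; have u20 : 0 < 2 * u by rewrite mulr_gt0.
apply: le_trans (ler_normD _ _) _.
have h1 : `|phi u / (2 * u)| <= decay u / (2 * u).
  by rewrite normrM [`|(2 * u)^-1|]ger0_norm ?invr_ge0 ?(ltW u20)// ler_wpM2r ?invr_ge0 ?(ltW u20)// phi_le.
have h2 : `|Num.sqrt u * mac1 u| <= (1 + u^-1) / 2 * decay u.
  rewrite normrM ger0_norm ?sqrtr_ge0// -half_decay// mulrCA.
  by rewrite ler_wpM2l ?sqrtr_ge0// mac1_le.
apply: le_trans (lerD h1 h2) _; rewrite le_eqVlt; apply/orP; left; apply/eqP.
by field; exact: lt0r_neq0.
Qed.

(** Both modes agree with 1 up to multiples of cosh t - 1. *)
Lemma mode_near_half t : `|c t - hmode t| <= (M + 1) * ((cosh t - 1) * hmode t).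
Proof.
have C0 : 0 <= cosh t - 1 by rewrite subr_ge0 cosh_ge1.
have h1 := hmode_ge1 t; have hc : hmode t <= cosh t by exact: cosh_half_le.
have := mode_near1 _ _ _ _ mc t.
rewrite !ler_norml => /andP[l r].
have MC : 0 <= M * (cosh t - 1) by rewrite mulr_ge0 ?mode_M_ge0.
have Ch : cosh t - 1 <= (cosh t - 1) * hmode t by rewrite ler_peMr.
have MCh : M * (cosh t - 1) <= M * ((cosh t - 1) * hmode t).
  by rewrite ler_wpM2l ?mode_M_ge0.
by apply/andP; split; lra.
Qed.

Lemma phi_asymp u : 0 < u -> `|phi u - decay u| <= (M + 2) * decay u / u.
Proof.
move=> u0; rewrite -half_decay// -mulrBr normrM ger0_norm ?sqrtr_ge0//.
have -> : (M + 2) * (Num.sqrt u * half u) / u = Num.sqrt u * ((M + 2) * (half u / u)) by ring.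
rewrite ler_wpM2l ?sqrtr_ge0//.
apply: (lap_near_half (M + 2)) => //; [exact: mode_cont|by have := mode_M_ge0; lra|].
move=> t; apply: le_trans (mode_near_half t) _; rewrite ler_wpM2r//; last lra.
by rewrite mulr_ge0 ?hmode_ge0// subr_ge0 cosh_ge1.
Qed.

(** In the derivative the factor - cosh t / 2 is - 1/2 near t = 0, up to the
    excess cosh t - 1; the remaining terms are of relative order 1 / u. *)
Lemma phi1_asymp u : 0 < u -> `|phi1 u + decay u / 2| <= (M + 3) * decay u / u.
Proof.
move=> u0; have u20 : 0 < 2 * u by rewrite mulr_gt0.
have -> : phi1 u + decay u / 2 =
    phi u / (2 * u) + Num.sqrt u * (mac1 u + half u / 2).
  by rewrite /phi1 -half_decay//; ring.
apply: le_trans (ler_normD _ _) _.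
have h1 : `|phi u / (2 * u)| <= decay u / (2 * u).
  by rewrite normrM [`|(2 * u)^-1|]ger0_norm ?invr_ge0 ?(ltW u20)// ler_wpM2r ?invr_ge0 ?(ltW u20)// phi_le.
have h2 : `|mac1 u + half u / 2| <= (M + 2) * (half u / u) / 2.
  have -> : mac1 u + half u / 2 =
      - ((lap (fun t => cosh t * c t) u - half u) / 2) by rewrite /mac1; ring.
  rewrite normrN normrM [`|2^-1|]ger0_norm// ler_wpM2r//.
  apply: lap_near_half => //; [exact: coshc_cont|by have := mode_M_ge0; lra|].
  move=> t; have -> : cosh t * c t - hmode t = (cosh t - 1) * c t + (c t - hmode t) by ring.
  apply: le_trans (ler_normD _ _) _.
  have C0 : 0 <= cosh t - 1 by rewrite subr_ge0 cosh_ge1.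
  have := mode_near_half t; have : `|(cosh t - 1) * c t| <= (cosh t - 1) * hmode t.
    by rewrite normrM (ger0_norm C0) ler_wpM2l//; exact: (mode_le _ _ _ _ mc t).
  by set X := (_ - 1) * hmode t; lra.
have h3 : `|Num.sqrt u * (mac1 u + half u / 2)| <= (M + 2) * decay u / (2 * u).
  rewrite normrM ger0_norm ?sqrtr_ge0// -half_decay//.
  have -> : (M + 2) * (Num.sqrt u * half u) / (2 * u) =
      Num.sqrt u * ((M + 2) * (half u / u) / 2).
    by field; exact: lt0r_neq0.
  by rewrite ler_wpM2l ?sqrtr_ge0.
apply: le_trans (lerD h1 h3) _.
have -> : decay u / (2 * u) + (M + 2) * decay u / (2 * u) = (M + 3) / 2 * (decay u / u).
  by field; exact: lt0r_neq0.
rewrite -[leRHS]mulrA ler_wpM2r//; last by have := mode_M_ge0; lra.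
by rewrite divr_ge0 ?(ltW (decay_gt0 _))// ltW.
Qed.

End ModeTransform.
End Modes.

Global Opaque halfC.

(** * The kernel as an integral over (1, oo), and commutation *)

Local Notation D0 := [set` `]0%R, +oo[].
Local Notation D1 := [set` `]1%R, +oo[].

Section PairIntegrals.
Context {R : realType}.
Implicit Types (f g chi psi : R -> R) (C E : R -> R) (u v t x e : R) (n : nat).

Lemma measurable_D1 : measurable (D1 : set R). Proof. exact: measurable_itv. Qed.
Hint Resolve measurable_D1 : core.

Lemma inD1 t : D1 t -> 1 < t. Proof. by rewrite /= in_itv/= andbT. Qed.

Lemma integrable_cauchy_D1 : intble (D1 : set R) (fun t => (1 + t ^+ 2)^-1).
Proof. by apply: integrableS integrable_cauchy. Qed.

Lemma vanish_le_inv {F : R -> R} (K : R) : (forall t, 1 < t -> `|F t| <= K / t) ->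
  F t @[t --> +oo] --> 0.
Proof.
move=> FK; apply: norm_cvg0.
have c0 : K * t^-1 @[t --> +oo] --> (0 : R).
  rewrite -[X in _ --> X](mulr0 K); apply: cvgMr.
  apply/gtr0_cvgV0; first by near=> t; near: t; exact: nbhs_pinfty_gt.
  exact: cvg_id.
apply: (squeeze_cvgr _ _ c0); last exact: (cvg_cst 0).
near=> t; rewrite normr_ge0/= FK//; near: t; exact: nbhs_pinfty_gt.
Unshelve. all: by end_near. Qed.

(** Continuous on the half-line, exponentially small away from 0, with a
    constant that may blow up there. *)
Definition rapid chi C :=
  (forall x, 0 < x -> {for x, continuous chi}) /\
  (forall e x, 0 < e -> e <= x -> `|chi x| <= C e * expR (- (x / 4))).

Lemma rapid_ge0 {chi C} e : rapid chi C -> 0 < e -> 0 <= C e.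
Proof.
move=> [_ h] e0; have := le_trans (normr_ge0 _) (h e e e0 (lexx _)).
by rewrite pmulr_lge0// expR_gt0.
Qed.

Lemma rapid_bounded {chi C} e x : rapid chi C -> 0 < e -> e <= x -> `|chi x| <= C e.
Proof.
move=> rc e0 ex; apply: le_trans (rc.2 e x e0 ex) _; rewrite ler_piMr//.
  exact: (rapid_ge0 e rc e0).
by rewrite -expR0 ler_expR oppr_le0 divr_ge0// (le_trans (ltW e0)).
Qed.

(** 240 = 2 * 5!: y^5 <= 5! exp y is used at y = e t / 4, and 1 + t^2 <= 2 t^2. *)
Definition powK e : R := 240 * (4 / e) ^+ 5.

Lemma powK_ge0 e : 0 < e -> 0 <= powK e.
Proof.
move=> e0; rewrite /powK; apply: mulr_ge0; first exact: ler0n.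
by rewrite exprn_ge0// divr_ge0// ltW.
Qed.

Lemma pow3_exp_le e t : 0 < e -> 1 < t ->
  t ^+ 3 * expR (- (e * t / 4)) <= powK e * (1 + t ^+ 2)^-1.
Proof.
move=> e0 t1; have t0 : 0 < t by exact: lt_trans t1.
have y0 : 0 <= e * t / 4 by rewrite divr_ge0// mulr_ge0// ltW.
have := powM_expN_le 4 _ y0; rewrite (_ : 5`!%:R = 120 :> R)// => h.
have t2 : 1 + t ^+ 2 <= 2 * t ^+ 2.
  by have := exprn_ege1 2 (ltW t1); lra.
rewrite -ler_pdivrMr ?invr_gt0 ?ltr_pwDl ?sqr_ge0// invrK.
have X0 : 0 <= t ^+ 3 * expR (- (e * t / 4)) by rewrite mulr_ge0 ?expR_ge0// exprn_ge0// ltW.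
apply: le_trans (ler_wpM2l X0 t2) _.
have -> : t ^+ 3 * expR (- (e * t / 4)) * (2 * t ^+ 2) =
    2 * (4 / e) ^+ 5 * ((e * t / 4) ^+ 5 * expR (- (e * t / 4))).
  by field; exact: lt0r_neq0.
have -> : powK e = 2 * (4 / e) ^+ 5 * 120 by rewrite /powK; ring.
by rewrite ler_wpM2l// mulr_ge0// exprn_ge0// divr_ge0// ltW.
Qed.

(** The integral behind the kernel, with powers of t that come from
    differentiating in u. *)
Definition pairI n chi psi u v : R :=
  \int_ D1 (fun t => t ^+ n * (chi (u * t) * psi (v * t))).

Lemma pairI_sym n chi psi u v : pairI n chi psi u v = pairI n psi chi v u.
Proof. by apply: eq_Rintegral => t _; rewrite [chi _ * _]mulrC. Qed.

(** A majorant that depends on u only through a lower bound e, and on the second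
    factor only through a bound of its values. *)
Lemma pair_dom {n chi psi C} e u v (B : R) t : rapid chi C -> 0 < e -> e <= u ->
  (n <= 3)%N -> 1 < t -> `|psi (v * t)| <= B ->
  `|t ^+ n * (chi (u * t) * psi (v * t))| <= C e * B * powK e * (1 + t ^+ 2)^-1.
Proof.
move=> rc e0 eu n3 t1 pB; have t0 : 0 < t by exact: lt_trans t1.
have B0 : 0 <= B by exact: le_trans (normr_ge0 _) pB.
have C0 : 0 <= C e by exact: (rapid_ge0 e rc e0).
have eut : e * t <= u * t by rewrite ler_wpM2r// ltW.
have h1 : `|chi (u * t)| <= C e * expR (- (e * t / 4)).
  apply: le_trans (rc.2 e (u * t) e0 _) _.
    by apply: (le_trans eu); rewrite ler_peMr ?(ltW t1)//; exact: le_trans (ltW e0) eu.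
  by rewrite ler_wpM2l// ler_expR lerN2 ler_wpM2r.
have tn : t ^+ n <= t ^+ 3 by apply: ler_weXn2l => //; exact: ltW.
have h2 := pow3_exp_le e t e0 t1.
rewrite !normrM (ger0_norm (exprn_ge0 _ (ltW t0))).
apply: (@le_trans _ _ (t ^+ 3 * (C e * expR (- (e * t / 4)) * B))).
  apply: ler_pM => //; first by rewrite exprn_ge0// ltW.
  exact: ler_pM.
have -> : t ^+ 3 * (C e * expR (- (e * t / 4)) * B) =
  C e * B * (t ^+ 3 * expR (- (e * t / 4))) by ring.
by rewrite -[leRHS]mulrA ler_wpM2l// mulr_ge0.
Qed.

Lemma mulr_cont (u : R) : continuous (fun t => u * t).
Proof. by move=> t; apply: der_cont; exact: (derM (derC u t) (derX t)). Qed.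

Lemma scale_cont {chi} u t : (forall x, 0 < x -> {for x, continuous chi}) ->
  0 < u -> 0 < t -> {for t, continuous (fun t => chi (u * t))}.
Proof.
move=> cc u0 t0; apply: (@continuous_comp _ _ _ (fun t => u * t) chi).
  exact: mulr_cont.
by apply: cc; rewrite mulr_gt0.
Qed.

Lemma pair_cont {n chi psi C E} u v t : rapid chi C -> rapid psi E -> 0 < u -> 0 < v ->
  0 < t -> {for t, continuous (fun t => t ^+ n * (chi (u * t) * psi (v * t)))}.
Proof.
move=> rc rp u0 v0 t0; apply: cvgM; first exact: exprn_continuous.
by apply: cvgM; [exact: (scale_cont _ _ rc.1)|exact: (scale_cont _ _ rp.1)].
Qed.

Lemma pair_int {n chi psi C E} u v : rapid chi C -> rapid psi E -> (n <= 3)%N ->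
  0 < u -> 0 < v -> intble D1 (fun t => t ^+ n * (chi (u * t) * psi (v * t))).
Proof.
move=> rc rp n3 u0 v0.
apply: (integrable_dom (fun t => C u * E v * powK u * (1 + t ^+ 2)^-1)) => //.
- apply: measurable_halfline => t t1; apply: (pair_cont _ _ _ rc rp) => //.
  exact: lt_trans t1.
- move=> t /inD1 t1; apply: (pair_dom u) => //; apply: (rapid_bounded v) => //.
  by rewrite ler_peMr// ltW.
- by apply: intbleZ => //; exact: integrable_cauchy_D1.
Qed.

Definition cauchyD1 : R := \int_ D1 (fun t => (1 + t ^+ 2)^-1).

Lemma pair_le {n chi psi C E} e u v (B : R) : rapid chi C -> rapid psi E -> (n <= 3)%N ->
  0 < e -> e <= u -> 0 < v -> (forall t, 1 < t -> `|psi (v * t)| <= B) ->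
  `|pairI n chi psi u v| <= C e * powK e * cauchyD1 * B.
Proof.
move=> rc rp n3 e0 eu v0 pB; have u0 : 0 < u by exact: lt_le_trans eu.
have -> : C e * powK e * cauchyD1 * B =
    \int_ D1 (fun t => C e * B * powK e * (1 + t ^+ 2)^-1).
  by rewrite RintegralZl//; [rewrite /cauchyD1; ring|exact: integrable_cauchy_D1].
apply: norm_Rintegral_le => //; first exact: (pair_int u v rc rp).
  by apply: intbleZ => //; exact: integrable_cauchy_D1.
by move=> t /inD1 t1; apply: pair_dom rc e0 eu n3 t1 (pB t t1).
Qed.

Lemma pair_der {n chi chi1 psi C C1 E} u v : rapid chi C -> rapid chi1 C1 ->
  rapid psi E -> (forall x, 0 < x -> has_der chi x (chi1 x)) -> (n <= 2)%N ->
  0 < u -> 0 < v ->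
  has_der (fun u => pairI n chi psi u v) u (pairI n.+1 chi1 psi u v).
Proof.
move=> rc rc1 rp dc n2 u0 v0.
have uu : u / 2 < u < u + 1 by apply/andP; split; lra.
have pos x : u / 2 < x < u + 1 -> 0 < x by move=> /andP[h _]; lra.
apply: (der_under_integral (u / 2) (u + 1)
  (f := fun x t => t ^+ n * (chi (x * t) * psi (v * t)))
  (df := fun x t => t ^+ n.+1 * (chi1 (x * t) * psi (v * t)))
  (G := fun t => C1 (u / 2) * E v * powK (u / 2) * (1 + t ^+ 2)^-1)) => //.
- by move=> x /pos x0; apply: (pair_int x v rc rp) => //; exact: leq_trans n2 _.
- move=> x t /pos x0 /inD1 t1; have t0 : 0 < t by exact: lt_trans t1.
  have dx := derM (derX x) (derC t x).
  have dchi : has_der (fun y => chi (y * t)) x (chi1 (x * t) * (1 * t + x * 0)).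
    by apply: (der_comp (g := fun y => y * t) (dc (x * t) _) dx); rewrite mulr_gt0.
  apply: has_der_eq; first exact: (derM (derC (t ^+ n) x) (derM dchi (derC (psi (v * t)) x))).
  by rewrite /= exprS; ring.
- move=> x t /andP[ux _] /inD1 t1; apply: (pair_dom (u / 2)) => //; [|exact: ltW|].
    by rewrite divr_gt0.
  by apply: (rapid_bounded v) => //; rewrite ler_peMr// ltW.
- by apply: intbleZ => //; exact: integrable_cauchy_D1.
Qed.

End PairIntegrals.

Section Waves.
Context {R : realType}.
Implicit Types (f : R -> R) (b N u v t x e : R).

(** The properties of phi on which everything below rests. *)
Record wave f (f1 : R -> R) b N : Prop := Wave {
  wave_der : forall u, 0 < u -> has_der f u (f1 u);
  wave_der1 : forall u, 0 < u -> has_der f1 u ((4^-1 + b / u ^+ 2) * f u);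
  wave_le : forall u, 0 < u -> `|f u| <= decay u;
  wave_le1 : forall u, 0 < u -> `|f1 u| <= (2^-1 + u^-1) * decay u;
  wave_asymp : forall u, 0 < u -> `|f u - decay u| <= N * decay u / u;
  wave_asymp1 : forall u, 0 < u -> `|f1 u + decay u / 2| <= N * decay u / u }.

Lemma mode_wave {c c1 : R -> R} {k M : R} : mode c c1 k M ->
  wave (@phi _ c) (@phi1 _ c) (k - 4^-1) (M + 3).
Proof.
move=> mc; split=> u u0.
- exact: (der_phi mc).
- exact: (der_phi1 mc).
- exact: (phi_le mc).
- exact: (phi1_le mc).
- apply: le_trans (phi_asymp mc u u0) _.
  rewrite ler_wpM2r ?invr_ge0 ?(ltW u0)// ler_wpM2r ?(ltW (decay_gt0 _))//.
  by rewrite lerD2l ler_nat.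
- exact: (phi1_asymp mc).
Qed.

Section OneWave.
Context {f f1 : R -> R} {b N : R}.
Hypothesis wf : wave f f1 b N.

Definition wave2 x := (4^-1 + b / x ^+ 2) * f x.

Let df := wave_der _ _ _ _ wf.
Let df1 := wave_der1 _ _ _ _ wf.

Lemma decay_le x : 0 <= x -> decay x <= halfC * expR (- (x / 4)) :> R.
Proof.
move=> x0; rewrite ler_wpM2l ?(ltW halfC_gt0)// ler_expR lerN2.
by rewrite ler_wpM2l// lef_pV2 ?posrE// ler_nat.
Qed.

Lemma decay_anti x y : x <= y -> decay y <= decay x :> R.
Proof.
move=> xy; rewrite ler_wpM2l ?(ltW halfC_gt0)// ler_expR lerN2.
by rewrite ler_wpM2r.
Qed.

Lemma rapid_wave : rapid f (fun=> halfC).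
Proof.
split=> [x x0|e x e0 ex]; first exact: der_cont (df x x0).
have x0 : 0 < x by exact: lt_le_trans ex.
exact: le_trans (wave_le _ _ _ _ wf x x0) (decay_le x (ltW x0)).
Qed.

Lemma rapid_wave1 : rapid f1 (fun e => (2^-1 + e^-1) * halfC).
Proof.
split=> [x x0|e x e0 ex]; first exact: der_cont (df1 x x0).
have x0 : 0 < x by exact: lt_le_trans ex.
apply: le_trans (wave_le1 _ _ _ _ wf x x0) _; rewrite -mulrA; apply: ler_pM.
- by rewrite addr_ge0// invr_ge0 ltW.
- exact: ltW (decay_gt0 _).
- by rewrite lerD2l lef_pV2 ?posrE.
- exact: decay_le (ltW x0).
Qed.

Lemma rapid_wave2 : rapid wave2 (fun e => (4^-1 + `|b| / e ^+ 2) * halfC).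
Proof.
split=> [x x0|e x e0 ex].
  apply: cvgM; last exact: der_cont (df x x0).
  apply: cvgD; first exact: cvg_cst.
  apply: cvgM; first exact: cvg_cst.
  apply: cvgV; first by rewrite expf_neq0// lt0r_neq0.
  exact: exprn_continuous.
have x0 : 0 < x by exact: lt_le_trans ex.
rewrite normrM -mulrA; apply: ler_pM => //.
  apply: le_trans (ler_normD _ _) _; rewrite [`|4^-1|]ger0_norm// lerD2l.
  rewrite normrM ler_wpM2l// ger0_norm ?invr_ge0 ?sqr_ge0//.
  by rewrite lef_pV2 ?posrE ?exprn_gt0// lerXn2r// nnegrE ltW.
exact: le_trans (wave_le _ _ _ _ wf x x0) (decay_le x (ltW x0)).
Qed.

(** Phi1 and Phi2 are the first two derivatives of Phi in the first variable. *)
Definition Phi u v := pairI 0 f f u v.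
Definition Phi1 u v := pairI 1 f1 f u v.
Definition Phi2 u v := pairI 2 wave2 f u v.

Lemma Phi_sym u v : Phi u v = Phi v u. Proof. exact: pairI_sym. Qed.

Lemma der_Phi u v : 0 < u -> 0 < v -> has_der (Phi^~ v) u (Phi1 u v).
Proof. exact: (pair_der u v rapid_wave rapid_wave1 rapid_wave df). Qed.

Lemma der_Phi1 u v : 0 < u -> 0 < v -> has_der (Phi1^~ v) u (Phi2 u v).
Proof. exact: (pair_der u v rapid_wave1 rapid_wave2 rapid_wave df1). Qed.

(** The same function of v is a transform of f1 and of wave2, hence continuous. *)
Lemma Phi_cont2 u v : 0 < u -> 0 < v ->
  [/\ {for v, continuous (Phi u)}, {for v, continuous (Phi1 u)} &
      {for v, continuous (Phi2 u)}].
Proof.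
move=> u0 v0.
have H n (chi : R -> R) C : rapid chi C -> (n <= 2)%N ->
    {for v, continuous (pairI n chi f u)}.
  move=> rc n2; have -> : pairI n chi f u = fun v => pairI n f chi v u.
    by apply/funext => w; exact: pairI_sym.
  exact: der_cont (pair_der v u rapid_wave rapid_wave1 rc df n2 v0 u0).
by split; [exact: (H _ _ _ rapid_wave)|exact: (H _ _ _ rapid_wave1)|exact: (H _ _ _ rapid_wave2)].
Qed.

(** Bounds that do not deteriorate as v tends to 0. *)
Lemma Phi_le e : 0 < e -> exists K : R, 0 <= K /\ forall u v, e <= u -> 0 < v ->
  [/\ `|Phi u v| <= K * expR (- (v / 2)), `|Phi1 u v| <= K * expR (- (v / 2)) &
      `|Phi2 u v| <= K * expR (- (v / 2))].
Proof.
move=> e0.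
have H n (chi : R -> R) C : rapid chi C -> (n <= 3)%N -> exists K : R,
    0 <= K /\ forall u v, e <= u -> 0 < v -> `|pairI n chi f u v| <= K * expR (- (v / 2)).
  move=> rc n3.
  have S0 : 0 <= cauchyD1 :> R.
    apply: Rintegral_ge0 => t _; by rewrite invr_ge0 addr_ge0// sqr_ge0.
  exists (C e * powK e * cauchyD1 * halfC); split.
    rewrite mulr_ge0 ?(ltW halfC_gt0)// mulr_ge0// mulr_ge0 ?powK_ge0//.
    exact: (rapid_ge0 e rc e0).
  move=> u v eu v0; rewrite -mulrA; apply: (pair_le e u v _ rc rapid_wave) => // t t1.
  have vt0 : 0 < v * t by rewrite mulr_gt0// (lt_trans _ t1).
  apply: le_trans (wave_le _ _ _ _ wf _ vt0) _; apply: decay_anti.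
  by rewrite ler_peMr// ltW.
have [K0 [p0 h0]] := H 0%N f _ rapid_wave isT.
have [K1 [p1 h1]] := H 1%N f1 _ rapid_wave1 isT.
have [K2 [p2 h2]] := H 2%N wave2 _ rapid_wave2 isT.
exists (K0 + K1 + K2); split; first by rewrite !addr_ge0.
move=> u v eu v0; have E0 := expR_ge0 (- (v / 2)).
split; [apply: le_trans (h0 u v eu v0) _|apply: le_trans (h1 u v eu v0) _|
  apply: le_trans (h2 u v eu v0) _]; rewrite ler_wpM2r//; lra.
Qed.

(** The Wronskian of t -> f (u t) and t -> f (v t); the potentials b / t^2 cancel
    in its derivative. *)
Definition wron u v t := u * (f1 (u * t) * f (v * t)) - v * (f (u * t) * f1 (v * t)).

Lemma der_wron u v t : 0 < u -> 0 < v -> 0 < t ->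
  has_der (wron u v) t ((u ^+ 2 - v ^+ 2) / 4 * (f (u * t) * f (v * t))).
Proof.
move=> u0 v0 t0.
have d (chi chi1 : R -> R) (w : R) : (forall x, 0 < x -> has_der chi x (chi1 x)) ->
    0 < w -> has_der (fun t => chi (w * t)) t (chi1 (w * t) * w).
  move=> dc w0; apply: has_der_eq.
    by apply: (der_comp (g := fun t => w * t) (dc (w * t) _) (derM (derC w t) (derX t)));
      rewrite mulr_gt0.
  by rewrite /=; ring.
have d0 w := d f f1 w df; have d1 w := d f1 _ w df1.
apply: has_der_eq.
  exact: (derD (derM (derC u t) (derM (d1 u u0) (d0 v v0)))
    (derN (derM (derC v t) (derM (d0 u u0) (d1 v v0))))).
by rewrite /=; field; rewrite !lt0r_neq0.
Qed.

(** Even after multiplication by t^2, as needed for the boundary term at infinity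
    in Phi_commute, the Wronskian vanishes there. *)
Lemma wron_le u v t n : 0 < u -> 0 < v -> 1 < t -> (n <= 2)%N ->
  `|t ^+ n * wron u v t| <= (u * ((2^-1 + u^-1) * halfC * halfC * powK u) +
     v * ((2^-1 + v^-1) * halfC * halfC * powK v)) / t.
Proof.
move=> u0 v0 t1 n2; have t0 : 0 < t by exact: lt_trans t1.
have B (w : R) : 0 < w -> `|f (w * t)| <= halfC.
  by move=> w0; apply: (rapid_bounded w _ rapid_wave) => //; rewrite ler_peMr// ltW.
have n3 : (n <= 3)%N by exact: leq_trans n2 _.
have h1 := pair_dom u u v halfC t rapid_wave1 u0 (lexx _) n3 t1 (B v v0).
have h2 := pair_dom v v u halfC t rapid_wave1 v0 (lexx _) n3 t1 (B u u0).
have it : (1 + t ^+ 2)^-1 <= t^-1.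
  by rewrite lef_pV2 ?posrE ?ltr_pwDl ?sqr_ge0//; nra.
have k0 (w : R) : 0 < w -> 0 <= (2^-1 + w^-1) * halfC * halfC * powK w.
  move=> w0; apply: mulr_ge0; last exact: powK_ge0.
  apply: mulr_ge0; last exact: ltW halfC_gt0.
  apply: mulr_ge0; last exact: ltW halfC_gt0.
  by rewrite addr_ge0// invr_ge0 ltW.
have {}h1 := le_trans h1 (ler_wpM2l (k0 u u0) it).
have {}h2 := le_trans h2 (ler_wpM2l (k0 v v0) it).
have -> : t ^+ n * wron u v t = u * (t ^+ n * (f1 (u * t) * f (v * t))) -
    v * (t ^+ n * (f1 (v * t) * f (u * t))) by rewrite /wron; ring.
apply: le_trans (ler_normB _ _) _; rewrite [leRHS]mulrDl; apply: lerD;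
  by rewrite normrM gtr0_norm// -[leRHS]mulrA; apply: ler_wpM2l => //; exact: ltW.
Qed.

Let ffi u v := @pair_int R 0 _ _ _ _ u v rapid_wave rapid_wave isT.

(** The Christoffel--Darboux type formula for the kernel. *)
Lemma Phi_wron u v : 0 < u -> 0 < v ->
  (u ^+ 2 - v ^+ 2) / 4 * Phi u v = v * (f u * f1 v) - u * (f1 u * f v).
Proof.
move=> u0 v0.
have -> : (u ^+ 2 - v ^+ 2) / 4 * Phi u v =
    \int_ D1 (fun t => (u ^+ 2 - v ^+ 2) / 4 * (f (u * t) * f (v * t))).
  rewrite /Phi /pairI -RintegralZl//; last exact: ffi.
  by apply: eq_Rintegral => t _; rewrite expr0 mul1r.
have cF : {for (1 : R), continuous (wron u v)} by exact: der_cont (der_wron u v 1 u0 v0 ltr01).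
rewrite (FTC_halfline (F := wron u v) 1 (wron u v 1) 0).
- by rewrite /wron !mulr1; ring.
- apply: intbleZ => //.
  rewrite (_ : (fun x => _) = fun t => t ^+ 0 * (f (u * t) * f (v * t))).
    exact: ffi.
  by apply/funext => t; rewrite expr0 mul1r.
- by move=> t t1; apply: der_wron => //; exact: lt_trans t1.
- move=> t t1; have t0 : 0 < t by exact: lt_trans t1.
  apply: cvgM; first exact: cvg_cst.
  by apply: cvgM; apply: scale_cont => //; exact: rapid_wave.1.
- by apply: cvg_at_right_filter.
- set K : R := (u * ((2^-1 + u^-1) * halfC * halfC * powK u) +
     v * ((2^-1 + v^-1) * halfC * halfC * powK v)).
  apply: (vanish_le_inv K) => t t1.
  by have := wron_le u v t 0 u0 v0 t1 isT; rewrite expr0 mul1r.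
Qed.

(** Applied to f (u t), the operator in u becomes the Legendre-type operator
    d/dt (1 - t^2) d/dt - b / t^2, the same for u and for v. Its symmetry on
    (1, oo), where 1 - t^2 kills the boundary term, is the commutation relation. *)
Lemma Phi_commute u v : 0 < u -> 0 < v ->
  - (u ^+ 2 * Phi2 u v + 2 * u * Phi1 u v) + u ^+ 2 / 4 * Phi u v =
  - (v ^+ 2 * Phi2 v u + 2 * v * Phi1 v u) + v ^+ 2 / 4 * Phi v u.
Proof.
move=> u0 v0.
pose I (chi psi : R -> R) n t := t ^+ n * (chi (u * t) * psi (v * t)).
have i0 : intble D1 (I f f 0%N) by exact: ffi.
have i1 : intble D1 (I f1 f 1%N) by exact: (pair_int u v rapid_wave1 rapid_wave).
have i2 : intble D1 (I wave2 f 2%N) by exact: (pair_int u v rapid_wave2 rapid_wave).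
have j1 : intble D1 (I f f1 1%N) by exact: (pair_int u v rapid_wave rapid_wave1).
have j2 : intble D1 (I f wave2 2%N) by exact: (pair_int u v rapid_wave rapid_wave2).
(* the primitive of the difference of the two sides under the integral *)
pose G t := (1 - t ^+ 2) * wron u v t.
pose g t := - (2 * t) * wron u v t +
  (1 - t ^+ 2) * ((u ^+ 2 - v ^+ 2) / 4 * (f (u * t) * f (v * t))).
have dG t : 0 < t -> has_der G t (g t).
  move=> t0; apply: has_der_eq.
    exact: (derM (derD (derC 1 t) (derN (derX2 t))) (der_wron u v t u0 v0 t0)).
  by rewrite /g /=; ring.
pose h t := (v ^+ 2 * I f wave2 2%N t + 2 * v * I f f1 1%N t) -
  (u ^+ 2 * I wave2 f 2%N t + 2 * u * I f1 f 1%N t) + (u ^+ 2 - v ^+ 2) / 4 * I f f 0%N t.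
have gh t : 0 < t -> g t = h t.
  move=> t0; rewrite /g /h /I /wron /wave2; field.
  by rewrite !lt0r_neq0.
have ih : intble D1 h.
  by apply: intbleD => //; [apply: intbleB => //; apply: intbleD => //; exact: intbleZ|exact: intbleZ].
have ch t : 0 < t -> {for t, continuous h}.
  move=> t0.
  have cI (chi psi : R -> R) C E n : rapid chi C -> rapid psi E -> {for t, continuous (I chi psi n)}.
    by move=> rc rp; exact: (pair_cont u v t rc rp).
  have cZ (k : R) (q : R -> R) : {for t, continuous q} -> {for t, continuous (fun t => k * q t)}.
    by move=> cq; apply: cvgM; [exact: cvg_cst|exact: cq].
  apply: cvgD; last by apply: cZ; exact: cI rapid_wave rapid_wave.
  apply: cvgB; apply: cvgD; apply: cZ.
  - exact: cI rapid_wave rapid_wave2.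
  - exact: cI rapid_wave rapid_wave1.
  - exact: cI rapid_wave2 rapid_wave.
  - exact: cI rapid_wave1 rapid_wave.
have G1 : G 1 = 0 by rewrite /G expr1n subrr mul0r.
have h0 : \int_ D1 h = 0.
  rewrite -[RHS](subrr 0); apply: (FTC_halfline (F := G) 1 0 0 ih).
  - move=> t t1; have t0 : 0 < t by exact: lt_trans t1.
    exact: (has_der_eq _ (dG t t0) (gh t t0)).
  - by move=> t t1; apply: ch; exact: lt_trans t1.
  - by rewrite -G1; apply: cvg_at_right_filter; exact: der_cont (dG 1 ltr01).
  - set K : R := (u * ((2^-1 + u^-1) * halfC * halfC * powK u) +
     v * ((2^-1 + v^-1) * halfC * halfC * powK v)).
    apply: (vanish_le_inv (K + K)) => t t1.
    have w0 := wron_le u v t 0 u0 v0 t1 isT; have w2 := wron_le u v t 2 u0 v0 t1 isT.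
    rewrite expr0 mul1r in w0; rewrite /G mulrBl mul1r [leRHS]mulrDl.
    by apply: le_trans (ler_normB _ _) _; exact: lerD.
have iZ (k : R) (q : R -> R) : intble D1 q -> intble D1 (fun t => k * q t).
  exact: intbleZ.
have RZ (k : R) (q : R -> R) : intble D1 q ->
    \int_ D1 (fun t => k * q t) = k * \int_ D1 q by exact: Rint_scale.
have A1 := iZ (v ^+ 2) _ j2; have A2 := iZ (2 * v) _ j1.
have B1 := iZ (u ^+ 2) _ i2; have B2 := iZ (2 * u) _ i1.
have A := intbleD measurable_D1 A1 A2; have B := intbleD measurable_D1 B1 B2.
have AB := intbleB measurable_D1 A B; have C0 := iZ ((u ^+ 2 - v ^+ 2) / 4) _ i0.
move: h0; rewrite /h (Rint_add measurable_D1 AB C0).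
rewrite (Rint_sub measurable_D1 A B) (Rint_add measurable_D1 A1 A2).
rewrite (Rint_add measurable_D1 B1 B2) (RZ _ _ j2) (RZ _ _ j1) (RZ _ _ i2).
rewrite (RZ _ _ i1) (RZ _ _ i0) /I.
rewrite -/(pairI 0 f f u v) -/(pairI 1 f f1 u v) -/(pairI 1 f1 f u v).
rewrite -/(pairI 2 f wave2 u v) -/(pairI 2 wave2 f u v).
rewrite (pairI_sym 1 f f1) (pairI_sym 2 f wave2) (Phi_sym v u).
rewrite -/(Phi u v) -/(Phi1 u v) -/(Phi1 v u) -/(Phi2 u v) -/(Phi2 v u); lra.
Qed.

End OneWave.
End Waves.

(** * Recessive solutions of second order equations *)

Section Recessive.
Context {R : realType}.
Implicit Types (a u x : R).

(** Gronwall's argument run backwards: (z^2 + z'^2) exp ((1 + Q) u) is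
    nondecreasing when |q| <= Q. *)
Lemma ode_backward_unique {z z1 q : R -> R} {a b Q : R} : a <= b ->
  (forall u, a <= u <= b -> has_der z u (z1 u)) ->
  (forall u, a <= u <= b -> has_der z1 u (q u * z u)) ->
  (forall u, a <= u <= b -> `|q u| <= Q) -> z b = 0 -> z1 b = 0 -> z a = 0.
Proof.
move=> ab dz dz1 qQ zb z1b.
pose E u := (z u * z u + z1 u * z1 u) * expR ((1 + Q) * u).
pose E1 u := (2 * (1 + q u) * (z u * z1 u) + (1 + Q) * (z u * z u + z1 u * z1 u)) *
  expR ((1 + Q) * u).
have : E a <= E b.
  apply: (der_ge0_le (f1 := E1)) => // u uab.
    apply: has_der_eq.
      exact: (derM (derD (derM (dz u uab) (dz u uab)) (derM (dz1 u uab) (dz1 u uab)))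
        (der_exp (derM (derC (1 + Q) u) (derX u)))).
    by rewrite /E1 /=; ring.
  rewrite /E1 mulr_ge0 ?expR_ge0//.
  have := qQ u uab; rewrite ler_norml => /andP[q1 q2].
  have s1 : 0 <= (z u + z1 u) ^+ 2 by exact: sqr_ge0.
  have s2 : 0 <= (z u - z1 u) ^+ 2 by exact: sqr_ge0.
  have h1 : 0 <= (1 + Q + (1 + q u)) * (z u + z1 u) ^+ 2 + (1 + Q - (1 + q u)) * (z u - z1 u) ^+ 2.
    have [p0|p0] := leP 0 (1 + Q + (1 + q u)).
      by rewrite addr_ge0// mulr_ge0//; lra.
    by have := ler_norml (q u) Q; lra.
  have -> : 2 * (1 + q u) * (z u * z1 u) + (1 + Q) * (z u * z u + z1 u * z1 u) =
    2^-1 * ((1 + Q + (1 + q u)) * (z u + z1 u) ^+ 2 + (1 + Q - (1 + q u)) * (z u - z1 u) ^+ 2).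
    by field.
  by rewrite mulr_ge0.
rewrite /E zb z1b !mul0r addr0 mul0r pmulr_lle0 ?expR_gt0// => h.
have z2 : z a * z a <= 0.
  by apply: le_trans h; rewrite lerDl -expr2 sqr_ge0.
by apply/eqP; rewrite -sqrf_eq0 expr2 eq_le z2 -expr2 sqr_ge0.
Qed.

(** The recessive solution at infinity is unique up to a factor: the Wronskian
    w is constant and (y / Y)' = w / Y^2 is bounded below, so y / Y can only
    converge when w = 0. *)
Lemma recessive_unique {y y1 Y Y1 q : R -> R} {s : nat -> R} {c B U : R} :
  (forall u, 0 < u -> has_der y u (y1 u)) ->
  (forall u, 0 < u -> has_der y1 u (q u * y u)) ->
  (forall u, 0 < u -> has_der Y u (Y1 u)) ->
  (forall u, 0 < u -> has_der Y1 u (q u * Y u)) ->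
  (forall a, 0 < a -> exists Q, forall u, a <= u -> `|q u| <= Q) ->
  0 < U -> (forall u, U <= u -> 0 < Y u <= B) ->
  s n @[n --> \oo] --> +oo -> y (s n) / Y (s n) @[n --> \oo] --> c ->
  forall u, 0 < u -> y u = c * Y u.
Proof.
move=> dy dy1 dY dY1 qQ U0 YB soo yYc.
pose z u := y u - c * Y u; pose z1 u := y1 u - c * Y1 u.
have dz u : 0 < u -> has_der z u (z1 u).
  move=> u0; apply: has_der_eq; first exact: (derD (dy u u0) (derN (derM (derC c u) (dY u u0)))).
  by rewrite /z1 /=; ring.
have dz1 u : 0 < u -> has_der z1 u (q u * z u).
  move=> u0; apply: has_der_eq; first exact: (derD (dy1 u u0) (derN (derM (derC c u) (dY1 u u0)))).
  by rewrite /z /=; ring.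
have YU u : U <= u -> 0 < Y u by move=> /YB/andP[].
have pos u : U <= u -> 0 < u by exact: lt_le_trans.
have B0 : 0 < B by have /andP[h /(lt_le_trans h)] := YB U (lexx _).
pose w u := z1 u * Y u - z u * Y1 u.
have dw u : 0 < u -> has_der w u 0.
  move=> u0; apply: has_der_eq.
    exact: (derD (derM (dz1 u u0) (dY u u0)) (derN (derM (dz u u0) (dY1 u u0)))).
  by rewrite /=; ring.
pose k := w U.
have wk u : 0 < u -> w u = k by move=> u0; exact: der0_eq_pos.
pose r u := z u / Y u.
have dr u : U <= u -> has_der r u (k / Y u ^+ 2).
  move=> Uu; have u0 := pos u Uu; have Yn : Y u != 0 by rewrite gt_eqF// YU.
  apply: has_der_eq; first exact: (derM (dz u u0) (derV Yn (dY u u0))).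
  by rewrite -(wk u u0) /w /=; field.
have rc : r (s n) @[n --> \oo] --> 0.
  have : y (s n) / Y (s n) - c @[n --> \oo] --> 0.
    by rewrite -(subrr c); apply: cvgB => //; exact: cvg_cst.
  apply: cvg_trans; apply: near_eq_cvg; near=> n.
  have Un : U <= s n by near: n; exact: (cvgryPge _).1.
  by rewrite /r /z mulrBl mulfK// gt_eqF// YU.
have k0 : k = 0.
  apply/eqP/negPn/negP => kn.
  have k2 : 0 < k ^+ 2 by rewrite lt0r sqrf_eq0 kn sqr_ge0.
  (* (k r)' = k^2 / Y^2 >= k^2 / B^2, so k r is unbounded unless k = 0 *)
  have grow u : U <= u -> k ^+ 2 / B ^+ 2 * (u - U) <= k * r u - k * r U.
    move=> Uu.
    have := der_le_compare (f := fun u => k ^+ 2 / B ^+ 2 * u) (g := fun u => k * r u)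
      (f1 := fun=> k ^+ 2 / B ^+ 2) (g1 := fun u => k ^+ 2 / Y u ^+ 2) U u Uu.
    rewrite mulrBr; apply.
    - move=> x _; apply: has_der_eq; first exact: (derM (derC _ x) (derX x)).
      by rewrite /=; ring.
    - move=> x /andP[Ux _]; apply: has_der_eq; first exact: (derM (derC k x) (dr x Ux)).
      by rewrite /=; ring.
    - move=> x /andP[Ux _]; have /andP[Y0 YBx] := YB x Ux.
      rewrite ler_wpM2l ?sqr_ge0// lef_pV2 ?posrE ?exprn_gt0//.
      by rewrite lerXn2r// nnegrE ltW.
  pose T := U + (1 + `|k * r U|) / (k ^+ 2 / B ^+ 2).
  have /cvgrPdist_lt rc' : k * r (s n) @[n --> \oo] --> 0.
    by rewrite -(mulr0 k); apply: cvgM => //; exact: cvg_cst.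
  have kB : 0 < k ^+ 2 / B ^+ 2 by rewrite divr_gt0// exprn_gt0.
  have : \forall n \near \oo, False.
    near=> n.
    have h1 : `|0 - k * r (s n)| < 1 by near: n; exact: rc'.
    have h2 : T <= s n by near: n; exact: (cvgryPge _).1.
    have UT : U <= T.
      by rewrite lerDl divr_ge0 ?(ltW kB)// addr_ge0.
    have := grow _ (le_trans UT h2).
    have : 1 + `|k * r U| <= k ^+ 2 / B ^+ 2 * (s n - U).
      by rewrite [leRHS]mulrC -ler_pdivrMr// lerBrDl.
    have := ler_norm (- (k * r U)); rewrite normrN.
    by move: h1; rewrite sub0r normrN => /ltr_normlW; lra.
  by move=> /(@filter_ex _ _ _) [].
have rconst u : U <= u -> r u = r U.
  move=> Uu; apply/esym/der0_eq => // x /andP[Ux _].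
  by apply: has_der_eq; first exact: dr; rewrite k0 mul0r.
have rU : r U = 0.
  have : r (s n) @[n --> \oo] --> r U.
    apply: cvg_near_cst; near=> n; apply: rconst.
    by near: n; exact: (cvgryPge _).1.
  by move=> /cvg_lim <- //; exact: cvg_lim.
have zU u : U <= u -> z u = 0.
  move=> Uu; have := rconst u Uu; rewrite rU => /eqP.
  by rewrite mulf_eq0 invr_eq0 (gt_eqF (YU u Uu)) orbF => /eqP.
have U1 : 0 < U + 1 by rewrite addr_gt0.
have z1U : z1 (U + 1) = 0.
  apply: (has_der_unique (dz _ U1)).
  apply: (der_near (f := fun=> 0)); last exact: derC.
  near=> u; rewrite zU//; apply/ltW; near: u; apply: lt_nbhsr.
  by rewrite ltrDl.
move=> u u0; apply/eqP; rewrite -subr_eq0; apply/eqP; rewrite -/(z u).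
have [Uu|uU] := leP U u; first exact: zU.
have [Q hQ] := qQ u u0.
apply: (ode_backward_unique (b := U + 1) (q := q) (Q := Q) (z1 := z1)) => //.
- by rewrite (le_trans (ltW uU))// lerDl.
- by move=> x /andP[ux _]; apply: dz; exact: lt_le_trans ux.
- by move=> x /andP[ux _]; apply: dz1; exact: lt_le_trans ux.
- by move=> x /andP[ux _]; exact: hQ.
- by apply: zU; rewrite lerDl.
Unshelve. all: by end_near. Qed.

End Recessive.

(** * The integral operator applied to an eigenfunction *)

Section SingularWeight.
Context {R : realType}.
Implicit Types v : R.

Lemma measurable_D0 : measurable (D0 : set R). Proof. exact: measurable_itv. Qed.

Lemma inD0 v : D0 v -> 0 < v. Proof. by rewrite /= in_itv/= andbT. Qed.

(** Fourth roots measure the behaviour at 0: Macdonald functions of imaginary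
    order are at most a multiple of u^(- 1/4) there, a crude estimate that keeps
    all the integrals below convergent. *)
Definition qroot v : R := v `^ 4^-1.

Lemma qroot_gt0 v : 0 < v -> 0 < qroot v. Proof. exact: powR_gt0. Qed.

Lemma qroot4 v : 0 <= v -> qroot v ^+ 4 = v.
Proof.
by move=> v0; rewrite /qroot -powR_mulrn ?powR_ge0// -powRrM mulVf ?pnatr_eq0// powRr1.
Qed.

Lemma der_qroot v : 0 < v -> has_der qroot v (qroot v / v / 4).
Proof.
move=> v0; apply: has_der_eq; first exact: is_derive1_powR.
have q0 : 0 < 4^-1 :> R by rewrite invr_gt0.
have := @mulr_powRB1 R v 4^-1 (ltW v0) q0; rewrite -/(qroot v) => <-.
by field; exact: lt0r_neq0.
Qed.

(** The integrable majorant on the half-line: v^(-3/4) exp (- v / 2). *)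
Definition end_weight v : R := qroot v / v * expR (- (v / 2)).

Lemma weight_ge0 v : 0 < v -> 0 <= end_weight v.
Proof. by move=> v0; rewrite mulr_ge0 ?expR_ge0// divr_ge0 ?powR_ge0// ltW. Qed.

(** Comparison with the derivative of atan (v^(1/4)), of order v^(-3/4) at 0 and
    v^(-5/4) at infinity. *)
Lemma integrable_weight : intble (D0 : set R) end_weight.
Proof.
pose f v : R := (1 + qroot v ^+ 2)^-1 * (qroot v / v / 4).
have qc v : 0 < v -> {for v, continuous qroot} by move=> v0; exact: der_cont (der_qroot v v0).
have qvc v : 0 < v -> {for v, continuous (fun v => qroot v / v)}.
  move=> v0; apply: cvgM; first exact: qc.
  by apply: cvgV; [exact: lt0r_neq0|exact: cvg_id].
have q1 v : 1 + qroot v ^+ 2 != 0 by rewrite gt_eqF// ltr_pwDl// sqr_ge0.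
have fi : intble (D0 : set R) f.
  apply: (integrable_bounded_primitive (exhausts_oy 0) (F := fun v => atan (qroot v)) (pi / 2)).
  - move=> v /inD0 v0; rewrite mulr_ge0 ?invr_ge0 ?addr_ge0 ?sqr_ge0//.
    by rewrite divr_ge0// divr_ge0 ?powR_ge0// ltW.
  - move=> v /inD0 v0; apply: (der_comp (f := atan) _ (der_qroot v v0)).
    exact: is_derive1_atan.
  - move=> v /inD0 v0; apply: cvgM.
      apply: cvgV => //; apply: cvgD; first exact: cvg_cst.
      apply: (@continuous_comp _ _ _ qroot (fun x => x ^+ 2)); first exact: qc.
      exact: exprn_continuous.
    by apply: cvgM; [exact: qvc|exact: cvg_cst].
  - by move=> v _; rewrite ler_norml !ltW// ?atan_gtNpi2 ?atan_ltpi2.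
apply: (integrable_dom (fun v => 16 * f v)).
- exact: measurable_D0.
- apply: measurable_halfline => v v0; apply: cvgM; first exact: qvc.
  apply: (@continuous_comp _ _ _ (fun v => - (v / 2)) expR); last exact: continuous_expR.
  by apply: cvgN; apply: cvgM; [exact: cvg_id|exact: cvg_cst].
- move=> v /inD0 v0; rewrite ger0_norm ?weight_ge0//.
  have -> : 16 * f v = qroot v / v * (4 / (1 + qroot v ^+ 2)) by rewrite /f; field; rewrite !(q1, lt0r_neq0 v0).
  rewrite ler_wpM2l ?divr_ge0 ?powR_ge0 ?(ltW v0)// ler_pdivlMr ?ltr_pwDl ?sqr_ge0//.
  have q2 : qroot v ^+ 2 <= 1 + v.
    have := qroot4 v (ltW v0); set p := qroot v; rewrite (_ : p ^+ 4 = (p ^+ 2) ^+ 2); last by ring.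
    by have := sqr_ge0 (p ^+ 2 - 1); nra.
  have v2 : 0 <= v / 2 by rewrite divr_ge0// ltW.
  have e1 : expR (- (v / 2)) <= 1 by rewrite -[leRHS]expR0 ler_expR oppr_le0.
  have e2 := powM_expN_le 0 _ v2; rewrite expr1 in e2.
  apply: (@le_trans _ _ (expR (- (v / 2)) * (2 + v))).
    by rewrite ler_wpM2l ?expR_ge0//; lra.
  by move: e2; rewrite (_ : 1`!%:R = 1 :> R)//; lra.
- by apply: intbleZ => //; exact: measurable_D0.
Qed.

End SingularWeight.

Section Eigenfunction.
Context {R : realType}.
Context {f f1 h h1 : R -> R} {b N bh Nh C : R}.
Hypothesis wf : wave f f1 b N.
Hypothesis wh : wave h h1 bh Nh.
Hypothesis hC : forall v, 0 < v -> `|h v| <= C * qroot v.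
Hypothesis h1C : forall v, 0 < v -> `|v * h1 v| <= C * qroot v.
Implicit Types (u v x : R).

Notation Phi := (@Phi R f).
Notation Phi1 := (@Phi1 R f f1).
Notation Phi2 := (@Phi2 R f b).

Lemma wave_over_le v : 0 < v -> `|h v / v| <= C * (qroot v / v).
Proof.
move=> v0; rewrite normrM [`|v^-1|]gtr0_norm ?invr_gt0// mulrA.
by rewrite ler_wpM2r ?invr_ge0 ?(ltW v0)// hC.
Qed.

Lemma wave_over_cont v : 0 < v -> {for v, continuous (fun v => h v / v)}.
Proof.
move=> v0; apply: cvgM; first exact: der_cont (wave_der _ _ _ _ wh v v0).
by apply: cvgV; [exact: lt0r_neq0|exact: cvg_id].
Qed.

Lemma eigen_dom {F : R -> R} {K : R} v : 0 <= K -> 0 < v ->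
  `|F v| <= K * expR (- (v / 2)) -> `|F v * (h v / v)| <= K * C * end_weight v.
Proof.
move=> K0 v0 FK; rewrite normrM.
have -> : K * C * end_weight v = K * expR (- (v / 2)) * (C * (qroot v / v)) by rewrite /end_weight; ring.
by apply: ler_pM => //; exact: wave_over_le.
Qed.

Lemma eigen_int {F : R -> R} {K : R} : 0 <= K ->
  (forall v, 0 < v -> {for v, continuous F}) ->
  (forall v, 0 < v -> `|F v| <= K * expR (- (v / 2))) ->
  intble D0 (fun v => F v * (h v / v)).
Proof.
move=> K0 cF FK; apply: (integrable_dom (fun v => K * C * end_weight v)).
- exact: measurable_D0.
- apply: measurable_halfline => v v0; apply: cvgM; first exact: cF.
  exact: wave_over_cont.
- by move=> v /inD0 v0; apply: eigen_dom => //; exact: FK.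
- by apply: intbleZ; [exact: measurable_D0|exact: integrable_weight].
Qed.

Lemma Phi_int u : 0 < u ->
  [/\ intble D0 (fun v => Phi u v * (h v / v)),
      intble D0 (fun v => Phi1 u v * (h v / v)) &
      intble D0 (fun v => Phi2 u v * (h v / v))].
Proof.
move=> u0; have [K [K0 HK]] := Phi_le wf u u0.
split; apply: (eigen_int (K := K)) => // v v0;
  first [by have [] := Phi_cont2 wf u v u0 v0|by have [] := HK u v (lexx _) v0].
Qed.

(** The integral operator with kernel Phi on the function h v / v, and its formal
    derivatives. *)
Definition eig u := \int_ D0 (fun v => Phi u v * (h v / v)).
Definition eig1 u := \int_ D0 (fun v => Phi1 u v * (h v / v)).
Definition eig2 u := \int_ D0 (fun v => Phi2 u v * (h v / v)).

Lemma der_eig_gen {F F1 : R -> R -> R} u : 0 < u ->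
  (forall x, 0 < x -> intble D0 (fun v => F x v * (h v / v))) ->
  (forall x v, 0 < x -> 0 < v -> has_der (F^~ v) x (F1 x v)) ->
  (exists K, 0 <= K /\ forall x v, u / 2 <= x -> 0 < v -> `|F1 x v| <= K * expR (- (v / 2))) ->
  has_der (fun u => \int_ D0 (fun v => F u v * (h v / v))) u
    (\int_ D0 (fun v => F1 u v * (h v / v))).
Proof.
move=> u0 Fi dF [K [K0 HK]].
have uu : u / 2 < u < u + 1 by apply/andP; split; lra.
have pos x : u / 2 < x < u + 1 -> 0 < x by move=> /andP[? _]; lra.
apply: (der_under_integral (u / 2) (u + 1)
  (f := fun x v => F x v * (h v / v)) (df := fun x v => F1 x v * (h v / v))
  (G := fun v => K * C * end_weight v) measurable_D0 uu).
- by move=> x /pos; exact: Fi.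
- move=> x v /pos x0 /inD0 v0; apply: has_der_eq.
    exact: (derM (dF x v x0 v0) (derC (h v / v) x)).
  by rewrite /= mulr0 addr0.
- move=> x v /andP[ux _] /inD0 v0; apply: (eigen_dom (F := F1 x)) => //.
  by apply: HK => //; exact: ltW.
- by apply: intbleZ; [exact: measurable_D0|exact: integrable_weight].
Qed.

Lemma der_eig u : 0 < u -> has_der eig u (eig1 u).
Proof.
move=> u0; apply: der_eig_gen => //.
- by move=> x /Phi_int[].
- by move=> x v x0 v0; exact: der_Phi wf _ _ x0 v0.
- have u2 : 0 < u / 2 by rewrite divr_gt0.
  have [K [K0 HK]] := Phi_le wf (u / 2) u2.
  by exists K; split=> // x v xu v0; have [] := HK x v xu v0.
Qed.

Lemma der_eig1 u : 0 < u -> has_der eig1 u (eig2 u).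
Proof.
move=> u0; apply: der_eig_gen => //.
- by move=> x /Phi_int[].
- by move=> x v x0 v0; exact: der_Phi1 wf _ _ x0 v0.
- have u2 : 0 < u / 2 by rewrite divr_gt0.
  have [K [K0 HK]] := Phi_le wf (u / 2) u2.
  by exists K; split=> // x v xu v0; have [] := HK x v xu v0.
Qed.

(** v Phi1 v u stays bounded as v tends to 0 because x f1 x does. *)
Lemma Phi1_small u : 0 < u -> exists K, forall v, 0 < v -> `|v * Phi1 v u| <= K.
Proof.
move=> u0; pose chi x := x * f1 x.
have chi2 x : 0 < x -> `|chi x| <= halfC * (1 + x / 2) * expR (- (x / 2)).
  move=> x0; rewrite normrM gtr0_norm//.
  apply: le_trans (ler_wpM2l (ltW x0) (wave_le1 _ _ _ _ wf x x0)) _.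
  by rewrite le_eqVlt; apply/orP; left; apply/eqP; rewrite /decay; field; exact: lt0r_neq0.
have chi4 x : 0 < x -> `|chi x| <= halfC * 3 * expR (- (x / 4)).
  move=> x0; apply: le_trans (chi2 x x0) _.
  rewrite -[leLHS]mulrA -[leRHS]mulrA ler_wpM2l ?(ltW halfC_gt0)//.
  have x4 : 0 <= x / 4 by rewrite divr_ge0// ltW.
  have e2 := powM_expN_le 0 _ x4; rewrite expr1 (_ : 1`!%:R = 1 :> R)// in e2.
  have -> : expR (- (x / 2)) = expR (- (x / 4)) * expR (- (x / 4)).
    by rewrite -expRD; congr expR; field.
  rewrite mulrA ler_wpM2r ?expR_ge0//.
  have e1 : expR (- (x / 4)) <= 1 by rewrite -[leRHS]expR0 ler_expR oppr_le0.
  by rewrite mulrDl mul1r; lra.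
have rchi : rapid chi (fun=> halfC * 3).
  split=> [x x0|e x e0 ex]; last by apply: chi4; exact: lt_le_trans ex.
  apply: cvgM; first exact: cvg_id.
  exact: der_cont (wave_der1 _ _ _ _ wf x x0).
exists (halfC * powK u * cauchyD1 * (halfC * 3)) => v v0.
have -> : v * Phi1 v u = pairI 0 f chi u v.
  rewrite /Phi1 /pairI -Rint_scale; last 2 first.
  - exact: measurable_D1.
  - exact: (pair_int v u (rapid_wave1 wf) (rapid_wave wf)).
  by apply: eq_Rintegral => t _; rewrite /chi; ring.
apply: (pair_le u u v _ (rapid_wave wf) rchi) => // t t1.
have vt : 0 < v * t by rewrite mulr_gt0// (lt_trans _ t1).
have c0 : 0 <= halfC * 3 :> R by apply: mulr_ge0 => //; exact: ltW halfC_gt0.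
apply: le_trans (chi4 _ vt) _; rewrite ler_piMr//.
by rewrite -[leRHS]expR0 ler_expR oppr_le0 divr_ge0// ltW.
Qed.

(** The boundary terms of the integration by parts in v. *)
Lemma eigen_boundary u : 0 < u ->
  let B v := - (v * Phi1 v u) * h v + Phi v u * (v * h1 v - h v) in
  B v @[v --> 0^'+] --> 0 /\ B v @[v --> +oo] --> 0.
Proof.
move=> u0 B.
have [K1 HK1] := Phi1_small u u0; have [K [K0 HK]] := Phi_le wf u u0.
have K10 : 0 <= K1 by exact: le_trans (normr_ge0 _) (HK1 1 ltr01).
have Phb v : 0 < v -> `|Phi v u| <= K.
  move=> v0; rewrite Phi_sym; have [P _ _] := HK u v (lexx _) v0.
  apply: le_trans P _; rewrite ler_piMr// -[leRHS]expR0 ler_expR oppr_le0 divr_ge0//.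
  exact: ltW.
have Bb v : 0 < v -> `|B v| <= K1 * `|h v| + K * (`|v * h1 v| + `|h v|).
  move=> v0; apply: le_trans (ler_normD _ _) _; apply: lerD.
    by rewrite normrM normrN ler_wpM2r// HK1.
  by rewrite normrM; apply: ler_pM => //; [exact: Phb|exact: ler_normB].
split; last first.
  apply: (vanish_le_inv ((K1 + 3 * K) * (halfC * 8))) => v v1.
  have v0 : 0 < v by exact: lt_trans v1.
  have v2 : 0 <= v / 2 by rewrite divr_ge0// ltW.
  have e2 := powM_expN_le 1 _ v2; rewrite (_ : 2`!%:R = 2 :> R)// in e2.
  have d0 := decay_gt0 v.
  have D : v * decay v <= halfC * 8 / v.
    rewrite ler_pdivlMr// /decay.
    have -> : v * (halfC * expR (- (v / 2))) * v = halfC * (4 * ((v / 2) ^+ 2 * expR (- (v / 2)))) by field.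
    by rewrite ler_wpM2l ?(ltW halfC_gt0)//; lra.
  have dv : decay v <= v * decay v by rewrite ler_peMl// ltW.
  have hv := wave_le _ _ _ _ wh v v0; have h1v := wave_le1 _ _ _ _ wh v v0.
  have vh1 : `|v * h1 v| <= 2 * (v * decay v).
    rewrite normrM gtr0_norm//; apply: le_trans (ler_wpM2l (ltW v0) h1v) _.
    have -> : v * ((2^-1 + v^-1) * decay v) = 2^-1 * (v * decay v) + decay v.
      by field; exact: lt0r_neq0.
    by have := ltW d0; nra.
  apply: le_trans (Bb v v0) _; rewrite -[leRHS]mulrA.
  have X1 : K1 * `|h v| <= K1 * (halfC * 8 / v) by rewrite ler_wpM2l//; lra.
  have X2 : K * (`|v * h1 v| + `|h v|) <= K * (3 * (halfC * 8 / v)).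
    by rewrite ler_wpM2l//; lra.
  by lra.
have q0 : (K1 + 2 * K) * C * qroot v @[v --> 0^'+] --> (0 : R).
  rewrite -[X in _ --> X](mulr0 ((K1 + 2 * K) * C)); apply: cvgMr.
  by apply: powR_cvg0; rewrite invr_gt0.
apply: norm_cvg0; apply: (squeeze_cvgr _ _ q0); last exact: (cvg_cst 0).
near=> v; rewrite normr_ge0/=.
have v0 : 0 < v by near: v; exact: nbhs_right_gt.
apply: le_trans (Bb v v0) _; have a1 := hC v v0; have a2 := h1C v v0.
have X1 : K1 * `|h v| <= K1 * (C * qroot v) by rewrite ler_wpM2l.
have X2 : K * (`|v * h1 v| + `|h v|) <= K * (2 * (C * qroot v)).
  by rewrite ler_wpM2l//; lra.
by lra.
Unshelve. all: by end_near. Qed.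

(** The operator in u is moved to v by commutation and then onto h v / v by
    integration by parts: with B as below, B' is the integrand of the difference
    of the two sides. *)
Lemma eig_ode u : 0 < u ->
  - (u ^+ 2 * eig2 u + 2 * u * eig1 u) + u ^+ 2 / 4 * eig u = - bh * eig u.
Proof.
move=> u0; have [i0 i1 i2] := Phi_int u u0.
have mD0 := @measurable_D0 R.
pose B v := - (v * Phi1 v u) * h v + Phi v u * (v * h1 v - h v).
pose L v := (- (u ^+ 2 * Phi2 u v + 2 * u * Phi1 u v) + u ^+ 2 / 4 * Phi u v + bh * Phi u v) *
  (h v / v).
have dB v : 0 < v -> has_der B v (L v).
  move=> v0.
  have dvP : has_der (fun v => - (v * Phi1 v u)) v (- (1 * Phi1 v u + v * Phi2 v u)).
    exact: derN (derM (derX v) (der_Phi1 wf v u v0 u0)).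
  have dh := wave_der _ _ _ _ wh v v0; have dh1 := wave_der1 _ _ _ _ wh v v0.
  apply: has_der_eq.
    exact: (derD (derM dvP dh) (derM (der_Phi wf v u v0 u0)
      (derD (derM (derX v) dh1) (derN dh)))).
  rewrite /L (Phi_commute wf u v u0 v0) (Phi_sym u v) /=; field; exact: lt0r_neq0.
pose L' v := (- (u ^+ 2) * (Phi2 u v * (h v / v)) +
    (- (2 * u)) * (Phi1 u v * (h v / v))) + (u ^+ 2 / 4 + bh) * (Phi u v * (h v / v)).
have LE : L = L' by apply/funext => v; rewrite /L /L'; ring.
have j2 := intbleZ (- (u ^+ 2)) mD0 i2; have j1 := intbleZ (- (2 * u)) mD0 i1.
have j0 := intbleZ (u ^+ 2 / 4 + bh) mD0 i0; have j21 := intbleD mD0 j2 j1.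
have Li : intble D0 L.
  by rewrite LE; exact: (intbleD mD0 j21 j0).
have cL v : 0 < v -> {for v, continuous L}.
  move=> v0; have [c0 c1 c2] := Phi_cont2 wf u v u0 v0.
  apply: cvgM; last exact: wave_over_cont.
  have cZ (k : R) (g : R -> R) : {for v, continuous g} -> {for v, continuous (fun v => k * g v)}.
    by move=> cg; apply: cvgM; [exact: cvg_cst|exact: cg].
  apply: cvgD; last exact: cZ.
  apply: cvgD; last exact: cZ.
  by apply: cvgN; apply: cvgD; exact: cZ.
have [B0 Boo] := eigen_boundary u u0.
have := FTC_halfline 0 0 0 Li dB cL B0 Boo; rewrite subrr.
rewrite LE /L' (Rint_add mD0 j21 j0) (Rint_add mD0 j2 j1).
rewrite (Rint_scale _ mD0 i2) (Rint_scale _ mD0 i1) (Rint_scale _ mD0 i0).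
by rewrite -/(eig u) -/(eig1 u) -/(eig2 u); lra.
Qed.

Lemma decay_ratio_cvg {g : R -> R} (k K : R) :
  (forall u, 0 < u -> `|g u - k * decay u| <= K * decay u / u) ->
  g u / decay u @[u --> +oo] --> k.
Proof.
move=> gk; have : g u / decay u - k @[u --> +oo] --> 0.
  apply: (vanish_le_inv K) => u u1; have u0 : 0 < u by exact: lt_trans u1.
  have d0 := decay_gt0 u; have dn : decay u != 0 by rewrite gt_eqF.
  have -> : g u / decay u - k = (g u - k * decay u) / decay u by rewrite mulrBl mulfK.
  rewrite normrM [`|_^-1|]gtr0_norm ?invr_gt0// ler_pdivrMr//.
  by rewrite mulrAC; exact: gk.
by move=> c; rewrite -[X in _ --> X]add0r; under eq_fun do rewrite -(subrK k (g _ / _));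
  apply: cvgD => //; exact: cvg_cst.
Qed.

Lemma der_decay u x : has_der (fun x => decay (u * x)) x (- (u / 2) * decay (u * x)).
Proof.
apply: has_der_eq.
  exact: (derM (derC halfC x) (der_exp (derN (derM (derM (derC u x) (derX x)) (derC 2^-1 x))))).
by rewrite /decay /=; ring.
Qed.

Lemma integral_decay u : 0 < u ->
  intble D1 (fun t => decay (u * t)) /\
  \int_ D1 (fun t => decay (u * t)) = 2 / u * decay u.
Proof.
move=> u0; have d2 : 0 < 2 / u by rewrite divr_gt0.
pose F t := - (2 / u) * decay (u * t).
have dF t : has_der F t (decay (u * t)).
  apply: has_der_eq; first exact: (derM (derC (- (2 / u)) t) (der_decay u t)).
  by rewrite /=; field; exact: lt0r_neq0.
have cd t : {for t, continuous (fun t => decay (u * t))} by exact: der_cont (der_decay u t).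
have di : intble D1 (fun t => decay (u * t)).
  apply: (integrable_bounded_primitive (exhausts_oy 1) (F := F) (2 / u * halfC)) => //.
    by move=> t _; exact: ltW (decay_gt0 _).
  move=> t /inD1 t1; rewrite /F normrM normrN (gtr0_norm d2) (gtr0_norm (decay_gt0 _)).
  rewrite ler_wpM2l ?(ltW d2)// /decay ler_piMr ?(ltW halfC_gt0)//.
  by rewrite -[leRHS]expR0 ler_expR oppr_le0 divr_ge0// mulr_ge0// ltW// (lt_trans _ t1).
split=> //.
have -> : 2 / u * decay u = 0 - F 1 by rewrite /F mulr1; ring.
apply: (FTC_halfline 1 (F 1) 0 di (F := F)) => //.
  by apply: cvg_at_right_filter; exact: der_cont (dF 1).
apply: (vanish_le_inv (2 / u * (halfC * (2 / u)))) => t t1.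
have t0 : 0 < t by exact: lt_trans t1.
rewrite /F normrM normrN (gtr0_norm d2) (gtr0_norm (decay_gt0 _)).
rewrite -[leRHS]mulrA ler_wpM2l ?(ltW d2)// /decay.
rewrite -[leRHS]mulrA ler_wpM2l ?(ltW halfC_gt0)//.
have x0 : 0 <= u * t / 2 by rewrite divr_ge0// mulr_ge0// ltW.
have e := powM_expN_le 0 _ x0; rewrite expr1 (_ : 1`!%:R = 1 :> R)// in e.
rewrite ler_pdivlMr//.
have -> : expR (- (u * t / 2)) * t = 2 / u * (u * t / 2 * expR (- (u * t / 2))).
  by field; exact: lt0r_neq0.
by rewrite ler_piMr// divr_ge0// ltW.
Qed.

(** The decay in u is what bounds u Phi u v / h u uniformly in u, as dominated
    convergence requires in eig_eq. *)
Lemma Phi_decay u v : 0 < u -> 0 < v -> `|Phi u v| <= decay v * (2 / u * decay u).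
Proof.
move=> u0 v0; have [di <-] := integral_decay u u0.
have mD1 := @measurable_D1 R.
rewrite -Rint_scale//; apply: norm_Rintegral_le => //.
- exact: (pair_int u v (rapid_wave wf) (rapid_wave wf)).
- exact: intbleZ.
move=> t /inD1 t1; have t0 : 0 < t by exact: lt_trans t1.
rewrite expr0 mul1r normrM mulrC; apply: ler_pM => //.
  apply: le_trans (wave_le _ _ _ _ wf _ (mulr_gt0 v0 t0)) _; apply: decay_anti.
  by rewrite ler_peMr// ltW.
exact: (wave_le _ _ _ _ wf _ (mulr_gt0 u0 t0)).
Qed.

(** Past this point h is at least half of its leading term. *)
Definition waveU : R := 2 * `|Nh| + 1.

Lemma wave_ge u : waveU <= u -> decay u / 2 <= h u.
Proof.
move=> Uu; have N0 := normr_ge0 Nh.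
have u0 : 0 < u by apply: lt_le_trans Uu; rewrite /waveU; lra.
have d0 := decay_gt0 u.
have : Nh * decay u / u <= decay u / 2.
  rewrite ler_pdivrMr//; have Nu : Nh <= u / 2.
    by apply: le_trans (ler_norm _) _; have := Uu; rewrite /waveU; lra.
  by have := ler_wpM2r (ltW d0) Nu; lra.
have := wave_asymp _ _ _ _ wh u u0; rewrite ler_norml => /andP[]; lra.
Qed.

Lemma wave_gt0 u : waveU <= u -> 0 < h u.
Proof. by move=> /wave_ge; apply: lt_le_trans; rewrite divr_gt0// decay_gt0. Qed.

(** A wave spans the solutions that do not grow at infinity. *)
Lemma wave_unique {y y1 : R -> R} {s : nat -> R} {c : R} :
  (forall u, 0 < u -> has_der y u (y1 u)) ->
  (forall u, 0 < u -> has_der y1 u ((4^-1 + bh / u ^+ 2) * y u)) ->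
  s n @[n --> \oo] --> +oo -> y (s n) / h (s n) @[n --> \oo] --> c ->
  forall u, 0 < u -> y u = c * h u.
Proof.
move=> dy dy1 soo yhc.
have U0 : 0 < waveU by rewrite /waveU; have := normr_ge0 Nh; lra.
apply: (recessive_unique (y1 := y1) (Y1 := h1) (q := fun u => 4^-1 + bh / u ^+ 2)
  (s := s) (B := halfC) (U := waveU)) => //.
- by move=> x x0; exact: (wave_der _ _ _ _ wh).
- by move=> x x0; exact: (wave_der1 _ _ _ _ wh).
- move=> a a0; exists (4^-1 + `|bh| / a ^+ 2) => x ax.
  apply: le_trans (ler_normD _ _) _; rewrite [`|4^-1|]ger0_norm// lerD2l.
  rewrite normrM ler_wpM2l// ger0_norm ?invr_ge0 ?sqr_ge0//.
  have x0 : 0 < x by exact: lt_le_trans ax.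
  by rewrite lef_pV2 ?posrE ?exprn_gt0// lerXn2r// nnegrE ltW.
- move=> x Ux; have x0 : 0 < x by exact: lt_le_trans Ux.
  rewrite wave_gt0//=; apply: le_trans (ler_norm _) _.
  apply: le_trans (wave_le _ _ _ _ wh x x0) _; rewrite ler_piMr ?(ltW halfC_gt0)//.
  by rewrite -[leRHS]expR0 ler_expR oppr_le0 divr_ge0// ltW.
Qed.

(** In Phi_wron divided by u h u / 4, the term with f u is of order 1 / u, and
    the one with f1 u, asymptotic to - decay u / 2, gives the limit. *)
Lemma Phi_ratio_cvg v : 0 < v -> u * Phi u v / h u @[u --> +oo] --> 2 * f v.
Proof.
move=> v0.
have fd : f u / decay u @[u --> +oo] --> (1 : R).
  by apply: (decay_ratio_cvg 1 N) => u u0; rewrite mul1r; exact: (wave_asymp _ _ _ _ wf).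
have f1d : f1 u / decay u @[u --> +oo] --> (- 2^-1 : R).
  apply: (decay_ratio_cvg (- 2^-1) N) => u u0.
  by rewrite mulNr opprK mulrC; exact: (wave_asymp1 _ _ _ _ wf).
have hd : h u / decay u @[u --> +oo] --> (1 : R).
  by apply: (decay_ratio_cvg 1 Nh) => u u0; rewrite mul1r; exact: (wave_asymp _ _ _ _ wh).
have vu : v / u @[u --> +oo] --> (0 : R).
  rewrite -[X in _ --> X](mulr0 v); apply: cvgMr.
  apply/gtr0_cvgV0; first by near=> t; near: t; exact: nbhs_pinfty_gt.
  exact: cvg_id.
have bu : (1 - (v / u) * (v / u))^-1 @[u --> +oo] --> (1 : R).
  rewrite -[X in _ --> X]invr1; apply: cvgV; first exact: oner_neq0.
  rewrite -[X in _ --> X]subr0 -(mulr0 0); apply: cvgB; first exact: cvg_cst.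
  exact: cvgM.
(* the right-hand side of Phi_wron, rearranged into factors with a limit *)
have E : 4 * ((1 - (v / u) * (v / u))^-1 * (v / u) * f1 v * (f u / decay u) -
    (1 - (v / u) * (v / u))^-1 * f v * (f1 u / decay u)) / (h u / decay u)
    @[u --> +oo] --> 4 * (1 * 0 * f1 v * 1 - 1 * f v * - 2^-1) / 1.
  apply: cvgM; last by apply: cvgV; [exact: oner_neq0|exact: hd].
  apply: cvgMr; apply: cvgB.
    by apply: cvgM => //; apply: cvgMl; exact: cvgM.
  by apply: cvgM => //; exact: cvgMl.
rewrite [X in _ --> X](_ : _ = 4 * (1 * 0 * f1 v * 1 - 1 * f v * - 2^-1) / 1); last by field.
apply: cvg_trans E; apply: near_eq_cvg; near=> u.
have vu' : v < u by near: u; apply: nbhs_pinfty_gt; exact: num_real.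
have u0 : 0 < u by exact: lt_trans vu'.
have h0 : 0 < h u.
  apply: lt_le_trans (wave_ge u _); first by rewrite divr_gt0// decay_gt0.
  by near: u; apply: nbhs_pinfty_ge; exact: num_real.
have dn : decay u != 0 by rewrite gt_eqF// decay_gt0.
have hn : h u != 0 by rewrite gt_eqF.
have un : u != 0 by rewrite gt_eqF.
have D : u ^+ 2 - v ^+ 2 != 0.
  rewrite gt_eqF// (_ : u ^+ 2 - v ^+ 2 = (u - v) * (u + v)); last by ring.
  by rewrite mulr_gt0 ?subr_gt0// addr_gt0.
have P : Phi u v = 4 * (v * (f u * f1 v) - u * (f1 u * f v)) / (u ^+ 2 - v ^+ 2).
  by rewrite -(Phi_wron wf u v u0 v0); field.
rewrite P.
have -> : 1 - v / u * (v / u) = (u ^+ 2 - v ^+ 2) / u ^+ 2 by field.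
by field; rewrite ?un ?hn ?dn ?D.
Unshelve. all: by end_near. Qed.

(** The commuting differential operator forces the integral operator to act on
    h u / u by a scalar; letting u tend to infinity evaluates it. *)
Lemma eig_eq u : 0 < u ->
  eig u = 2 * \int_ D0 (fun v => f v * (h v / v)) * (h u / u).
Proof.
move=> u0; set c := 2 * _.
have mD0 := @measurable_D0 R.
(* u times an eigenfunction solves the equation of h *)
pose y u := u * eig u; pose y1 u := eig u + u * eig1 u.
pose s (n : nat) : R := waveU + n.+1%:R.
have U0 : 0 < waveU by rewrite /waveU; have := normr_ge0 Nh; lra.
have sU n : waveU <= s n by rewrite lerDl.
have s0 n : 0 < s n by exact: lt_le_trans (sU n).
have soo : s n @[n --> \oo] --> +oo.
  by apply: (cvg_comp (fun n => n.+1%:R) (fun x => waveU + x)); [exact: cvgr_idSn|exact: cvg_addrl].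
have fi : intble D0 (fun v => f v * (h v / v)).
  apply: (eigen_int (K := halfC)); first exact: ltW halfC_gt0.
    by move=> v v0; exact: der_cont (wave_der _ _ _ _ wf v v0).
  by move=> v v0; exact: (wave_le _ _ _ _ wf v v0).
have lim : y (s n) / h (s n) @[n --> \oo] --> c.
  pose G n v := s n * Phi (s n) v / h (s n) * (h v / v).
  have cG n v : 0 < v -> {for v, continuous (fun v => s n * Phi (s n) v / h (s n))}.
    move=> v0; apply: cvgM; last exact: cvg_cst.
    by apply: cvgM; [exact: cvg_cst|have [] := Phi_cont2 wf (s n) v (s0 n) v0].
  have Gb n v : 0 < v -> `|s n * Phi (s n) v / h (s n)| <= 4 * halfC * expR (- (v / 2)).
    move=> v0; have hn := wave_gt0 _ (sU n); have sn0 := s0 n.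
    rewrite normrM [`|_^-1|]gtr0_norm ?invr_gt0// ler_pdivrMr//.
    rewrite normrM gtr0_norm//.
    apply: le_trans (ler_wpM2l (ltW sn0) (Phi_decay _ _ sn0 v0)) _.
    have -> : s n * (decay v * (2 / s n * decay (s n))) = 4 * decay v * (decay (s n) / 2).
      by field; exact: lt0r_neq0.
    rewrite /decay -/(decay (s n)) -[4 * halfC * _]mulrA ler_wpM2l//; last exact: wave_ge.
    by rewrite mulr_ge0//; exact: ltW (decay_gt0 _).
  have mG n : measurable_fun (D0 : set R) (G n).
    apply: measurable_halfline => v v0; apply: cvgM; first exact: cG.
    exact: wave_over_cont.
  have K0 : 0 <= 4 * halfC :> R by rewrite mulr_ge0// ltW// halfC_gt0.
  have cvG v : D0 v -> G n v @[n --> \oo] --> 2 * (f v * (h v / v)).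
    move=> /inD0 v0; rewrite mulrA; apply: cvgM; last exact: cvg_cst.
    exact: (cvg_comp _ _ soo (Phi_ratio_cvg v v0)).
  have dG n v : D0 v -> `|G n v| <= 4 * halfC * C * end_weight v.
    by move=> /inD0 v0; apply: (eigen_dom (F := fun v => s n * Phi (s n) v / h (s n))) => //; exact: Gb.
  have iw : intble D0 (fun v => 4 * halfC * C * end_weight v).
    by apply: intbleZ => //; exact: integrable_weight.
  have [_] := dominated_cvg_Rintegral D0 G _ _ mD0 mG cvG dG iw.
  rewrite (Rint_scale _ mD0 fi) -/c; apply: cvg_trans; apply: near_eq_cvg.
  apply: nearW => n; rewrite /y /eig mulrAC.
  have [i0 _ _] := Phi_int (s n) (s0 n).
  rewrite -(Rint_scale (s n / h (s n)) mD0 i0).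
  by apply: eq_Rintegral => v _; rewrite /G; ring.
have : y u = c * h u.
  apply: (wave_unique (y1 := y1) (s := s)) => //.
  - move=> x x0; apply: has_der_eq; first exact: (derM (derX x) (der_eig x x0)).
    by rewrite /y1 /= mul1r.
  - move=> x x0; apply: has_der_eq.
      exact: (derD (der_eig x x0) (derM (derX x) (der_eig1 x x0))).
    have xn : x != 0 by rewrite gt_eqF.
    have O := eig_ode x x0.
    have -> : eig2 x = ((x ^+ 2 / 4 + bh) * eig x - 2 * x * eig1 x) / x ^+ 2.
      have : x ^+ 2 * eig2 x = (x ^+ 2 / 4 + bh) * eig x - 2 * x * eig1 x by lra.
      by move=> <-; field.
    by rewrite /y /=; field.
rewrite /y => E; apply: (mulfI (lt0r_neq0 u0)); rewrite E.
by field; exact: lt0r_neq0.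
Qed.

End Eigenfunction.

(** * Macdonald functions near the origin *)

Section SmallArgument.
Context {R : realType}.
Implicit Types (u v t y : R).

Lemma le_qroot a y : 0 <= a -> 0 <= y -> a ^+ 4 <= y -> a <= qroot y.
Proof.
move=> a0 y0 ay; rewrite -(@ler_pXn2r _ 4)// ?nnegrE ?powR_ge0//.
by rewrite qroot4.
Qed.

Lemma qroot_expN_le j y : (j <= 8)%N -> 0 < y -> qroot y ^+ j * expR (- y) <= 2.
Proof.
move=> j8 y0; rewrite /qroot -powR_mulrn ?powR_ge0// -powRrM.
apply: powRM_expN_le => //; rewrite mulr_ge0 ?invr_ge0 ?ler0n//=.
have : (j%:R : R) <= 8%:R by rewrite ler_nat.
by lra.
Qed.

(** Since cosh (t / 4) ^ 4 <= cosh t. *)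
Lemma qroot_kern_ge u t : 0 < u -> qroot u * cosh (t / 4) / 2 <= qroot (u / 2 * cosh t).
Proof.
move=> u0; have C0 := cosh_gt0 (t / 4); have q0 := qroot_gt0 u u0.
apply: le_qroot.
- by rewrite divr_ge0// mulr_ge0// ltW.
- by rewrite mulr_ge0 ?divr_ge0 ?(ltW u0)// ltW ?cosh_gt0.
have -> : (qroot u * cosh (t / 4) / 2) ^+ 4 = u / 16 * cosh (t / 4) ^+ 4.
  by rewrite -[in RHS](qroot4 u (ltW u0)); field.
have h1 := cosh_half_sqr t; have h2 := cosh_half_sqr (t / 2).
have -> : t / 4 = t / 2 / 2 by field.
have h3 : cosh (t / 2 / 2) ^+ 4 <= cosh t.
  apply: le_trans h1; by rewrite (exprM _ 2 2) lerXn2r// nnegrE ?exprn_ge0// ltW// cosh_gt0.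
have Ct := cosh_gt0 t.
apply: (@le_trans _ _ (u / 16 * cosh t)); first by rewrite ler_wpM2l// divr_ge0// ltW.
have : 0 <= u * cosh t by rewrite mulr_ge0// ltW.
by move=> h; rewrite mulrAC [leRHS]mulrAC; set x := u * cosh t in h *; lra.
Qed.

(** A negative power of u buys the same power of cosh t. *)
Lemma kern_power_le j u t : (j <= 8)%N -> 0 < u ->
  kern u t <= 2 ^+ j.+1 / (qroot u ^+ j * cosh (t / 4) ^+ j).
Proof.
move=> j8 u0; have C0 := cosh_gt0 (t / 4); have q0 := qroot_gt0 u u0.
have y0 : 0 < u / 2 * cosh t by rewrite mulr_gt0 ?cosh_gt0// divr_gt0.
have := qroot_expN_le j _ j8 y0; rewrite -/(kern u t) => h.
rewrite ler_pdivlMr; last by rewrite mulr_gt0// exprn_gt0.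
have g : (qroot u * cosh (t / 4) / 2) ^+ j <= qroot (u / 2 * cosh t) ^+ j.
  rewrite lerXn2r ?nnegrE ?powR_ge0//; last exact: qroot_kern_ge.
  by rewrite divr_ge0// mulr_ge0// ltW.
have -> : kern u t * (qroot u ^+ j * cosh (t / 4) ^+ j) =
   2 ^+ j * ((qroot u * cosh (t / 4) / 2) ^+ j * kern u t).
  by rewrite !exprMn exprVn; field; rewrite expf_neq0.
rewrite exprSr ler_wpM2l ?exprn_ge0//; apply: le_trans h.
by rewrite ler_wpM2r// ltW// kern_gt0.
Qed.

(** Three instances, each leaving one integrable factor 1 / cosh (t / 4) and the
    power of u that its use near u = 0 can afford. *)
Lemma kern_le1 u t : 0 < u -> kern u t <= 4 / qroot u / cosh (t / 4).
Proof.
move=> u0; apply: le_trans (kern_power_le 1 u t _ u0) _ => //.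
by rewrite !expr1 invfM mulrA (_ : 2 ^+ 2 = 4 :> R)//; ring.
Qed.

Lemma kern_half_le u t : 0 < u ->
  kern u t * cosh (t / 2) <= 32 * (qroot u / u) / cosh (t / 4).
Proof.
move=> u0; have C0 := cosh_gt0 (t / 4); have q0 := qroot_gt0 u u0.
have h := cosh_le_sqr (t / 2); rewrite (_ : t / 2 / 2 = t / 4) in h; last by field.
apply: (@le_trans _ _ (2 ^+ 4 / (qroot u ^+ 3 * cosh (t / 4) ^+ 3) * (2 * cosh (t / 4) ^+ 2))).
  apply: ler_pM => //; [exact: ltW (kern_gt0 _ _)|exact: ltW (cosh_gt0 _)|].
  exact: kern_power_le.
have -> : qroot u / u = (qroot u ^+ 3)^-1.
  have e := qroot4 u (ltW u0); rewrite -[X in _ / X = _]e; field; exact: lt0r_neq0.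
rewrite le_eqVlt; apply/orP; left; apply/eqP.
by field; rewrite !lt0r_neq0.
Qed.

Lemma kern_cosh_le1 u t : 0 < u -> cosh t * kern u t <= 8 / (u * qroot u) / cosh (t / 4).
Proof.
move=> u0; have C0 := cosh_gt0 (t / 4); have q0 := qroot_gt0 u u0.
have y0 : 0 < u / 2 * cosh t by rewrite mulr_gt0 ?cosh_gt0// divr_gt0.
have := qroot_expN_le 5 _ isT y0; rewrite -/(kern u t) => h.
have g := qroot_kern_ge u t u0.
have p0 := qroot_gt0 _ y0.
have k0 := kern_gt0 u t.
have h2 : (u / 2 * cosh t) * kern u t * qroot (u / 2 * cosh t) <= 2.
  by move: h; rewrite exprSr qroot4 ?(ltW y0)// mulrAC.
have h3 : (u / 2 * cosh t) * kern u t * (qroot u * cosh (t / 4) / 2) <= 2.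
  by apply: le_trans h2; rewrite ler_wpM2l// mulr_ge0// ltW.
have U0 : 0 < u * qroot u * cosh (t / 4) by apply: mulr_gt0 => //; exact: mulr_gt0.
rewrite -mulrA -invfM ler_pdivlMr//.
have -> : cosh t * kern u t * (u * qroot u * cosh (t / 4)) =
  4 * (u / 2 * cosh t * kern u t * (qroot u * cosh (t / 4) / 2)) by field.
by lra.
Qed.

Lemma sech4_cont : continuous (fun t : R => (cosh (t / 4))^-1).
Proof.
move=> t; apply: (@cvgV _ _ _ _ (fun t => cosh (t / 4))); first exact: cosh_neq0.
have := der_cosh (derM (derX t) (derC 4^-1 t)) => /der_cont; exact.
Qed.

Lemma integrable_sech4 : intble [set: R] (fun t : R => (cosh (t / 4))^-1).
Proof.
apply: (integrable_le_sech 1); first by apply: continuous_measurable_fun; exact: sech4_cont.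
by move=> t; rewrite mul1r ger0_norm// invr_ge0 ltW// cosh_gt0.
Qed.

Definition sech4_mass : R := \int_ [set: R] (fun t : R => (cosh (t / 4))^-1).

Lemma sech4_mass_ge0 : 0 <= sech4_mass.
Proof.
by apply: Rintegral_ge0 => t _; rewrite invr_ge0 ltW// cosh_gt0.
Qed.

Section BoundedMode.
Context {c c1 : R -> R} {k M : R}.
Hypothesis mc : mode c c1 k M.
Hypothesis c_le1 : forall t, `|c t| <= 1.

Lemma lap_sech_le {a : R -> R} {K : R} u : continuous a ->
  (forall t, `|kern u t * a t| <= K / cosh (t / 4)) ->
  `|lap a u| <= K * sech4_mass / 2.
Proof.
move=> ca aK; rewrite /lap normrM [`|2^-1|]ger0_norm// mulrC ler_wpM2r//.
rewrite -(Rint_scale K _ integrable_sech4)//; apply: norm_Rintegral_le => //.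
- apply: (integrable_le_sech K) => //; apply: continuous_measurable_fun.
  exact: kernM_cont.
- by apply: intbleZ => //; exact: integrable_sech4.
Qed.

Lemma mac_small u : 0 < u -> `|mac (c := c) u| <= 2 * sech4_mass / qroot u.
Proof.
move=> u0; have -> : 2 * sech4_mass / qroot u = 4 / qroot u * sech4_mass / 2.
  by field; rewrite lt0r_neq0 ?qroot_gt0.
apply: lap_sech_le; first exact: mode_cont mc.
move=> t; rewrite normrM (ger0_norm (ltW (kern_gt0 u t))).
by apply: le_trans (kern_le1 u t u0); rewrite ler_piMr// ltW// kern_gt0.
Qed.

Lemma mac1_small u : 0 < u -> `|mac1 (c := c) u| <= 2 * sech4_mass / (u * qroot u).
Proof.
move=> u0; rewrite /mac1 normrN normrM [`|2^-1|]ger0_norm//.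
have -> : 2 * sech4_mass / (u * qroot u) = 8 / (u * qroot u) * sech4_mass / 2 / 2.
  by field; rewrite !lt0r_neq0 ?qroot_gt0.
rewrite ler_wpM2r//; apply: lap_sech_le; first exact: coshc_cont mc.
move=> t; rewrite mulrA normrM (mulrC (kern u t)).
have C0 : 0 <= cosh t * kern u t by rewrite mulr_ge0 ?ltW ?cosh_gt0 ?kern_gt0.
by rewrite (ger0_norm C0); apply: le_trans (kern_cosh_le1 u t u0); rewrite ler_piMr.
Qed.

Lemma sqrt_qroot u : 0 < u -> Num.sqrt u = qroot u ^+ 2.
Proof.
move=> u0; rewrite -[in LHS](qroot4 u (ltW u0)) (exprM _ 2 2) sqrtr_sqr ger0_norm//.
exact: sqr_ge0.
Qed.

(** Together with phi1_small, this makes the boundary terms at 0 vanish when the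
    operator is moved across the integral, and h v / v integrable. *)
Lemma phi_small u : 0 < u -> `|phi (c := c) u| <= 3 * sech4_mass * qroot u.
Proof.
move=> u0; have q0 := qroot_gt0 u u0; rewrite /phi normrM ger0_norm ?sqrtr_ge0//.
have h := mac_small u u0.
apply: (@le_trans _ _ (Num.sqrt u * (2 * sech4_mass / qroot u))).
  by rewrite ler_wpM2l ?sqrtr_ge0.
have -> : Num.sqrt u * (2 * sech4_mass / qroot u) = 2 * sech4_mass * qroot u.
  by rewrite sqrt_qroot//; field; exact: lt0r_neq0.
by rewrite ler_wpM2r ?(ltW q0)//; have := sech4_mass_ge0; lra.
Qed.

Lemma phi1_small u : 0 < u -> `|u * phi1 (c := c) u| <= 3 * sech4_mass * qroot u.
Proof.
move=> u0; have q0 := qroot_gt0 u u0.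
have -> : u * phi1 (c := c) u = Num.sqrt u * (mac (c := c) u / 2 + u * mac1 (c := c) u).
  by rewrite /phi1 /phi; field; exact: lt0r_neq0.
rewrite normrM ger0_norm ?sqrtr_ge0//.
have h := mac_small u u0; have h1 := mac1_small u u0.
have -> : 3 * sech4_mass * qroot u = Num.sqrt u * (3 * sech4_mass / qroot u).
  by rewrite sqrt_qroot//; field; exact: lt0r_neq0.
rewrite ler_wpM2l ?sqrtr_ge0//; apply: le_trans (ler_normD _ _) _.
have h2 : `|u * mac1 (c := c) u| <= 2 * sech4_mass / qroot u.
  rewrite normrM (gtr0_norm u0).
  have -> : 2 * sech4_mass / qroot u = u * (2 * sech4_mass / (u * qroot u)).
    by field; rewrite !lt0r_neq0.
  by rewrite ler_wpM2l// ltW.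
rewrite normrM [`|2^-1|]ger0_norm//.
by move: h h2; rewrite -!mulrA; set s := sech4_mass / _; lra.
Qed.

End BoundedMode.
End SmallArgument.

(** * The integral of a product of Macdonald functions *)

Section DoubleIntegral.
Context {R : realType}.
Context {c c1 a a1 : R -> R} {k M l N : R}.
Hypothesis mc : mode c c1 k M.
Hypothesis ma : mode a a1 l N.
Hypothesis a_le1 : forall t, `|a t| <= 1.
Implicit Types (u v t s : R).

Local Notation T := (measurableTypeR R).

Lemma kern_cont1 t : continuous (fun v => kern v t).
Proof.
move=> v.
have := der_exp (derN (derM (derM (derX v) (derC 2^-1 v)) (derC (cosh t) v))).
by move/der_cont; exact.
Qed.

Lemma measurable_kern2 : measurable_fun [set: T * T] (fun z => kern z.1 z.2).
Proof.
have mC : measurable_fun [set: T] (@cosh R) by apply: continuous_measurable_fun; exact: cosh_cont.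
apply: (measurableT_comp (f := (expR : T -> T))); first exact: measurable_expR.
apply: measurableT_comp; first exact: oppr_measurable.
apply: measurable_funM.
  by apply: measurable_funM => //; exact: measurable_fst.
by apply: (measurableT_comp mC); exact: measurable_snd.
Qed.

Lemma measurable_kernM {f g : R -> R} : measurable_fun [set: T] f -> measurable_fun [set: T] g ->
  measurable_fun [set: T * T] (fun z => f z.1 * (kern z.1 z.2 * g z.2)).
Proof.
move=> mf mg; apply: measurable_funM.
  by apply: (measurableT_comp (f := (f : T -> T))) => //; exact: measurable_fst.
apply: measurable_funM; first exact: measurable_kern2.
by apply: (measurableT_comp (f := (g : T -> T))) => //; exact: measurable_snd.
Qed.

Lemma integral_exp_half (A : R) : 1 <= A ->
  intble D0 (fun v => expR (- (v / 2 * A))) /\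
  \int_ D0 (fun v => expR (- (v / 2 * A))) = 2 / A.
Proof.
move=> A1; have A0 : 0 < A := lt_le_trans ltr01 A1.
pose F v : R := - (2 / A) * expR (- (v / 2 * A)).
have dF v : has_der F v (expR (- (v / 2 * A))).
  apply: has_der_eq.
    exact: (derM (derC (- (2 / A)) v) (der_exp (derN (derM (derM (derX v) (derC 2^-1 v)) (derC A v))))).
  by rewrite /=; field; exact: lt0r_neq0.
have cf v : {for v, continuous (fun v => expR (- (v / 2 * A)))}.
  by apply: der_cont; exact: (der_exp (derN (derM (derM (derX v) (derC 2^-1 v)) (derC A v)))).
have F0 : F v @[v --> 0^'+] --> - (2 / A).
  have -> : - (2 / A) = F 0 by rewrite /F !mul0r oppr0 expR0 mulr1.
  by apply: cvg_within_filter; exact: (der_cont (dF 0)).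
have cy : v / 2 * A @[v --> +oo] --> +oo.
  have -> : (fun v => v / 2 * A) = (fun v => (A / 2) * v) by apply/funext => v; ring.
  by apply: gt0_cvgMry; [exact: divr_gt0|exact: cvg_id].
have Fy : F v @[v --> +oo] --> 0.
  rewrite -[X in _ --> X](mulr0 (- (2 / A))); apply: cvgMr.
  by have := @cvgr_expR R; exact: (@cvg_comp _ _ _ (fun v => v / 2 * A) (fun y => expR (- y)) _ _ _ cy).
have fi : intble D0 (fun v => expR (- (v / 2 * A))).
  apply: (integrable_bounded_primitive (exhausts_oy 0) (F := F) (2 / A)) => //.
  - move=> v /inD0 v0; rewrite normrM normrN.
    have A2 : 0 <= 2 / A by rewrite divr_ge0// ltW.
    rewrite (ger0_norm A2) (ger0_norm (expR_ge0 _)) ler_piMr// -[leRHS]expR0 ler_expR oppr_le0.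
    by rewrite mulr_ge0 ?divr_ge0 ?(ltW A0)// ltW.
by split => //; rewrite (FTC_halfline 0 (- (2 / A)) 0 (F := F))// ?sub0r ?opprK.
Qed.

(** The majorant of K_nu times that of the kernel is the integrable weight. *)
Lemma weight_half v : 0 < v -> half v * (4 / qroot v) = 4 * @halfC R * end_weight v.
Proof.
move=> v0; have q0 := qroot_gt0 v v0.
have := half_decay v v0; rewrite sqrt_qroot// /decay => h.
have -> : half v = halfC * expR (- (v / 2)) / qroot v ^+ 2.
  by rewrite -h; field; exact: lt0r_neq0.
have e := qroot4 v (ltW v0); rewrite /end_weight -[X in _ / X * expR _]e.
by field; exact: lt0r_neq0.
Qed.

Lemma kern_le_exp v t : 0 < v -> kern v t <= expR (- (v / 2)).
Proof.
by move=> v0; rewrite ler_expR lerN2 ler_peMr ?cosh_ge1// divr_ge0// ltW.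
Qed.

Lemma mac_kern_le v t : 0 < v ->
  `|mac (c := c) v * kern v t| <= 4 * @halfC R * end_weight v / cosh (t / 4).
Proof.
move=> v0; rewrite -weight_half// normrM -mulrA; apply: ler_pM => //; first exact: (mac_le mc).
by rewrite ger0_norm ?(ltW (kern_gt0 _ _))//; exact: kern_le1.
Qed.

Lemma mac_kern_int t : intble D0 (fun v => mac (c := c) v * kern v t).
Proof.
have mD0 := @measurable_D0 R.
apply: (integrable_dom (fun v => (4 * @halfC R / cosh (t / 4)) * end_weight v)) => //.
- apply: measurable_halfline => v v0; apply: cvgM; first exact: der_cont (der_mac mc v v0).
  exact: kern_cont1.
- by move=> v /inD0 v0; apply: le_trans (mac_kern_le v t v0) _; rewrite mulrAC.
- by apply: intbleZ => //; exact: integrable_weight.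
Qed.

Lemma mac_mac_int : intble D0 (fun v => mac (c := c) v * mac (c := a) v).
Proof.
have mD0 := @measurable_D0 R.
apply: (integrable_dom (fun v => (4 * @halfC R * sech4_mass) * end_weight v)) => //.
- apply: measurable_halfline => v v0.
  by apply: cvgM; [exact: der_cont (der_mac mc v v0)|exact: der_cont (der_mac ma v v0)].
- move=> v /inD0 v0.
  have -> : 4 * @halfC R * sech4_mass * end_weight v = half v * (4 * sech4_mass / qroot v).
    by rewrite mulrAC -weight_half//; ring.
  rewrite normrM; apply: ler_pM => //; first exact: (mac_le mc).
  apply: le_trans (mac_small ma a_le1 v v0) _; rewrite ler_wpM2r ?invr_ge0 ?powR_ge0//.
  by have := @sech4_mass_ge0 R; lra.
- by apply: intbleZ => //; exact: integrable_weight.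
Qed.

Lemma mode_cosh_int t : intble [set: R] (fun s => c s / (cosh t + cosh s)).
Proof. exact: over_cosh_sum_int (mode_cont mc) (mode_le _ _ _ _ mc). Qed.

Lemma kern_kern_le t s v : 0 < v ->
  `|kern v t * (kern v s * c s)| <= 32 * end_weight v / cosh (s / 4).
Proof.
move=> v0; rewrite normrM (ger0_norm (ltW (kern_gt0 _ _))).
have -> : 32 * end_weight v / cosh (s / 4) =
  expR (- (v / 2)) * (32 * (qroot v / v) / cosh (s / 4)) by rewrite /end_weight; ring.
apply: ler_pM => //; [exact: ltW (kern_gt0 _ _)|exact: kern_le_exp|].
apply: le_trans (kern_half_le v s v0); rewrite normrM (ger0_norm (ltW (kern_gt0 _ _))).
by rewrite ler_wpM2l ?(ltW (kern_gt0 _ _))// (mode_le _ _ _ _ mc).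
Qed.

Lemma kern_kern_integral t s :
  \int_ D0 (fun v => kern v t * (kern v s * c s)) = 2 * (c s / (cosh t + cosh s)).
Proof.
have A1 : 1 <= cosh t + cosh s by have := cosh_ge1 t; have := cosh_ge1 s; lra.
have [ei eI] := integral_exp_half _ A1.
have -> : (fun v => kern v t * (kern v s * c s)) =
          (fun v => c s * expR (- (v / 2 * (cosh t + cosh s)))).
  by apply/funext => v; rewrite /kern mulrDr opprD expRD; ring.
by rewrite (Rint_scale (c s) (@measurable_D0 R) ei) eI; ring.
Qed.

(** Fubini in the variables v, t, s, the v-integral being elementary. *)
Lemma mac_product_integral :
  \int_ D0 (fun v => mac (c := c) v * mac (c := a) v) =
  2^-1 * \int_ [set: R] (fun t => a t * \int_ [set: R] (fun s => c s / (cosh t + cosh s))).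
Proof.
have mD0 := @measurable_D0 R.
have cc := mode_cont mc; have ca := mode_cont ma.
have mcc : measurable_fun [set: T] c by exact: continuous_measurable_fun.
have mca : measurable_fun [set: T] a by exact: continuous_measurable_fun.
have mmac : measurable_fun [set: T] (mac (c := c) \_ D0).
  apply/(measurable_restrictT _ mD0); apply: measurable_halfline => v v0.
  exact: der_cont (der_mac mc v v0).
pose F v t := (mac (c := c) \_ D0) v * (kern v t * a t).
have FE v t : D0 v -> F v t = mac (c := c) v * (kern v t * a t).
  by move=> Dv; rewrite /F patchE ifT// inE.
have sw1 : \int_ D0 (fun v => \int_ [set: R] (F v)) =
           \int_ [set: R] (fun t => \int_ D0 (F^~ t)).
  apply: (Rintegral_swap_dom (A := fun v => 4 * @halfC R * end_weight v)
    (B := fun t => (cosh (t / 4))^-1)).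
  - exact: mD0.
  - exact: measurableT.
  - exact: measurable_kernM.
  - move=> v t Dv _; rewrite FE// mulrA normrM; apply: le_trans (mac_kern_le v t (inD0 v Dv)).
    by rewrite ler_piMr.
  - by apply: intbleZ => //; exact: integrable_weight.
  - exact: integrable_sech4.
  - by move=> v /inD0 v0; rewrite mulr_ge0 ?weight_ge0// mulr_ge0// ltW// halfC_gt0.
  - by move=> t _; rewrite invr_ge0 ltW// cosh_gt0.
have sw1L : \int_ D0 (fun v => \int_ [set: R] (F v)) =
    2 * \int_ D0 (fun v => mac (c := c) v * mac (c := a) v).
  rewrite -(Rint_scale 2 mD0 mac_mac_int); apply: eq_Rintegral => v; rewrite inE => Dv.
  rewrite (_ : F v = fun t => mac (c := c) v * (kern v t * a t)); last first.
    by apply/funext => t; rewrite FE.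
  rewrite Rint_scale//; first by rewrite {3}/mac /lap; field.
  by apply: (lap_integrable (M := 1)) => //; [move=> t; rewrite mul1r; exact: (mode_le_cosh ma 2)|exact: inD0].
have -> : \int_ D0 (fun v => mac (c := c) v * mac (c := a) v) =
    2^-1 * \int_ D0 (fun v => \int_ [set: R] (F v)) by rewrite sw1L; field.
rewrite sw1; congr (_ * _); apply: eq_Rintegral => t _.
pose G v s := kern v t * (kern v s * c s).
have iGs v : 0 < v -> intble [set: R] (fun s => kern v s * c s).
  move=> v0; apply: (lap_integrable (M := 1)) => //.
  by move=> s; rewrite mul1r; exact: (mode_le_cosh mc 2).
have sw2 : \int_ D0 (fun v => \int_ [set: R] (G v)) =
           \int_ [set: R] (fun s => \int_ D0 (G^~ s)).
  apply: (Rintegral_swap_dom (A := fun v => 32 * end_weight v)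
    (B := fun s => (cosh (s / 4))^-1)).
  - exact: mD0.
  - exact: measurableT.
  - by apply: (measurable_kernM (f := fun v => kern v t)) => //; apply: continuous_measurable_fun; exact: kern_cont1.
  - by move=> v s Dv _; exact: kern_kern_le (inD0 v Dv).
  - by apply: intbleZ => //; exact: integrable_weight.
  - exact: integrable_sech4.
  - by move=> v /inD0 v0; rewrite mulr_ge0 ?weight_ge0.
  - by move=> s _; rewrite invr_ge0 ltW// cosh_gt0.
have sw2L : \int_ D0 (fun v => \int_ [set: R] (G v)) =
    2 * \int_ D0 (fun v => mac (c := c) v * kern v t).
  rewrite -(Rint_scale 2 mD0 (mac_kern_int t)); apply: eq_Rintegral => v; rewrite inE => Dv.
  by rewrite Rint_scale//; [rewrite /mac /lap; field|apply: iGs; exact: inD0].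
have sw2R s : \int_ D0 (G^~ s) = 2 * (c s / (cosh t + cosh s)) := kern_kern_integral t s.
have -> : \int_ D0 (F^~ t) = a t * \int_ D0 (fun v => mac (c := c) v * kern v t).
  rewrite -(Rint_scale (a t) mD0 (mac_kern_int t)); apply: eq_Rintegral => v; rewrite inE => Dv.
  by rewrite FE//; ring.
congr (_ * _).
have : 2 * \int_ D0 (fun v => mac (c := c) v * kern v t) =
   2 * \int_ [set: R] (fun s => c s / (cosh t + cosh s)).
  rewrite -sw2L sw2 -(Rint_scale 2 measurableT (mode_cosh_int t)).
  by apply: eq_Rintegral => s _; exact: sw2R.
by apply: mulfI.
Qed.

End DoubleIntegral.

(** Even functions a and c with odd companions b and d that satisfy the addition
    theorems of cos and of cosh (e = 1) or cos (e = - 1). *)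
Section Convolution.
Context {R : realType}.
Context {a b c d : R -> R} {e : R}.
Hypotheses (a_cont : continuous a) (b_cont : continuous b)
  (c_cont : continuous c) (d_cont : continuous d).
Hypotheses (a_le1 : forall x, `|a x| <= 1) (b_le1 : forall x, `|b x| <= 1)
  (c_le : forall x, `|c x| <= cosh (x / 2)) (d_le : forall x, `|d x| <= cosh (x / 2)).
Hypotheses (aN : forall x, a (- x) = a x) (bN : forall x, b (- x) = - b x)
  (cN : forall x, c (- x) = c x) (dN : forall x, d (- x) = - d x).
Hypothesis aB : forall x y, a (x - y) = a x * a y + b x * b y.
Hypothesis cD : forall x y, c (x + y) = c x * c y + e * (d x * d y).
Implicit Types (x y t s : R).

Local Notation T := (measurableTypeR R).

Lemma over_cosh_int {f : R -> R} : continuous f -> (forall x, `|f x| <= cosh (x / 2)) ->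
  intble [set: R] (fun x => f x / cosh x).
Proof.
move=> cf fle; apply: (integrable_le_sech 1).
  apply: continuous_measurable_fun => x; apply: cvgM; first exact: cf.
  by apply: cvgV; [exact: cosh_neq0|exact: cosh_cont].
move=> x; rewrite mul1r; apply: le_trans (half_over_cosh x).
rewrite normrM normfV (gtr0_norm (cosh_gt0 x)) ler_wpM2r ?invr_ge0 ?(ltW (cosh_gt0 _))//.
Qed.

Lemma le1_mul_le {f g : R -> R} x : `|f x| <= 1 -> `|g x| <= cosh (x / 2) ->
  `|f x * g x| <= cosh (x / 2).
Proof.
move=> f1 gle; rewrite normrM -[leRHS]mul1r; exact: ler_pM.
Qed.

Definition even_part : R := \int_ [set: R] (fun x => a x * c x / cosh x).
Definition odd_part : R := \int_ [set: R] (fun x => b x * d x / cosh x).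

(** The factorisation, in the variables t and s after the shift s -> t + s. *)
Lemma coshD_pair t s : cosh t + cosh (t + s) = 2 * (cosh (t + s / 2) * cosh (s / 2)).
Proof.
have h1 : cosh t = cosh ((t + s / 2) - s / 2) by congr cosh; ring.
have h2 : cosh (t + s) = cosh ((t + s / 2) + s / 2) by congr cosh; field.
by rewrite h1 h2 !coshD coshN sinhN; ring.
Qed.

Let F t s : R := a t * (c (t + s) / (cosh t + cosh (t + s))).

Lemma conv_shift s x :
  F (x - s / 2) s = a (x - s / 2) * c (x + s / 2) / (2 * (cosh x * cosh (s / 2))).
Proof.
by rewrite /F coshD_pair (_ : x - s / 2 + s = x + s / 2) ?subrK ?mulrA//; field.
Qed.

(** In the separated variables the integrand has a majorant in product form. *)
Lemma conv_shift_le s x :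
  `|F (x - s / 2) s| <= (cosh (x / 4))^-1 * (cosh (s / 4))^-1.
Proof.
have Cx := cosh_gt0 x; have Cs := cosh_gt0 (s / 2).
have D0 : 0 < 2 * (cosh x * cosh (s / 2)) by apply: mulr_gt0 => //; exact: mulr_gt0.
rewrite conv_shift normrM normfV (gtr0_norm D0).
apply: (@le_trans _ _ ((cosh (x / 2) / cosh x) * (cosh (s / 2 / 2) / cosh (s / 2)))); last first.
  apply: ler_pM; rewrite ?divr_ge0 ?(ltW (cosh_gt0 _))//; first exact: half_over_cosh.
  have -> : s / 4 = s / 2 / 2 by field.
  rewrite ler_pdivrMr// [leRHS]mulrC ler_pdivlMr ?cosh_gt0// -expr2.
  exact: cosh_half_sqr.
have -> : cosh (x / 2) / cosh x * (cosh (s / 2 / 2) / cosh (s / 2)) =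
   (2 * (cosh (x / 2) * cosh (s / 2 / 2))) / (2 * (cosh x * cosh (s / 2))).
  by field; rewrite !lt0r_neq0.
rewrite ler_wpM2r ?invr_ge0 ?(ltW D0)// normrM.
have h : cosh ((x + s / 2) / 2) <= 2 * (cosh (x / 2) * cosh (s / 2 / 2)).
  rewrite (_ : (x + s / 2) / 2 = x / 2 + s / 2 / 2); last by field.
  rewrite coshD mulr_natl mulr2n lerD2l; apply: le_trans (ler_norm _) _.
  by rewrite normrM; apply: ler_pM => //; exact: sinh_abs_le.
apply: (@le_trans _ _ (1 * cosh ((x + s / 2) / 2))); last by rewrite mul1r.
by apply: ler_pM.
Qed.

Lemma conv_cont s : continuous (F^~ s).
Proof.
have cs : continuous (fun t => t + s) by move=> t; apply: cvgD; [exact: cvg_id|exact: cvg_cst].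
move=> t; apply: cvgM; first exact: a_cont.
apply: cvgM.
  by apply: (@continuous_comp _ _ _ (fun t => t + s) c); [exact: cs|exact: c_cont].
apply: cvgV; first by rewrite gt_eqF// addr_gt0 ?cosh_gt0.
apply: cvgD; first exact: cosh_cont.
by apply: (@continuous_comp _ _ _ (fun t => t + s) cosh); [exact: cs|exact: cosh_cont].
Qed.

Lemma conv_norm_integral s :
  (\int[lebesgue_measure]_(t in [set: R]) `|F t s|%:E <=
   (@sech4_mass R * (cosh (s / 4))^-1)%:E)%E.
Proof.
have cF : continuous (fun t => `|F t s|).
  move=> t; apply: (@continuous_comp _ _ _ (F^~ s) (fun z => `|z|)); first exact: conv_cont.
  exact: norm_continuous.
rewrite (ge0_integral_affine 1 (- (s / 2)) ltr01 cF); last by move=> x; exact: normr_ge0.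
have q0 x : 0 <= (cosh (x / 4))^-1 :> R by rewrite invr_ge0 ltW// cosh_gt0.
apply: (@le_trans _ _ (\int[lebesgue_measure]_x ((cosh (s / 4))^-1%:E * (cosh (x / 4))^-1%:E)%E)%E).
  apply: ge0_le_integral => //.
  - apply/measurable_EFinP; apply: continuous_measurable_fun => x.
    apply: cvgM; last exact: cvg_cst.
    apply: (@continuous_comp _ _ _ (fun x => 1 * x - s / 2) (fun t => `|F t s|)); last exact: cF.
    by apply: cvgD; [apply: cvgM; [exact: cvg_cst|exact: cvg_id]|exact: cvg_cst].
  - apply/measurable_EFinP; apply: continuous_measurable_fun => x.
    by apply: cvgM; [exact: cvg_cst|exact: sech4_cont].
  - by move=> x _; rewrite -EFinM lee_fin mul1r mulr1 [leRHS]mulrC conv_shift_le.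
rewrite ge0_integralZl//.
- have fin := integrable_fin_num measurableT (@integrable_sech4 R).
  by rewrite /sech4_mass /Rintegral EFinM fineK// muleC.
- by apply/measurable_EFinP; apply: continuous_measurable_fun; exact: sech4_cont.
- by move=> x _; rewrite lee_fin.
- by rewrite lee_fin.
Qed.

Lemma conv_measurable : measurable_fun [set: T * T] (fun z => F z.1 z.2).
Proof.
have mC : measurable_fun [set: T] (@cosh R) by apply: continuous_measurable_fun; exact: cosh_cont.
have ma : measurable_fun [set: T] a by exact: continuous_measurable_fun.
have mc : measurable_fun [set: T] c by exact: continuous_measurable_fun.
have mS : measurable_fun [set: T] (fun x : T => (cosh x)^-1).
  by apply: continuous_measurable_fun => x; apply: cvgV; [exact: cosh_neq0|exact: cosh_cont].
have m1 : measurable_fun [set: T * T] (fun z => z.1) := measurable_fst.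
have m2 : measurable_fun [set: T * T] (fun z => z.2 / 2).
  by apply: measurable_funM => //; exact: measurable_snd.
have m12 : measurable_fun [set: T * T] (fun z => z.1 + z.2).
  by apply: measurable_funD; [exact: measurable_fst|exact: measurable_snd].
have m122 : measurable_fun [set: T * T] (fun z => z.1 + z.2 / 2) by exact: measurable_funD.
have -> : (fun z : T * T => F z.1 z.2) = (fun z => a z.1 * (c (z.1 + z.2) *
    (2^-1 * ((cosh (z.1 + z.2 / 2))^-1 * (cosh (z.2 / 2))^-1)))).
  by apply/funext => z; rewrite /F coshD_pair !invfM.
apply: measurable_funM; first exact: (measurableT_comp ma m1).
apply: measurable_funM; first exact: (measurableT_comp mc m12).
apply: measurable_funM => //; apply: measurable_funM; first exact: (measurableT_comp mS m122).
exact: (measurableT_comp mS m2).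
Qed.

Lemma conv_int s : intble [set: R] (F^~ s).
Proof.
apply/integrableP; split; first by apply/measurable_EFinP; apply: continuous_measurable_fun; exact: conv_cont.
by apply: le_lt_trans (conv_norm_integral s) _; rewrite ltry.
Qed.

(** The mixed products of an even and an odd function integrate to 0. *)
Lemma conv_inner s : \int_ [set: R] (F^~ s) =
  (even_part * (a (s / 2) * c (s / 2)) + e * (odd_part * (b (s / 2) * d (s / 2)))) /
  (2 * cosh (s / 2)).
Proof.
have Cs := cosh_gt0 (s / 2); set y := s / 2 in Cs *.
rewrite (Rintegral_affine 1 (- y) ltr01 (conv_cont s) (conv_int s)).
have ac := over_cosh_int (f := fun x => a x * c x).
have iac : intble [set: R] (fun x => a x * c x / cosh x).
  by apply: over_cosh_int => x; [apply: cvgM; [exact: a_cont|exact: c_cont]|exact: le1_mul_le].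
have ibd : intble [set: R] (fun x => b x * d x / cosh x).
  by apply: over_cosh_int => x; [apply: cvgM; [exact: b_cont|exact: d_cont]|exact: le1_mul_le].
have iad : intble [set: R] (fun x => a x * d x / cosh x).
  by apply: over_cosh_int => x; [apply: cvgM; [exact: a_cont|exact: d_cont]|exact: le1_mul_le].
have ibc : intble [set: R] (fun x => b x * c x / cosh x).
  by apply: over_cosh_int => x; [apply: cvgM; [exact: b_cont|exact: c_cont]|exact: le1_mul_le].
have zad : \int_ [set: R] (fun x => a x * d x / cosh x) = 0.
  apply: Rintegral_odd => //; last by move=> x; rewrite aN dN coshN; ring.
  move=> x; apply: cvgM; first by apply: cvgM; [exact: a_cont|exact: d_cont].
  by apply: cvgV; [exact: cosh_neq0|exact: cosh_cont].
have zbc : \int_ [set: R] (fun x => b x * c x / cosh x) = 0.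
  apply: Rintegral_odd => //; last by move=> x; rewrite bN cN coshN; ring.
  move=> x; apply: cvgM; first by apply: cvgM; [exact: b_cont|exact: c_cont].
  by apply: cvgV; [exact: cosh_neq0|exact: cosh_cont].
pose k1 := (2 * cosh y)^-1.
have mT : measurable [set: R] by exact: measurableT.
transitivity (\int_ [set: R] (fun x =>
  (k1 * (a y * c y) * (a x * c x / cosh x) + k1 * (e * (b y * d y)) * (b x * d x / cosh x)) +
  (k1 * (e * (a y * d y)) * (a x * d x / cosh x) + k1 * (b y * c y) * (b x * c x / cosh x)))).
  apply: eq_Rintegral => x _; rewrite mul1r mulr1 conv_shift -/y aB cD /k1.
  by field; rewrite !cosh_neq0.
rewrite Rint_add//; [|by apply: intbleD => //; exact: intbleZ..].
rewrite !Rint_add//; [|exact: intbleZ..].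
rewrite !Rint_scale// zad zbc !mulr0 !addr0 -/even_part -/odd_part /k1.
by field; exact: lt0r_neq0.
Qed.

(** The kernel 1/(cosh t + cosh s) is a product in the variables (t + s) / 2 and
    (s - t) / 2, and the addition theorems split the numerator accordingly. *)
Lemma cosh_sum_integral :
  \int_ [set: R] (fun t => a t * \int_ [set: R] (fun s => c s / (cosh t + cosh s))) =
  even_part ^+ 2 + e * odd_part ^+ 2.
Proof.
have mT : measurable [set: R] by exact: measurableT.
have icc t := over_cosh_sum_int t c_cont c_le.
have cont_c t : continuous (fun s => c s / (cosh t + cosh s)).
  move=> s; apply: cvgM; first exact: c_cont.
  apply: cvgV; first by rewrite gt_eqF// addr_gt0 ?cosh_gt0.
  by apply: cvgD; [exact: cvg_cst|exact: cosh_cont].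
have mF := conv_measurable.
transitivity (\int_ [set: R] (fun t => \int_ [set: R] (F t))).
  apply: eq_Rintegral => t _.
  rewrite (Rintegral_affine 1 t ltr01 (cont_c t) (icc t)) -Rint_scale//.
    by apply: eq_Rintegral => s _; rewrite mul1r mulr1 /F (addrC s).
  have := (Rintegral_subst_signed (fun s => 1 * s + t) 1 _ _ (cont_c t) (icc t) ler01).2.
  apply.
    by move=> s; apply: cvgD; [apply: cvgM; [exact: cvg_cst|exact: cvg_id]|exact: cvg_cst].
  by move=> g cg g0; exact: ge0_integral_affine.
rewrite (Rintegral_swap (B := fun s => @sech4_mass R * (cosh (s / 4))^-1))//; last 2 first.
- exact: conv_norm_integral.
- by apply: intbleZ => //; exact: integrable_sech4.
pose G y : R := even_part * (a y * c y / cosh y) + e * odd_part * (b y * d y / cosh y).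
have iac : intble [set: R] (fun x => a x * c x / cosh x).
  by apply: over_cosh_int => x; [apply: cvgM; [exact: a_cont|exact: c_cont]|exact: le1_mul_le].
have ibd : intble [set: R] (fun x => b x * d x / cosh x).
  by apply: over_cosh_int => x; [apply: cvgM; [exact: b_cont|exact: d_cont]|exact: le1_mul_le].
have iG : intble [set: R] G by apply: intbleD => //; exact: intbleZ.
have cG : continuous G.
  have cV : continuous (fun x : R => (cosh x)^-1).
    by move=> x; apply: cvgV; [exact: cosh_neq0|exact: cosh_cont].
  move=> x; apply: cvgD; apply: cvgM; try exact: cvg_cst; apply: cvgM; try exact: cV.
    by apply: cvgM; [exact: a_cont|exact: c_cont].
  by apply: cvgM; [exact: b_cont|exact: d_cont].
have h2 : 0 < 2^-1 :> R by rewrite invr_gt0.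
transitivity (\int_ [set: R] G).
  rewrite (Rintegral_affine 2^-1 0 h2 cG iG); apply: eq_Rintegral => s _.
  rewrite conv_inner addr0 (mulrC 2^-1 s) /G.
  by field; rewrite cosh_neq0.
by rewrite Rint_add ?Rint_scale//; [rewrite -/even_part -/odd_part; ring|exact: intbleZ..].
Qed.

End Convolution.

(** * Contour shift *)

Section Contour.
Context {R : realType}.
Implicit Types (t s x : R).

Local Notation T := (measurableTypeR R).

Lemma le_norm_sqr (x y z : R) : 0 <= z -> x ^+ 2 + y ^+ 2 <= z ^+ 2 -> `|x| <= z /\ `|y| <= z.
Proof.
move=> z0 h; have x2 := sqr_ge0 x; have y2 := sqr_ge0 y.
by split; rewrite -(ler_pXn2r (n := 2))// ?nnegrE// real_normK ?num_real//; lra.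
Qed.

Lemma cos_ge_left x y : `|x| <= y -> y <= pi / 2 -> cos y <= cos x.
Proof.
move=> xy ypi; have pi0 := @pi_gt0 R; have y0 : 0 <= y by apply: le_trans xy.
move: xy; rewrite ler_norml => /andP[x1 x2].
have -> : cos x = cos ((y + x) / 2 - (y - x) / 2) by congr cos; field.
have -> : cos y = cos ((y + x) / 2 + (y - x) / 2) by congr cos; field.
rewrite cosB cosD.
have s1 : 0 <= sin ((y + x) / 2) by apply: sin_ge0_pi; apply/andP; split; lra.
have s2 : 0 <= sin ((y - x) / 2) by apply: sin_ge0_pi; apply/andP; split; lra.
by have := mulr_ge0 s1 s2; lra.
Qed.

(** The quotient rule for (p + i q) / (a + i b) in real coordinates, when p + i q
    has logarithmic derivative al1 + i al2. *)
Lemma der_quotient {p q a b : R -> R} {al1 al2 a1 b1 N T1 T2 : R} x :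
  has_der p x (al1 * p x - al2 * q x) -> has_der q x (al2 * p x + al1 * q x) ->
  has_der a x a1 -> has_der b x b1 ->
  a x ^+ 2 + b x ^+ 2 = N -> N != 0 ->
  T1 = (a1 * a x + b1 * b x) / N -> T2 = (b1 * a x - a1 * b x) / N ->
  has_der (fun y => (p y * a y + q y * b y) / (a y ^+ 2 + b y ^+ 2)) x
    ((al1 - T1) * ((p x * a x + q x * b x) / N) -
     (al2 - T2) * ((q x * a x - p x * b x) / N)) /\
  has_der (fun y => (q y * a y - p y * b y) / (a y ^+ 2 + b y ^+ 2)) x
    ((al2 - T2) * ((p x * a x + q x * b x) / N) +
     (al1 - T1) * ((q x * a x - p x * b x) / N)).
Proof.
move=> dp dq da db NE N0 -> ->.
have dN : has_der (fun y => a y ^+ 2 + b y ^+ 2) x (2 * a x * a1 + 2 * b x * b1).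
  have sq (f : R -> R) c : has_der f x c -> has_der (fun y => f y ^+ 2) x (2 * f x * c).
    by move=> df; apply: has_der_eq; [exact: (derM df df)|rewrite /=; ring].
  by apply: derD; exact: sq.
have N0' : a x ^+ 2 + b x ^+ 2 != 0 by rewrite NE.
have dV := derV (f := fun y => a y ^+ 2 + b y ^+ 2) N0' dN.
split; apply: has_der_eq.
- exact: (derM (derD (derM dp da) (derM dq db)) dV).
- by rewrite /= -NE; field.
- exact: (derM (derD (derM dq da) (derN (derM dp db))) dV).
- by rewrite /= -NE; field.
Qed.

Context {r m : R}.
Hypothesis r_le : `|r| <= 2^-1.

(* exp ((r + i m) (t + i s)) = ec t s + i es t s and
   cosh (t + i s) = wr t s + i wi t s *)
Let ec t s : R := expR (r * t - m * s) * cos (m * t + r * s).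
Let es t s : R := expR (r * t - m * s) * sin (m * t + r * s).
Let wr t s : R := cosh t * cos s.
Let wi t s : R := sinh t * sin s.
Let N t s : R := wr t s ^+ 2 + wi t s ^+ 2.
Let T1 t s : R := (sinh t * cos s * wr t s + cosh t * sin s * wi t s) / N t s.
Let T2 t s : R := (cosh t * sin s * wr t s - sinh t * cos s * wi t s) / N t s.

(** Real and imaginary part of exp (al z) / cosh z, al = r + i m, z = t + i s. *)
Definition contour1 t s : R := (ec t s * wr t s + es t s * wi t s) / N t s.
Definition contour2 t s : R := (es t s * wr t s - ec t s * wi t s) / N t s.
Definition dcontour1 t s : R := (r - T1 t s) * contour1 t s - (m - T2 t s) * contour2 t s.
Definition dcontour2 t s : R := (m - T2 t s) * contour1 t s + (r - T1 t s) * contour2 t s.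

Lemma contour_denE t s : N t s = sinh t ^+ 2 + cos s ^+ 2.
Proof.
rewrite /N /wr /wi; have := cosh2_sinh2 t; have := sin2cos2 s.
move: (cosh t) (sinh t) (cos s) (sin s) => a b c d d2 a2.
rewrite !exprMn d2; have -> : a ^+ 2 = 1 + b ^+ 2 by lra.
by ring.
Qed.

Lemma contour_den_gt0 t s : 0 < cos s -> 0 < N t s.
Proof. by move=> c0; rewrite contour_denE ltr_wpDl ?sqr_ge0// exprn_gt0. Qed.

Lemma der_contour_t t s : 0 < cos s ->
  has_der (contour1^~ s) t (dcontour1 t s) /\ has_der (contour2^~ s) t (dcontour2 t s).
Proof.
move=> c0; have N0 := lt0r_neq0 (contour_den_gt0 t s c0).
have de : has_der (fun t => r * t - m * s) t r.
  apply: has_der_eq; first exact: (derD (derM (derC r t) (derX t)) (derC (- (m * s)) t)).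
  by rewrite /=; ring.
have dm : has_der (fun t => m * t + r * s) t m.
  apply: has_der_eq; first exact: (derD (derM (derC m t) (derX t)) (derC (r * s) t)).
  by rewrite /=; ring.
apply: (der_quotient (p := ec^~ s) (q := es^~ s) (a := wr^~ s) (b := wi^~ s)
  (a1 := sinh t * cos s) (b1 := cosh t * sin s)) => //.
- apply: has_der_eq; first exact: (derM (der_exp de) (der_cos dm)).
  by rewrite /ec /es; ring.
- apply: has_der_eq; first exact: (derM (der_exp de) (der_sin dm)).
  by rewrite /ec /es; ring.
- by apply: has_der_eq; first exact: (derM (der_cosh (derX t)) (derC (cos s) t)); rewrite /=; ring.
- by apply: has_der_eq; first exact: (derM (der_sinh (derX t)) (derC (sin s) t)); rewrite /=; ring.
Qed.

(** The Cauchy-Riemann equations. *)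
Lemma der_contour_s t s : 0 < cos s ->
  has_der (contour1 t) s (- dcontour2 t s) /\ has_der (contour2 t) s (dcontour1 t s).
Proof.
move=> c0; have N0 := lt0r_neq0 (contour_den_gt0 t s c0).
have de : has_der (fun s => r * t - m * s) s (- m).
  apply: has_der_eq; first exact: (derD (derC (r * t) s) (derN (derM (derC m s) (derX s)))).
  by rewrite /=; ring.
have dm : has_der (fun s => m * t + r * s) s r.
  apply: has_der_eq; first exact: (derD (derC (m * t) s) (derM (derC r s) (derX s))).
  by rewrite /=; ring.
have [] := der_quotient (p := ec t) (q := es t) (a := wr t) (b := wi t)
  (a1 := - (cosh t * sin s)) (b1 := sinh t * cos s) (al1 := - m) (al2 := r)
  (T1 := - T2 t s) (T2 := T1 t s) (N := N t s) s.
- apply: has_der_eq; first exact: (derM (der_exp de) (der_cos dm)).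
  by rewrite /ec /es; ring.
- apply: has_der_eq; first exact: (derM (der_exp de) (der_sin dm)).
  by rewrite /ec /es; ring.
- by apply: has_der_eq; first exact: (derM (derC (cosh t) s) (der_cos (derX s))); rewrite /=; ring.
- by apply: has_der_eq; first exact: (derM (derC (sinh t) s) (der_sin (derX s))); rewrite /=; ring.
- by [].
- by [].
- by rewrite /T2 -mulNr; congr (_ / _); ring.
- by rewrite /T1; congr (_ / _); ring.
rewrite -/(contour1 t s) -/(contour2 t s) => d1 d2; split.
  by apply: has_der_eq d1 _; rewrite /dcontour2; ring.
by apply: has_der_eq d2 _; rewrite /dcontour1; ring.
Qed.

Let K (k : R) : R := 2 * expR (2 * `|m|) / k.

Lemma exp_mode_le t : expR (r * t) <= 2 * cosh (t / 2).
Proof.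
apply: (@le_trans _ _ (2 * cosh (r * t))).
  by rewrite /cosh; have := expR_ge0 (- (r * t)); lra.
rewrite ler_wpM2l//; apply: cosh_abs_le; rewrite !normrM mulrC ler_wpM2l//.
by rewrite [`|2^-1|]ger0_norm.
Qed.

(** |exp (al z)| = exp (r t - m s) and |cosh z| >= cosh t cos s, and |r| <= 1/2
    leaves the decay cosh (t / 2) / cosh t. The bound is uniform on the heights
    with cos s >= k. *)
Lemma contour_le t s (k : R) : 0 < k -> k <= cos s -> `|s| <= 2 ->
  `|contour1 t s| <= K k / cosh (t / 4) /\ `|contour2 t s| <= K k / cosh (t / 4).
Proof.
move=> k0 ks s2; have c0 := lt_le_trans k0 ks; have N0 := contour_den_gt0 t s c0.
have Ct := cosh_gt0 t.
have K0 : 0 <= K k by rewrite divr_ge0 ?(ltW k0)// mulr_ge0 ?expR_ge0.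
apply: le_norm_sqr; first by rewrite divr_ge0// ltW// cosh_gt0.
pose e := expR (r * t - m * s).
have e0 : 0 <= e by exact: expR_ge0.
have E : contour1 t s ^+ 2 + contour2 t s ^+ 2 = e ^+ 2 / N t s.
  have h : ec t s ^+ 2 + es t s ^+ 2 = e ^+ 2.
    by rewrite /ec /es -/e !exprMn -mulrDr cos2Dsin2 mulr1.
  have -> : contour1 t s ^+ 2 + contour2 t s ^+ 2 =
    (ec t s ^+ 2 + es t s ^+ 2) * (wr t s ^+ 2 + wi t s ^+ 2) / N t s ^+ 2.
    by rewrite /contour1 /contour2; field; exact: lt0r_neq0.
  by rewrite h -/(N t s); field; exact: lt0r_neq0.
have w0 : 0 < wr t s by rewrite mulr_gt0.
have eK : e / wr t s <= K k / cosh (t / 4).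
  apply: (@le_trans _ _ (2 * expR (2 * `|m|) / k * (cosh (t / 2) / cosh t))); last first.
    by rewrite -/(K k) ler_wpM2l// half_over_cosh.
  have -> : 2 * expR (2 * `|m|) / k * (cosh (t / 2) / cosh t) =
    (2 * cosh (t / 2) * expR (2 * `|m|)) * (k * cosh t)^-1.
    by field; rewrite !lt0r_neq0.
  apply: ler_pM => //; first by rewrite invr_ge0 ltW.
    rewrite /e expRD; apply: ler_pM; rewrite ?expR_ge0// ?exp_mode_le// ler_expR.
    apply: le_trans (ler_norm _) _; rewrite normrN normrM mulrC.
    by rewrite ler_wpM2r.
  have kC : 0 < k * cosh t by exact: mulr_gt0.
  by rewrite lef_pV2 ?posrE// /wr [leRHS]mulrC ler_wpM2r// ltW.
rewrite E; apply: (@le_trans _ _ ((e / wr t s) ^+ 2)).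
  rewrite expr_div_n ler_wpM2l ?sqr_ge0// lef_pV2 ?posrE ?exprn_gt0//.
  by rewrite /N lerDl sqr_ge0.
have eK0 : 0 <= e / wr t s by rewrite divr_ge0// ltW.
by rewrite lerXn2r ?nnegrE// (le_trans eK0).
Qed.

(** T1 + i T2 is tanh z, and |sinh z|^2 = |cosh z|^2 + 1 - 2 cos^2 s. *)
Lemma contour_T_le t s (k : R) : 0 < k -> k <= cos s ->
  `|T1 t s| <= 1 + k^-1 /\ `|T2 t s| <= 1 + k^-1.
Proof.
move=> k0 ks; have c0 := lt_le_trans k0 ks; have N0 := contour_den_gt0 t s c0.
have kV0 : 0 < k^-1 by rewrite invr_gt0.
apply: le_norm_sqr; first by rewrite addr_ge0// ltW.
have -> : T1 t s ^+ 2 + T2 t s ^+ 2 = ((sinh t * cos s) ^+ 2 + (cosh t * sin s) ^+ 2) / N t s.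
  have -> : T1 t s ^+ 2 + T2 t s ^+ 2 = ((sinh t * cos s) ^+ 2 + (cosh t * sin s) ^+ 2) *
     (wr t s ^+ 2 + wi t s ^+ 2) / N t s ^+ 2.
    by rewrite /T1 /T2; field; exact: lt0r_neq0.
  by rewrite -/(N t s); field; exact: lt0r_neq0.
have -> : (sinh t * cos s) ^+ 2 + (cosh t * sin s) ^+ 2 = N t s + 1 - 2 * cos s ^+ 2.
  rewrite contour_denE; have := cosh2_sinh2 t; have := sin2cos2 s.
  move: (cosh t) (sinh t) (cos s) (sin s) => a b c d d2 a2.
  rewrite !exprMn d2; have -> : a ^+ 2 = 1 + b ^+ 2 by lra.
  by ring.
apply: (@le_trans _ _ (1 + k^-1 ^+ 2)); last first.
  by rewrite sqrrD expr1n lerD2r lerDl mul1r mulr2n addr_ge0// ltW.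
rewrite ler_pdivrMr// mulrDl mul1r.
have h : 1 <= k^-1 ^+ 2 * N t s.
  apply: (@le_trans _ _ (k^-1 ^+ 2 * k ^+ 2)).
    by rewrite -exprMn mulVf ?expr1n// lt0r_neq0.
  rewrite ler_wpM2l ?sqr_ge0// contour_denE; apply: (@le_trans _ _ (cos s ^+ 2)).
    by rewrite lerXn2r// nnegrE ltW.
  by rewrite lerDr sqr_ge0.
by have := sqr_ge0 (cos s); lra.
Qed.

Lemma dcontour_le t s (k : R) : 0 < k -> k <= cos s -> `|s| <= 2 ->
  let B := (`|r| + `|m| + 2 * (1 + k^-1)) * K k in
  `|dcontour1 t s| <= B / cosh (t / 4) /\ `|dcontour2 t s| <= B / cosh (t / 4).
Proof.
move=> k0 ks s2 B; have [h1 h2] := contour_le t s k k0 ks s2.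
have [t1 t2] := contour_T_le t s k k0 ks.
have a1 : `|r - T1 t s| <= `|r| + (1 + k^-1) by apply: le_trans (ler_normB _ _) _; rewrite lerD2l.
have a2 : `|m - T2 t s| <= `|m| + (1 + k^-1) by apply: le_trans (ler_normB _ _) _; rewrite lerD2l.
have -> : B / cosh (t / 4) = (`|r| + (1 + k^-1)) * (K k / cosh (t / 4)) +
   (`|m| + (1 + k^-1)) * (K k / cosh (t / 4)) by rewrite /B; ring.
rewrite /dcontour1 /dcontour2.
move: (contour1 t s) (contour2 t s) (r - T1 t s) (m - T2 t s) h1 h2 a1 a2 => x y a b x1 y1 a1 b1.
have M (c d C D : R) : `|c| <= C -> `|d| <= D -> `|c * d| <= C * D.
  by move=> cC dD; rewrite normrM; exact: ler_pM.
split; first by apply: le_trans (ler_normB _ _) _; apply: lerD; exact: M.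
by rewrite addrC; apply: le_trans (ler_normD _ _) _; apply: lerD; exact: M.
Qed.

Lemma contour_T_cont s : 0 < cos s -> continuous (T1^~ s) /\ continuous (T2^~ s).
Proof.
move=> c0.
have ca : continuous (fun t => cosh t * cos s).
  by move=> t; apply: cvgM; [exact: cosh_cont|exact: cvg_cst].
have cb : continuous (fun t => sinh t * sin s).
  by move=> t; apply: cvgM; [exact: sinh_cont|exact: cvg_cst].
have ca1 : continuous (fun t => sinh t * cos s).
  by move=> t; apply: cvgM; [exact: sinh_cont|exact: cvg_cst].
have cb1 : continuous (fun t => cosh t * sin s).
  by move=> t; apply: cvgM; [exact: cosh_cont|exact: cvg_cst].
have cN : continuous (fun t => (N t s)^-1).
  move=> t; apply: cvgV; first exact: lt0r_neq0 (contour_den_gt0 t s c0).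
  apply: cvgD.
    by apply: (@continuous_comp _ _ _ (wr^~ s) (fun x => x ^+ 2)); [exact: ca|exact: exprn_continuous].
  by apply: (@continuous_comp _ _ _ (wi^~ s) (fun x => x ^+ 2)); [exact: cb|exact: exprn_continuous].
split=> t; apply: cvgM; try exact: cN.
  by apply: cvgD; apply: cvgM; [exact: ca1|exact: ca|exact: cb1|exact: cb].
by apply: cvgB; apply: cvgM; [exact: cb1|exact: ca|exact: ca1|exact: cb].
Qed.

Lemma contour_cont s : 0 < cos s -> continuous (contour1^~ s) /\ continuous (contour2^~ s).
Proof.
move=> c0; split=> t; have [d1 d2] := der_contour_t t s c0.
  exact: der_cont d1.
exact: der_cont d2.
Qed.

Lemma dcontour_cont s : 0 < cos s -> continuous (dcontour1^~ s) /\ continuous (dcontour2^~ s).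
Proof.
move=> c0; have [h1 h2] := contour_cont s c0; have [t1 t2] := contour_T_cont s c0.
have ar : continuous (fun t => r - T1 t s) by move=> t; apply: cvgB; [exact: cvg_cst|exact: t1].
have am : continuous (fun t => m - T2 t s) by move=> t; apply: cvgB; [exact: cvg_cst|exact: t2].
split=> t.
  by apply: cvgB; apply: cvgM; [exact: ar|exact: h1|exact: am|exact: h2].
by apply: cvgD; apply: cvgM; [exact: am|exact: h1|exact: ar|exact: h2].
Qed.

Lemma strip_le2 s : `|s| < pi / 2 -> `|s| <= 2.
Proof. by move=> h; have := @pihalf_lt2 R; lra. Qed.

Lemma strip_cos_gt0 s : `|s| < pi / 2 -> 0 < cos s.
Proof. by rewrite ltr_norml => h; exact: cos_gt0_pihalf. Qed.

Lemma contour_int s : `|s| < pi / 2 ->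
  intble [set: R] (contour1^~ s) /\ intble [set: R] (contour2^~ s).
Proof.
move=> hs; have c0 := strip_cos_gt0 s hs; have [h1 h2] := contour_cont s c0.
by split; apply: (integrable_le_sech (K (cos s))); [exact: continuous_measurable_fun| |
  exact: continuous_measurable_fun|] => t;
  have [] := contour_le t s (cos s) c0 (lexx _) (strip_le2 s hs).
Qed.

Lemma dcontour_integral0 s : `|s| < pi / 2 ->
  \int_ [set: R] (dcontour1^~ s) = 0 /\ \int_ [set: R] (dcontour2^~ s) = 0.
Proof.
move=> hs; have c0 := strip_cos_gt0 s hs; have s2 := strip_le2 s hs.
have [h1 h2] := dcontour_cont s c0.
have le t := dcontour_le t s (cos s) c0 (lexx _) s2.
have le' t := contour_le t s (cos s) c0 (lexx _) s2.
split; apply: Rintegral_derivative0.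
- apply: integrable_le_sech; first exact: continuous_measurable_fun.
  by move=> t; have [h _] := le t; exact: h.
- by move=> t; have [d _] := der_contour_t t s c0; exact: d.
- exact: h1.
- by move=> t; have [h _] := le' t; exact: h.
- apply: integrable_le_sech; first exact: continuous_measurable_fun.
  by move=> t; have [_ h] := le t; exact: h.
- by move=> t; have [_ d] := der_contour_t t s c0; exact: d.
- exact: h2.
- by move=> t; have [_ h] := le' t; exact: h.
Qed.

(** The derivative in s under the integral is, by the Cauchy-Riemann equations, a
    derivative in t of a function vanishing at both ends. *)
Lemma der_contour_integral s : `|s| < pi / 2 ->
  has_der (fun s => \int_ [set: R] (contour1^~ s)) s 0 /\
  has_der (fun s => \int_ [set: R] (contour2^~ s)) s 0.
Proof.
move=> hs; pose b := (`|s| + pi / 2) / 2.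
have bpi : b < pi / 2 by rewrite /b; lra.
have sb : `|s| < b by rewrite /b; lra.
have b0 : 0 <= b by apply: le_trans (ltW sb).
have kb : 0 < cos b by apply: strip_cos_gt0; rewrite ger0_norm.
have abs x : - b < x < b -> `|x| < b by rewrite ltr_norml.
have strip x : - b < x < b -> `|x| < pi / 2 by move=> /abs h; lra.
have kx x : - b < x < b -> cos b <= cos x.
  by move=> /abs h; apply: cos_ge_left; [exact: ltW|exact: ltW].
have [i1 i2] := dcontour_integral0 s hs.
have iD (B : R) : intble [set: R] (fun t => B / cosh (t / 4)).
  by apply: intbleZ => //; exact: integrable_sech4.
have sI : - b < s < b by rewrite -ltr_norml.
have i2' : \int_ [set: R] (fun t => - dcontour2 t s) = 0.
  have -> : (fun t => - dcontour2 t s) = (fun t => -1 * dcontour2 t s).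
    by apply/funext => t; rewrite mulN1r.
  rewrite Rint_scale ?i2 ?mulr0//; have c0 := strip_cos_gt0 s hs.
  apply: integrable_le_sech; first by apply: continuous_measurable_fun; exact: (dcontour_cont s c0).2.
  by move=> t; have [_ h] := dcontour_le t s (cos s) c0 (lexx _) (strip_le2 s hs); exact: h.
pose f1 x t := contour1 t x; pose f2 x t := contour2 t x.
split.
- rewrite -i2'; apply: (der_under_integral (f := f1) (df := fun x t => - dcontour2 t x)
    (- b) b measurableT sI _ _ _ (iD _)).
  + by move=> x /strip hx; have [] := contour_int x hx.
  + by move=> x t xb _; have [] := der_contour_s t x (strip_cos_gt0 x (strip x xb)).
  + move=> x t xb _; rewrite normrN.
    by have [_ h] := dcontour_le t x (cos b) kb (kx x xb) (strip_le2 x (strip x xb)); exact: h.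
- rewrite -i1; apply: (der_under_integral (f := f2) (df := fun x t => dcontour1 t x)
    (- b) b measurableT sI _ _ _ (iD _)).
  + by move=> x /strip hx; have [] := contour_int x hx.
  + by move=> x t xb _; have [] := der_contour_s t x (strip_cos_gt0 x (strip x xb)).
  + move=> x t xb _.
    by have [h _] := dcontour_le t x (cos b) kb (kx x xb) (strip_le2 x (strip x xb)); exact: h.
Qed.

(** Shifting the contour: the integrals do not depend on the height s. *)
Lemma contour_integral_const s : 0 <= s < pi / 2 ->
  [/\ \int_ [set: R] (contour1^~ s) = \int_ [set: R] (contour1^~ 0),
      \int_ [set: R] (contour2^~ s) = \int_ [set: R] (contour2^~ 0),
      \int_ [set: R] (contour1^~ (- s)) = \int_ [set: R] (contour1^~ 0) &
      \int_ [set: R] (contour2^~ (- s)) = \int_ [set: R] (contour2^~ 0)].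
Proof.
move=> /andP[s0 spi].
have d1 x : `|x| <= s -> has_der (fun s => \int_ [set: R] (contour1^~ s)) x 0.
  by move=> xs; have [] := der_contour_integral x (le_lt_trans xs spi).
have d2 x : `|x| <= s -> has_der (fun s => \int_ [set: R] (contour2^~ s)) x 0.
  by move=> xs; have [] := der_contour_integral x (le_lt_trans xs spi).
have p x : 0 <= x <= s -> `|x| <= s by move=> /andP[x0 xs]; rewrite ger0_norm.
have n x : - s <= x <= 0 -> `|x| <= s by move=> /andP[x0 xs]; rewrite ler_norml x0 (le_trans xs).
have s0' : - s <= 0 by rewrite oppr_le0.
split.
- exact: esym (der0_eq _ _ s0 (fun x h => d1 x (p x h))).
- exact: esym (der0_eq _ _ s0 (fun x h => d2 x (p x h))).
- exact: (der0_eq _ _ s0' (fun x h => d1 x (n x h))).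
- exact: (der0_eq _ _ s0' (fun x h => d2 x (n x h))).
Qed.

End Contour.

(** * The value of the contour integral *)

Section ContourValue.
Context {R : realType} {r m : R}.
Hypothesis r_le : `|r| <= 2^-1.
Implicit Types (t s k : R).

(** For k = cos s this is the real part of 1 / cosh (t + i s); as k tends to 0 it
    concentrates at t = 0 with total mass pi. *)
Definition bump k t : R := k * cosh t / (sinh t ^+ 2 + k ^+ 2).

Lemma bump_den_gt0 k t : 0 < k -> 0 < sinh t ^+ 2 + k ^+ 2.
Proof. by move=> k0; rewrite ltr_wpDl ?sqr_ge0// exprn_gt0. Qed.

Lemma bump_ge0 k t : 0 < k -> 0 <= bump k t.
Proof.
by move=> k0; rewrite divr_ge0 ?(ltW (bump_den_gt0 _ _ _))// mulr_ge0 ?ltW ?cosh_gt0.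
Qed.

Lemma bump_cont k : 0 < k -> continuous (bump k).
Proof.
move=> k0 t; apply: cvgM; first by apply: cvgM; [exact: cvg_cst|exact: cosh_cont].
apply: cvgV; first exact: lt0r_neq0 (bump_den_gt0 k t k0).
apply: cvgD; last exact: cvg_cst.
by apply: (@continuous_comp _ _ _ sinh (fun x => x ^+ 2)); [exact: sinh_cont|exact: exprn_continuous].
Qed.

Lemma bumpN k t : bump k (- t) = bump k t.
Proof. by rewrite /bump coshN sinhN sqrrN. Qed.

Lemma bump_le k t : 0 < k <= 1 -> bump k t <= k^-1 / cosh t.
Proof.
move=> /andP[k0 k1]; have D0 := bump_den_gt0 k t k0; have Ct := cosh_gt0 t.
have kC : 0 < k * cosh t by exact: mulr_gt0.
rewrite ler_pdivrMr// -invfM [leRHS]mulrC ler_pdivlMr//.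
have -> : k * cosh t * (k * cosh t) = k ^+ 2 * cosh t ^+ 2 by ring.
have -> : cosh t ^+ 2 = 1 + sinh t ^+ 2 by have := cosh2_sinh2 t; lra.
rewrite mulrDr mulr1 addrC lerD2r ler_piMl ?sqr_ge0//.
by rewrite expr_le1// ltW.
Qed.

Lemma sinh_cvgy : sinh t @[t --> +oo] --> (+oo%R : set_system R).
Proof.
apply/cvgryPge => A; near=> t; apply: (@le_trans _ _ t); last apply: sinh_ge.
  by near: t; apply: nbhs_pinfty_ge; exact: num_real.
by near: t; apply: nbhs_pinfty_ge; exact: num_real.
Unshelve. all: by end_near. Qed.

(** The primitive of the bump is atan (sinh t / k). *)
Lemma bump_mass k : 0 < k ->
  intble [set: R] (bump k) /\ \int_ [set: R] (bump k) = pi.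
Proof.
move=> k0; pose F t := atan (sinh t / k).
have dF t : has_der F t (bump k t).
  apply: has_der_eq.
    apply: (der_comp (f := atan) _ (derM (der_sinh (derX t)) (derC k^-1 t))).
    exact: is_derive1_atan.
  have D0 := lt0r_neq0 (bump_den_gt0 k t k0).
  rewrite /bump /=; field; rewrite D0 lt0r_neq0//=.
have FM t : `|F t| <= pi / 2.
  by rewrite ler_norml !ltW// ?atan_gtNpi2 ?atan_ltpi2.
have bi : intble [set: R] (bump k).
  apply: (integrable_bounded_primitive exhausts_setT (F := F) (pi / 2)) => t _ //.
  - exact: bump_ge0.
  - exact: bump_cont.
split=> //.
have kV : 0 < k^-1 by rewrite invr_gt0.
have Fy : F t @[t --> +oo] --> pi / 2.
  apply: (@cvg_comp _ _ _ (fun t => sinh t / k) atan _ (+oo%R : set_system R)); last exact: cvgy_atan.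
  by apply: gt0_cvgMly => //; exact: sinh_cvgy.
have FNy : F t @[t --> -oo] --> - (pi / 2).
  apply/cvgNy_compNP; rewrite /=.
  have -> : (fun x => F (- x)) = - F.
    by apply/funext => t; rewrite /F /= sinhN mulNr atanN.
  exact: cvgN Fy.
rewrite (FTC_line (- (pi / 2)) (pi / 2) bi dF (bump_cont k k0) FNy Fy); by field.
Qed.

Definition even_value : R := \int_ [set: R] (fun t => cos (m * t) * cosh (r * t) / cosh t).
Definition odd_value : R := \int_ [set: R] (fun t => sin (m * t) * sinh (r * t) / cosh t).

Lemma coshr_cont : continuous (fun t => cosh (r * t)).
Proof. by move=> t; have := der_cosh (derM (derC r t) (derX t)) => /der_cont; exact. Qed.

Lemma sinhr_cont : continuous (fun t => sinh (r * t)).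
Proof. by move=> t; have := der_sinh (derM (derC r t) (derX t)) => /der_cont; exact. Qed.

Lemma cosm_cont : continuous (fun t => cos (m * t)).
Proof. by move=> t; have := der_cos (derM (derC m t) (derX t)) => /der_cont; exact. Qed.

Lemma sinm_cont : continuous (fun t => sin (m * t)).
Proof. by move=> t; have := der_sin (derM (derC m t) (derX t)) => /der_cont; exact. Qed.

Lemma coshr_le t : cosh (r * t) <= cosh (t / 2).
Proof.
apply: cosh_abs_le; rewrite !normrM mulrC ler_wpM2l//.
by rewrite [`|2^-1|]ger0_norm.
Qed.

Lemma coshr_abs_le t : `|cosh (r * t)| <= cosh (t / 2).
Proof. by rewrite ger0_norm ?coshr_le// ltW// cosh_gt0. Qed.

Lemma sinhr_le t : `|sinh (r * t)| <= cosh (t / 2).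
Proof. exact: le_trans (sinh_abs_le _) (coshr_le t). Qed.

Lemma cos_abs_le1 x : `|cos x| <= 1 :> R.
Proof. by rewrite ler_norml cos_le1 cos_geN1. Qed.

Lemma sin_abs_le1 x : `|sin x| <= 1 :> R.
Proof. by rewrite ler_norml sin_le1 sin_geN1. Qed.

Section EvenWeight.
Context {w : R -> R} {M : R}.
Hypotheses (w_cont : continuous w) (wN : forall t, w (- t) = w t)
  (w_le : forall t, `|w t| <= M / cosh t).

Lemma weighted_int {f g : R -> R} : continuous f -> continuous g ->
  (forall t, `|f t| <= 1) -> (forall t, `|g t| <= cosh (t / 2)) ->
  intble [set: R] (fun t => f t * g t * w t).
Proof.
move=> cf cg f1 gle; have M0 : 0 <= M.
  by have := le_trans (normr_ge0 _) (w_le 0); rewrite cosh0 divr1.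
apply: (integrable_le_sech M).
  by apply: continuous_measurable_fun => t; apply: cvgM; [apply: cvgM; [exact: cf|exact: cg]|exact: w_cont].
move=> t; rewrite normrM.
apply: (@le_trans _ _ (cosh (t / 2) * (M / cosh t))).
  by apply: ler_pM => //; exact: le1_mul_le.
by rewrite mulrCA ler_wpM2l// half_over_cosh.
Qed.

(** Against an even weight only the even parts of exp (r t) cos (m t) and
    exp (r t) sin (m t) count. *)
Lemma exp_cos_even : \int_ [set: R] (fun t => expR (r * t) * cos (m * t) * w t) =
  \int_ [set: R] (fun t => cos (m * t) * cosh (r * t) * w t).
Proof.
have i1 := weighted_int cosm_cont coshr_cont (fun t => cos_abs_le1 _) coshr_abs_le.
have i2 := weighted_int cosm_cont sinhr_cont (fun t => cos_abs_le1 _) sinhr_le.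
have z : \int_ [set: R] (fun t => cos (m * t) * sinh (r * t) * w t) = 0.
  apply: Rintegral_odd => //.
    by move=> t; apply: cvgM; [apply: cvgM; [exact: cosm_cont|exact: sinhr_cont]|exact: w_cont].
  by move=> t; rewrite !mulrN cosN sinhN wN; ring.
rewrite -[RHS]addr0 -z -Rint_add//; apply: eq_Rintegral => t _.
by rewrite /cosh /sinh; field.
Qed.

Lemma exp_sin_even : \int_ [set: R] (fun t => expR (r * t) * sin (m * t) * w t) =
  \int_ [set: R] (fun t => sin (m * t) * sinh (r * t) * w t).
Proof.
have i1 := weighted_int sinm_cont coshr_cont (fun t => sin_abs_le1 _) coshr_abs_le.
have i2 := weighted_int sinm_cont sinhr_cont (fun t => sin_abs_le1 _) sinhr_le.
have z : \int_ [set: R] (fun t => sin (m * t) * cosh (r * t) * w t) = 0.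
  apply: Rintegral_odd => //.
    by move=> t; apply: cvgM; [apply: cvgM; [exact: sinm_cont|exact: coshr_cont]|exact: w_cont].
  by move=> t; rewrite !mulrN sinN coshN wN; ring.
rewrite -[RHS]addr0 -z -Rint_add//; apply: eq_Rintegral => t _.
by rewrite /cosh /sinh; field.
Qed.

End EvenWeight.

Lemma contour_integral0 :
  \int_ [set: R] (fun t => contour1 (r := r) (m := m) t 0) = even_value /\
  \int_ [set: R] (fun t => contour2 (r := r) (m := m) t 0) = odd_value.
Proof.
have cw : continuous (fun t : R => (cosh t)^-1).
  by move=> t; apply: cvgV; [exact: cosh_neq0|exact: cosh_cont].
have wN t : (cosh (- t))^-1 = (cosh t)^-1 :> R by rewrite coshN.
have wle t : `|(cosh t)^-1| <= 1 / cosh t :> R.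
  by rewrite mul1r ger0_norm// invr_ge0 ltW// cosh_gt0.
split.
  rewrite /even_value -(exp_cos_even cw wN wle); apply: eq_Rintegral => t _.
  rewrite /contour1 sin0 cos0 !mulr0 subr0 !addr0 mulr1 expr0n /= addr0.
  by have := cosh_neq0 t; move: (cosh t) => a a0; field.
rewrite /odd_value -(exp_sin_even cw wN wle); apply: eq_Rintegral => t _.
rewrite /contour2 sin0 cos0 !mulr0 !subr0 !addr0 mulr1 expr0n /= addr0.
by have := cosh_neq0 t; move: (cosh t) => a a0; field.
Qed.

(** With z = t + i s: 1 / cosh z + 1 / cosh (t - i s) = 2 bump (cos s) t, so an
    average of the integrands at heights s and - s, with weights removing the
    factors exp (i al s) and exp (- i al s), is exp (al t) times the bump. *)
Lemma contour_combine t s : 0 < cos s ->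
  expR (r * t) * cos (m * t) * bump (cos s) t =
    expR (m * s) / 2 * cos (r * s) * contour1 (r := r) (m := m) t s +
    expR (m * s) / 2 * sin (r * s) * contour2 (r := r) (m := m) t s +
    (expR (- (m * s)) / 2 * cos (r * s) * contour1 (r := r) (m := m) t (- s) +
     - (expR (- (m * s)) / 2 * sin (r * s)) * contour2 (r := r) (m := m) t (- s)) /\
  expR (r * t) * sin (m * t) * bump (cos s) t =
    expR (m * s) / 2 * cos (r * s) * contour2 (r := r) (m := m) t s +
    - (expR (m * s) / 2 * sin (r * s)) * contour1 (r := r) (m := m) t s +
    (expR (- (m * s)) / 2 * cos (r * s) * contour2 (r := r) (m := m) t (- s) +
     expR (- (m * s)) / 2 * sin (r * s) * contour1 (r := r) (m := m) t (- s)).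
Proof.
move=> c0; have N0 := lt0r_neq0 (contour_den_gt0 t s c0).
have NE := contour_denE t s.
rewrite /contour1 /contour2 /bump !mulrN cosN sinN opprK -NE.
have -> : expR (r * t - m * s) = expR (r * t) / expR (m * s) by rewrite expRD expRN.
rewrite expRN (expRD (r * t) (m * s)) cosD sinD cosB sinB.
have h := cos2Dsin2 (r * s); have e0 := lt0r_neq0 (expR_gt0 (m * s)).
move: (expR (m * s)) e0 => e e0; move: (expR (r * t)) (cos (m * t)) (sin (m * t)) => a x y.
move: (cos (r * s)) (sin (r * s)) h => p q h.
move: N0 {NE c0}; move: (cosh t) (sinh t) (cos s) (sin s) => A B C D N0.
have h1 (z w : R) : (p ^+ 2 + q ^+ 2) * z = w -> z = w by rewrite h mul1r.
have -> : (A * C) ^+ 2 + (B * - D) ^+ 2 = (A * C) ^+ 2 + (B * D) ^+ 2 by ring.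
by split; apply: h1; field; rewrite N0 e0.
Qed.

Lemma Rint_lin4 {f g h k : R -> R} (a b c d : R) :
  intble [set: R] f -> intble [set: R] g -> intble [set: R] h -> intble [set: R] k ->
  \int_ [set: R] (fun t => a * f t + b * g t + (c * h t + d * k t)) =
  a * \int_ [set: R] f + b * \int_ [set: R] g + (c * \int_ [set: R] h + d * \int_ [set: R] k).
Proof.
move=> fi gi hi ki; have mT : measurable [set: R] by exact: measurableT.
rewrite Rint_add//; [|by apply: intbleD => //; exact: intbleZ..].
by rewrite !Rint_add ?Rint_scale//; exact: intbleZ.
Qed.

(** The contour integrals at heights s and - s equal those at height 0, which are
    even_value and odd_value: averaging them expresses these against the bump. *)
Lemma contour_average s : 0 <= s < pi / 2 ->
  \int_ [set: R] (fun t => cos (m * t) * cosh (r * t) * bump (cos s) t) =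
    cos (r * s) * cosh (m * s) * even_value + sin (r * s) * sinh (m * s) * odd_value /\
  \int_ [set: R] (fun t => sin (m * t) * sinh (r * t) * bump (cos s) t) =
    cos (r * s) * cosh (m * s) * odd_value - sin (r * s) * sinh (m * s) * even_value.
Proof.
move=> hs; have /andP[s0 spi] := hs.
have sl : `|s| < pi / 2 by rewrite ger0_norm.
have slN : `|- s| < pi / 2 by rewrite normrN.
have c0 := strip_cos_gt0 s sl.
have [E1 E2 E3 E4] := contour_integral_const (m := m) r_le s hs.
have [X0 Y0] := contour_integral0; rewrite X0 in E1 E3; rewrite Y0 in E2 E4.
have [i1 i2] := contour_int (m := m) r_le s sl.
have [i3 i4] := contour_int (m := m) r_le (- s) slN.
have b1 : 0 < cos s <= 1 by rewrite c0 cos_le1.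
have ble t : `|bump (cos s) t| <= (cos s)^-1 / cosh t.
  by rewrite ger0_norm ?bump_ge0// bump_le.
split.
- rewrite -(exp_cos_even (bump_cont _ c0) (bumpN _) ble).
  under eq_Rintegral do rewrite (contour_combine _ s c0).1.
  by rewrite Rint_lin4// E1 E2 E3 E4 /cosh /sinh; field.
- rewrite -(exp_sin_even (bump_cont _ c0) (bumpN _) ble).
  under eq_Rintegral do rewrite (contour_combine _ s c0).2.
  by rewrite Rint_lin4// E1 E2 E3 E4 /cosh /sinh; field.
Qed.

(** A weight vanishing to second order at 0 cancels the peak of the bump there
    and leaves a quantity of order k. *)
Lemma bump_small {w : R -> R} {C : R} k : continuous w -> 0 < k -> 0 <= C ->
  (forall t, `|w t| * cosh t ^+ 2 <= C * (sinh t ^+ 2 * cosh (t / 2))) ->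
  intble [set: R] (fun t => w t * bump k t) /\
  `|\int_ [set: R] (fun t => w t * bump k t)| <= k * (C * @sech4_mass R).
Proof.
move=> cw k0 C0 wC.
have b t : `|w t * bump k t| <= k * C / cosh (t / 4).
  have Ct := cosh_gt0 t; have D0 := bump_den_gt0 k t k0.
  apply: (@le_trans _ _ (k * C * (cosh (t / 2) / cosh t))); last first.
    by rewrite ler_wpM2l ?half_over_cosh// mulr_ge0// ltW.
  rewrite normrM (ger0_norm (bump_ge0 k t k0)) /bump.
  have -> : `|w t| * (k * cosh t / (sinh t ^+ 2 + k ^+ 2)) =
     k * (`|w t| * cosh t ^+ 2) / (cosh t * (sinh t ^+ 2 + k ^+ 2)).
    by move: (cosh t) Ct (sinh t) D0 => a a0 d d0; field; rewrite !lt0r_neq0.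
  have -> : k * C * (cosh (t / 2) / cosh t) =
     k * (C * ((sinh t ^+ 2 + k ^+ 2) * cosh (t / 2))) / (cosh t * (sinh t ^+ 2 + k ^+ 2)).
    by move: (cosh t) (cosh (t / 2)) Ct (sinh t) D0 => a b a0 d d0; field; rewrite !lt0r_neq0.
  rewrite ler_wpM2r ?invr_ge0 ?mulr_ge0 ?(ltW Ct) ?(ltW D0)//.
  rewrite ler_wpM2l ?(ltW k0)//; apply: le_trans (wC t) _.
  by rewrite ler_wpM2l// ler_wpM2r ?(ltW (cosh_gt0 _))// lerDl sqr_ge0.
have wi : intble [set: R] (fun t => w t * bump k t).
  apply: (integrable_le_sech (k * C)) => //.
  by apply: continuous_measurable_fun => t; apply: cvgM; [exact: cw|exact: bump_cont].
split=> //; have -> : k * (C * @sech4_mass R) = k * C * @sech4_mass R by ring.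
rewrite -(Rint_scale (k * C) measurableT (@integrable_sech4 R)).
apply: norm_Rintegral_le => //; by apply: intbleZ => //; exact: integrable_sech4.
Qed.

Let C : R := m ^+ 2 / 2 + `|m| + 3.

(** Combines a bound that is good near t = 0 with one that is good far away. *)
Lemma small_cosh2 (d M h : R) t : 0 <= d -> 1 <= h -> d <= M * (sinh t ^+ 2 * h) -> d <= 2 * h ->
  d * cosh t ^+ 2 <= (M + 2) * (sinh t ^+ 2 * h).
Proof.
move=> d0 h1 dM d2; have -> : cosh t ^+ 2 = 1 + sinh t ^+ 2 by have := cosh2_sinh2 t; lra.
have : d * sinh t ^+ 2 <= 2 * h * sinh t ^+ 2 by rewrite ler_wpM2r ?sqr_ge0.
by lra.
Qed.

Lemma cos_cosh_near1 t : `|cos (m * t) * cosh (r * t) - 1| * cosh t ^+ 2 <=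
  C * (sinh t ^+ 2 * cosh (t / 2)).
Proof.
have h1 := cosh_ge1 (t / 2); have hr := coshr_le t; have hr1 := cosh_ge1 (r * t).
have S0 := sqr_ge0 (sinh t); have m0 := sqr_ge0 m; have am := normr_ge0 m.
have E : cos (m * t) * cosh (r * t) - 1 = (cos (m * t) - 1) * cosh (r * t) + (cosh (r * t) - 1) by ring.
apply: (@le_trans _ _ ((m ^+ 2 / 2 + 1 + 2) * (sinh t ^+ 2 * cosh (t / 2)))); last first.
  apply: ler_wpM2r; last by rewrite /C; lra.
  by rewrite mulr_ge0// (le_trans ler01).
apply: small_cosh2 => //.
- rewrite E; apply: le_trans (ler_normD _ _) _.
  have a1 : `|(cos (m * t) - 1) * cosh (r * t)| <= (m ^+ 2 / 2 * sinh t ^+ 2) * cosh (t / 2).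
    rewrite normrM; apply: ler_pM => //; last by rewrite ger0_norm// ltW// cosh_gt0.
    apply: le_trans (one_sub_cos_le _) _; rewrite exprMn.
    have := sqr_sinh_ge t; rewrite mulrAC => h; rewrite ler_wpM2l// divr_ge0//.
  have a2 : `|cosh (r * t) - 1| <= sinh t ^+ 2 * cosh (t / 2).
    rewrite ger0_norm ?subr_ge0//; apply: (@le_trans _ _ (sinh t ^+ 2)); last by rewrite ler_peMr.
    have c2 : cosh t ^+ 2 = 1 + sinh t ^+ 2 by have := cosh2_sinh2 t; lra.
    have c3 : cosh t <= cosh t ^+ 2 by rewrite expr2 ler_peMl ?cosh_ge1// ltW// cosh_gt0.
    by have := cosh_half_le t; lra.
  by lra.
- apply: le_trans (ler_normB _ _) _; rewrite normr1.
  have : `|cos (m * t) * cosh (r * t)| <= cosh (t / 2).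
    apply: (le1_mul_le (f := fun t => cos (m * t)) (g := fun t => cosh (r * t))).
      exact: cos_abs_le1.
    by rewrite ger0_norm// ltW// cosh_gt0.
  by lra.
Qed.

Lemma sin_sinh_small t : `|sin (m * t) * sinh (r * t)| * cosh t ^+ 2 <=
  C * (sinh t ^+ 2 * cosh (t / 2)).
Proof.
have h1 := cosh_ge1 (t / 2).
have S0 := sqr_ge0 (sinh t); have m0 := sqr_ge0 m; have am := normr_ge0 m.
apply: (@le_trans _ _ ((`|m| + 2) * (sinh t ^+ 2 * cosh (t / 2)))); last first.
  apply: ler_wpM2r; last by rewrite /C; lra.
  by rewrite mulr_ge0// (le_trans ler01).
apply: small_cosh2 => //.
- have a1 : `|sin (m * t)| <= `|m| * `|sinh t|.
    apply: le_trans (sin_abs_le _) _; rewrite normrM ler_wpM2l//.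
    by rewrite -ler_sqr ?nnegrE// !real_normK ?num_real// sqr_sinh_ge.
  have a2 : `|sinh (r * t)| <= `|sinh t|.
    rewrite -ler_sqr ?nnegrE// !real_normK ?num_real//.
    have rt : cosh (r * t) <= cosh t by apply: le_trans (coshr_le t) (cosh_half_le t).
    have : cosh (r * t) ^+ 2 <= cosh t ^+ 2 by rewrite lerXn2r ?nnegrE// ltW// cosh_gt0.
    by have := cosh2_sinh2 t; have := cosh2_sinh2 (r * t); lra.
  rewrite normrM; apply: (@le_trans _ _ (`|m| * `|sinh t| * `|sinh t|)).
    by apply: ler_pM.
  rewrite -mulrA -expr2 real_normK ?num_real// ler_wpM2l// ler_peMr//.
- apply: (@le_trans _ _ (cosh (t / 2))); last by lra.
  apply: (le1_mul_le (f := fun t => sin (m * t)) (g := fun t => sinh (r * t))).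
    exact: sin_abs_le1.
  exact: sinhr_le.
Qed.

(** Replacing cos (m t) cosh (r t) by its value 1 at t = 0 leaves the mass of the
    bump, pi, up to a multiple of cos s. *)
Lemma contour_near s : 0 <= s < pi / 2 ->
  `|cos (r * s) * cosh (m * s) * even_value + sin (r * s) * sinh (m * s) * odd_value - pi|
     <= cos s * (C * @sech4_mass R) /\
  `|cos (r * s) * cosh (m * s) * odd_value - sin (r * s) * sinh (m * s) * even_value|
     <= cos s * (C * @sech4_mass R).
Proof.
move=> hs; have [A1 A2] := contour_average s hs; have /andP[s0 spi] := hs.
have sl : `|s| < pi / 2 by rewrite ger0_norm.
have k0 := strip_cos_gt0 s sl.
have C0 : 0 <= C by rewrite /C !addr_ge0// divr_ge0// sqr_ge0.
have cf : continuous (fun t => cos (m * t) * cosh (r * t) - 1).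
  by move=> t; apply: cvgB; [apply: cvgM; [exact: cosm_cont|exact: coshr_cont]|exact: cvg_cst].
have cg : continuous (fun t => sin (m * t) * sinh (r * t)).
  by move=> t; apply: cvgM; [exact: sinm_cont|exact: sinhr_cont].
have [i1 l1] := bump_small (cos s) cf k0 C0 cos_cosh_near1.
have [i2 l2] := bump_small (cos s) cg k0 C0 sin_sinh_small.
split; last by rewrite -A2.
have [bi bI] := bump_mass (cos s) k0.
rewrite -A1; apply: le_trans l1; rewrite le_eqVlt; apply/orP; left; apply/eqP; congr (`|_|).
have -> : (fun t => cos (m * t) * cosh (r * t) * bump (cos s) t) =
   (fun t => (cos (m * t) * cosh (r * t) - 1) * bump (cos s) t + bump (cos s) t).
  by apply/funext => t; ring.
by rewrite Rint_add// bI addrK.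
Qed.

Lemma ge0_at_left_end {f : R -> R} (b : R) : 0 < b -> {for b, continuous f} ->
  (forall x, 0 <= x < b -> 0 <= f x) -> 0 <= f b.
Proof.
move=> b0 cf f0; have cb : f x @[x --> b^'-] --> f b by apply: cvg_within_filter; exact: cf.
apply: (cvgr_to_ge cb).
near=> x; apply: f0; apply/andP; split.
  by near: x; exact: nbhs_left_ge.
by near: x; exact: nbhs_left_lt.
Unshelve. all: by end_near. Qed.

Lemma le0_at_right_angle {f : R -> R} (K : R) : continuous f ->
  (forall s, 0 <= s < pi / 2 -> `|f s| <= cos s * K) -> f (pi / 2) = 0.
Proof.
move=> cf fK; have pi2 : 0 < pi / 2 :> R by rewrite divr_gt0// pi_gt0.
pose g s := cos s * K - `|f s|.
have : 0 <= g (pi / 2).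
  apply: ge0_at_left_end => //.
    apply: cvgB; first by apply: cvgM; [exact: continuous_cos|exact: cvg_cst].
    by apply: (@continuous_comp _ _ _ f (fun z => `|z|)); [exact: cf|exact: norm_continuous].
  by move=> s /fK; rewrite subr_ge0.
by rewrite /g cos_pihalf mul0r sub0r oppr_ge0 normr_le0 => /eqP.
Qed.

(** (even_value + i odd_value) cos (pi (r + i m) / 2) = pi, in real coordinates. *)
Lemma contour_value :
  let A := cos (r * (pi / 2)) * cosh (m * (pi / 2)) in
  let B := sin (r * (pi / 2)) * sinh (m * (pi / 2)) in
  A * even_value + B * odd_value = pi /\ A * odd_value - B * even_value = 0.
Proof.
have near := contour_near.
have cA : continuous (fun s => cos (r * s) * cosh (m * s)).
  move=> s; have := derM (der_cos (derM (derC r s) (derX s))) (der_cosh (derM (derC m s) (derX s))).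
  by move/der_cont; exact.
have cB : continuous (fun s => sin (r * s) * sinh (m * s)).
  move=> s; have := derM (der_sin (derM (derC r s) (derX s))) (der_sinh (derM (derC m s) (derX s))).
  by move/der_cont; exact.
split.
- apply/eqP; rewrite -subr_eq0; apply/eqP.
  apply: (le0_at_right_angle (f := fun s => cos (r * s) * cosh (m * s) * even_value +
    sin (r * s) * sinh (m * s) * odd_value - pi) (C * @sech4_mass R)).
    move=> s; apply: cvgB; last exact: cvg_cst.
    by apply: cvgD; apply: cvgM; [exact: cA|exact: cvg_cst|exact: cB|exact: cvg_cst].
  by move=> s /near[].
- apply: (le0_at_right_angle (f := fun s => cos (r * s) * cosh (m * s) * odd_value -
    sin (r * s) * sinh (m * s) * even_value) (C * @sech4_mass R)).
    move=> s.
    by apply: cvgB; apply: cvgM; [exact: cA|exact: cvg_cst|exact: cB|exact: cvg_cst].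
  by move=> s /near[].
Qed.

(** The squared modulus of contour_value, since
    |cos (pi (r + i m) / 2)|^2 = (cos (pi r) + cosh (pi m)) / 2. *)
Lemma contour_norm :
  (even_value ^+ 2 + odd_value ^+ 2) * (cos (pi * r) + cosh (pi * m)) = 2 * pi ^+ 2.
Proof.
have [e1 e2] := contour_value; rewrite /= in e1 e2.
have -> : pi * m = 2 * (m * (pi / 2)) by field.
have -> : pi * r = r * (pi / 2) + r * (pi / 2) by field.
rewrite cosh_dup cosD; have := cosh2_sinh2 (m * (pi / 2)); have := cos2Dsin2 (r * (pi / 2)).
move: e1 e2; move: (cos _) (sin _) (cosh _) (sinh _) even_value odd_value => c s C1 S X Y e1 e2 h1 h2.
have h3 : c ^+ 2 = 1 - s ^+ 2 by lra.
have h4 : S ^+ 2 = C1 ^+ 2 - 1 by lra.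
have -> : c * c - s * s + (2 * C1 ^+ 2 - 1) = 2 * ((c * C1) ^+ 2 + (s * S) ^+ 2).
  by rewrite !exprMn h4 h3 -!expr2 h3; ring.
have -> : (X ^+ 2 + Y ^+ 2) * (2 * ((c * C1) ^+ 2 + (s * S) ^+ 2)) =
  2 * ((c * C1 * X + s * S * Y) ^+ 2 + (c * C1 * Y - s * S * X) ^+ 2) by ring.
by rewrite e1 e2 expr0n addr0.
Qed.

End ContourValue.

Section MacIntegral.
Context {R : realType} {m : R}.

Let mcos (s : R) t := cos (s * t) : R.
Let msin (s : R) t := sin (s * t) : R.
Let mcosh (r : R) t := cosh (r * t) : R.
Let msinh (r : R) t := sinh (r * t) : R.

Lemma cos_le1_mode t : `|mcos m t| <= 1. Proof. exact: cos_abs_le1. Qed.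

(** The integrals even_part and odd_part are the real and imaginary part of the
    contour integral, and the sum of their squares is its squared modulus. *)
Lemma mac_integral_real (r : R) : 0 <= r <= 2^-1 ->
  \int_ D0 (fun v => mac (c := mcosh r) v * mac (c := mcos m) v) =
  pi ^+ 2 / (cos (pi * r) + cosh (pi * m)).
Proof.
move=> r01; have /andP[r0 r2] := r01.
have rle : `|r| <= 2^-1 by rewrite ger0_norm.
rewrite (mac_product_integral (mode_cosh r r01) (mode_cos m) cos_le1_mode).
rewrite (cosh_sum_integral (b := msin m) (d := msinh r) (e := 1)).
- have h := contour_norm (m := m) rle.
  have D0 : 0 < cos (pi * r) + cosh (pi * m).
    rewrite ltr_wpDl ?cosh_gt0// cos_ge0_pihalf//; have := @pi_gt0 R => p0; apply/andP; split; nra.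
  have -> : even_part (a := mcos m) (c := mcosh r) = even_value (r := r) (m := m) by [].
  have -> : odd_part (b := msin m) (d := msinh r) = odd_value (r := r) (m := m) by [].
  rewrite mul1r; apply: (mulIf (lt0r_neq0 D0)); rewrite -mulrA h divfK ?lt0r_neq0//.
  by field.
- exact: cosm_cont.
- exact: sinm_cont.
- exact: coshr_cont.
- exact: sinhr_cont.
- exact: cos_le1_mode.
- by move=> x; exact: sin_abs_le1.
- exact: (coshr_abs_le rle).
- by move=> x; exact: sinhr_le.
- by move=> x; rewrite /mcos mulrN cosN.
- by move=> x; rewrite /msin mulrN sinN.
- by move=> x; rewrite /mcosh mulrN coshN.
- by move=> x; rewrite /msinh mulrN sinhN.
- by move=> x y; rewrite /mcos /msin mulrBr cosB.
- by move=> x y; rewrite /mcosh /msinh mulrDr coshD mul1r.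
Qed.

(** The case r = 0 of the contour integral. *)
Lemma cos_over_cosh (s : R) : \int_ [set: R] (fun t => cos (s * t) / cosh t) =
  pi / cosh (s * (pi / 2)).
Proof.
have r0 : `|0 : R| <= 2^-1 by rewrite normr0.
have [e _] := contour_value (m := s) r0; rewrite /= !mul0r cos0 sin0 mul0r mul0r addr0 mul1r in e.
have E : even_value (r := 0) (m := s) = \int_ [set: R] (fun t => cos (s * t) / cosh t).
  by apply: eq_Rintegral => t _; rewrite mul0r cosh0 mulr1.
rewrite -E; apply: (mulfI (cosh_neq0 (s * (pi / 2)))); rewrite e.
by field; exact: cosh_neq0.
Qed.

(** The difference of the squares of even_part and odd_part factors, and their sum
    and difference are the integrals of cos ((m - s) x) / cosh x and
    cos ((m + s) x) / cosh x. *)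
Lemma mac_integral_imag (s : R) :
  \int_ D0 (fun v => mac (c := mcos s) v * mac (c := mcos m) v) =
  pi ^+ 2 / (cosh (pi * s) + cosh (pi * m)).
Proof.
rewrite (mac_product_integral (mode_cos s) (mode_cos m) cos_le1_mode).
have hle (z : R) x : `|z| <= 1 -> `|z| <= cosh (x / 2) by move=> /le_trans; apply; exact: cosh_ge1.
rewrite (cosh_sum_integral (b := msin m) (d := msin s) (e := -1)).
- have i1 : intble [set: R] (fun x => mcos m x * mcos s x / cosh x).
    apply: over_cosh_int => x; first by apply: cvgM; exact: cosm_cont.
    by apply: le1_mul_le; [exact: cos_abs_le1|apply: hle; exact: cos_abs_le1].
  have i2 : intble [set: R] (fun x => msin m x * msin s x / cosh x).
    apply: over_cosh_int => x; first by apply: cvgM; exact: sinm_cont.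
    by apply: le1_mul_le; [exact: sin_abs_le1|apply: hle; exact: sin_abs_le1].
  have P : even_part (a := mcos m) (c := mcos s) + odd_part (b := msin m) (d := msin s) =
      pi / cosh ((m - s) * (pi / 2)).
    rewrite -cos_over_cosh /even_part /odd_part -Rint_add//; apply: eq_Rintegral => x _.
    by rewrite mulrBl cosB /mcos /msin mulrDl.
  have Mn : even_part (a := mcos m) (c := mcos s) - odd_part (b := msin m) (d := msin s) =
      pi / cosh ((m + s) * (pi / 2)).
    rewrite -cos_over_cosh /even_part /odd_part -Rint_sub//; apply: eq_Rintegral => x _.
    by rewrite mulrDl cosD /mcos /msin mulrBl.
  move: P Mn; set X := even_part; set Y := odd_part => P Mn.
  have -> : X ^+ 2 + -1 * Y ^+ 2 = (X + Y) * (X - Y) by ring.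
  rewrite P Mn.
  have -> : cosh (pi * s) + cosh (pi * m) =
     2 * (cosh ((m - s) * (pi / 2)) * cosh ((m + s) * (pi / 2))).
    have -> : pi * s = (m + s) * (pi / 2) - (m - s) * (pi / 2) by field.
    have -> : pi * m = (m + s) * (pi / 2) + (m - s) * (pi / 2) by field.
    by rewrite !coshD coshN sinhN; ring.
  have := cosh_neq0 ((m - s) * (pi / 2)); have := cosh_neq0 ((m + s) * (pi / 2)).
  by move: (cosh _) (cosh _) => a b a0 b0; field; rewrite a0 b0.
- exact: cosm_cont.
- exact: sinm_cont.
- exact: cosm_cont.
- exact: sinm_cont.
- exact: cos_le1_mode.
- by move=> x; exact: sin_abs_le1.
- by move=> x; apply: hle; exact: cos_abs_le1.
- by move=> x; apply: hle; exact: sin_abs_le1.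
- by move=> x; rewrite /mcos mulrN cosN.
- by move=> x; rewrite /msin mulrN sinN.
- by move=> x; rewrite /mcos mulrN cosN.
- by move=> x; rewrite /msin mulrN sinN.
- by move=> x y; rewrite /mcos /msin mulrBr cosB.
- by move=> x y; rewrite /mcos /msin mulrDr cosD mulN1r.
Qed.

End MacIntegral.

(** * Complex-valued functions on the half-line *)

Local Open Scope complex_scope.

Section RealLift.
Context {R : realType}.
Implicit Types (f : R -> R[i]) (x u : R).

Lemma near_pos u : 0 < u -> \forall y \near u, 0 < y.
Proof. by move=> u0; exact: lt_nbhsr. Qed.

Lemma der_derivable {F : R -> R} {x a : R} : has_der F x a -> derivable F x 1 /\ derive1 F x = a.
Proof. by case=> dF <-; split=> //; rewrite derive1E. Qed.

Lemma real_lift1 {f} {F F1 : R -> R} : (forall u, 0 < u -> f u = (F u)%:C) ->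
  (forall u, 0 < u -> has_der F u (F1 u)) ->
  forall u, 0 < u -> cderivable f u /\ cderive f u = (F1 u)%:C.
Proof.
move=> fF dF u u0.
have dR : has_der (fun y => complex.Re (f y)) u (F1 u).
  apply: der_near (dF u u0); near=> y; rewrite fF//; near: y; exact: near_pos.
have dI : has_der (fun y => complex.Im (f y)) u 0.
  apply: der_near (derC 0 u); near=> y; rewrite fF//; near: y; exact: near_pos.
have [a1 b1] := der_derivable dR; have [a2 b2] := der_derivable dI.
by split; [split|rewrite /cderive b1 b2].
Unshelve. all: by end_near. Qed.

(** On a function that is real on the half-line the complex differential
    operator is the real one, applied to the product-rule expansion. *)
Lemma real_lift {f} {F F1 F2 : R -> R} : (forall u, 0 < u -> f u = (F u)%:C) ->
  (forall u, 0 < u -> has_der F u (F1 u)) -> (forall u, 0 < u -> has_der F1 u (F2 u)) ->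
  [/\ ctwice_derivable_on D0 f,
      (forall u, 0 < u -> cderive (cderive f) u = (F2 u)%:C) &
      (forall u, 0 < u -> macdonald_diffop f u =
        (- (u ^+ 2 * F2 u + 2 * u * F1 u) + u ^+ 2 / 4 * F u)%:C)].
Proof.
move=> fF dF dF1; have l1 := real_lift1 fF dF.
have l1' u : 0 < u -> cderive f u = (F1 u)%:C by move=> u0; exact: (l1 u u0).2.
have l2 := real_lift1 l1' dF1.
split=> u.
- by move=> /inD0 u0; split; [exact: (l1 u u0).1|exact: (l2 u u0).1].
- by move=> u0; exact: (l2 u u0).2.
move=> u0; rewrite /macdonald_diffop.
have dG x : 0 < x -> has_der (fun x => x ^+ 2 * F1 x) x (2 * x * F1 x + x ^+ 2 * F2 x).
  by move=> x0; exact: (derM (derX2 x) (dF1 x x0)).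
have gE x : 0 < x -> (x ^+ 2)%:C * cderive f x = (x ^+ 2 * F1 x)%:C.
  by move=> x0; rewrite (l1 x x0).2 [RHS]rmorphM.
rewrite (real_lift1 gE dG u u0).2 fF// -rmorphM -rmorphN -rmorphD.
by congr (_%:C); ring.
Qed.

Lemma cintegrable_real {D} {f : R -> R[i]} {F : R -> R} : measurable D ->
  (forall x, D x -> f x = (F x)%:C) -> intble D F -> cintegrable D f.
Proof.
move=> mD fF iF; split.
  apply: eq_integrable iF => //.
  by move=> x; rewrite inE => Dx; rewrite /= fF.
have i0 : intble D (fun=> 0 : R) by exact: integrable0.
apply: eq_integrable i0 => //.
by move=> x; rewrite inE => Dx; rewrite /= fF.
Qed.

Lemma cintegral_real {D} {f : R -> R[i]} {F : R -> R} : measurable D ->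
  (forall x, D x -> f x = (F x)%:C) -> cintegral D f = (\int_ D F)%:C.
Proof.
move=> mD fF; rewrite /cintegral -complexr0; congr (_ +i* _).
  by apply: eq_Rintegral => x; rewrite inE => Dx; rewrite fF.
transitivity (\int_ D (fun=> 0 : R)); last by rewrite Rintegral_cst// mul0r.
by apply: eq_Rintegral => x; rewrite inE => Dx; rewrite fF.
Qed.

(** The embedding of the real line and the real and imaginary parts are continuous
    for the topology that the norm of the complex numbers defines. *)
Lemma cvg_realC {T : Type} {E : set_system T} {FE : Filter E} {g : T -> R} {l : R} :
  g x @[x --> E] --> l -> ((g x)%:C : R[i]^o) @[x --> E] --> (l%:C : R[i]^o).
Proof.
move=> gl; apply/cvgrPdist_lt => e e0.
have [er eR] : 0 < complex.Re e /\ e = (complex.Re e)%:C.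
  case: e e0 => a b; rewrite ltcE /= => /andP[/eqP b0 a0]; split=> //.
  by rewrite b0.
move/cvgrPdist_lt : gl => /(_ _ er); apply: filterS => x h.
by rewrite -rmorphB normc_def /= expr0n addr0 sqrtr_sqr eR ltcR.
Qed.

Lemma cvg_Re {T : Type} {E : set_system T} {FE : Filter E} {g : T -> R[i]^o} {l : R[i]^o} :
  g x @[x --> E] --> l -> complex.Re (g x) @[x --> E] --> complex.Re l.
Proof.
move=> gl; apply/cvgrPdist_lt => e e0.
have eC : (0 : R[i]^o) < e%:C by rewrite ltcR.
move/cvgrPdist_lt : gl => /(_ _ eC); apply: filterS => x h.
rewrite -ltcR; apply: le_lt_trans h.
have := normc_ge_Re (l - g x); congr (_ <= _); congr (`|_|%:C).
by case: (l : R[i]) (g x : R[i]) => a b [c d].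
Qed.

Lemma cvg_Im {T : Type} {E : set_system T} {FE : Filter E} {g : T -> R[i]^o} {l : R[i]^o} :
  g x @[x --> E] --> l -> complex.Im (g x) @[x --> E] --> complex.Im l.
Proof.
move=> gl; apply/cvgrPdist_lt => e e0.
have eC : (0 : R[i]^o) < e%:C by rewrite ltcR.
move/cvgrPdist_lt : gl => /(_ _ eC); apply: filterS => x h.
rewrite -ltcR; apply: le_lt_trans h.
case: (l : R[i]) (g x : R[i]) => a b [c d] /=; rewrite normc_def lecR /=.
rewrite -sqrtr_sqr ler_sqrt ?addr_ge0 ?sqr_ge0//.
by rewrite lerDr sqr_ge0.
Qed.

Lemma cexpE (x y : R) : cexp (x +i* y) = (expR x * cos y) +i* (expR x * sin y).
Proof. by rewrite /cexp /=; simpc. Qed.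

Lemma ccoshE (x y : R) : ccosh (x +i* y) = (cosh x * cos y) +i* (sinh x * sin y).
Proof.
have e : - (x +i* y) = (- x) +i* (- y) by [].
have two : (2 : R[i])^-1 = (2^-1)%:C by rewrite fmorphV rmorph_nat.
rewrite /ccosh e !cexpE two cosN sinN; simpc.
by rewrite /cosh /sinh; congr (_ +i* _); field.
Qed.

(** Reduction to nonnegative functions by writing f = (|f| + f) - |f|. *)
Lemma halfline_even {f : R -> R} : continuous f -> intble [set: R] f ->
  (forall x, f (- x) = f x) -> \int_ `[0%R, +oo[ f = 2^-1 * \int_ [set: R] f.
Proof.
move=> cf fi fN.
have mH : measurable [set` `[0%R, +oo[ : interval R] by exact: measurable_itv.
have HE : [set x : R | 0 <= x] = [set` `[0%R, +oo[].
  by apply/seteqP; split => x /=; rewrite in_itv/= andbT.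
have pos (g : R -> R) : continuous g -> intble [set: R] g -> (forall x, 0 <= g x) ->
    (forall x, g (- x) = g x) -> \int_ `[0%R, +oo[ g = 2^-1 * \int_ [set: R] g.
  move=> cg gi g0 gN; rewrite /Rintegral.
  have -> : (\int[lebesgue_measure]_x (g x)%:E =
     2%:E * \int[lebesgue_measure]_(x in `[0%R, +oo[) (g x)%:E)%E.
    by rewrite ge0_symfun_integralT ?HE// => x; rewrite /= gN.
  have gH : lebesgue_measure.-integrable [set` `[0%R, +oo[ : interval R] (EFin \o g).
    by apply: integrableS gi.
  rewrite fineM//; first by rewrite mulrA mulVf ?mul1r.
  exact: integrable_fin_num gH.
have cn : continuous (fun x => `|f x|).
  by move=> x; apply: (@continuous_comp _ _ _ f (fun z => `|z|)); [exact: cf|exact: norm_continuous].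
have ni : intble [set: R] (fun x => `|f x|) by exact: integrable_norm fi.
have iH (g : R -> R) : intble [set: R] g -> intble [set` `[0%R, +oo[ : interval R] g.
  by move=> gi; apply: integrableS gi.
have e1 := pos _ cn ni (fun x => normr_ge0 _) (fun x => congr1 Num.norm (fN x)).
have si : intble [set: R] (fun x => `|f x| + f x) by apply: intbleD.
have cs : continuous (fun x => `|f x| + f x).
  by move=> x; apply: cvgD; [exact: cn|exact: cf].
have s0 x : 0 <= `|f x| + f x by have := ler_norm (- f x); rewrite normrN; lra.
have e2 := pos _ cs si s0 (fun x => _).
have {}e2 := e2 ltac:(move=> x; by rewrite fN).
move: e2; rewrite (Rint_add mH (iH _ ni) (iH _ fi)) (Rint_add measurableT ni fi) e1 mulrDr.
by move/addrI.
Qed.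

End RealLift.

(** * The Macdonald function and its kernel *)

Section MacdonaldFunction.
Context {R : realType}.
Implicit Types (x y t u r s : R).

Lemma macdonald_bound x y t : `|x| <= 2 ->
  `|cosh (x * t) * cos (y * t)| <= 2 * cosh t ^+ 3 /\
  `|sinh (x * t) * sin (y * t)| <= 2 * cosh t ^+ 3.
Proof.
move=> x2; have h : cosh (x * t) <= 2 * cosh t ^+ 3.
  apply: (@le_trans _ _ (cosh (2 * t))).
    by apply: cosh_abs_le; rewrite !normrM [`|2|]ger0_norm// ler_wpM2r.
  rewrite cosh_dup; have : cosh t ^+ 2 <= cosh t ^+ 3 by exact: (cosh_powS_le 2 3).
  by lra.
have c0 := ltW (cosh_gt0 (x * t)).
split; rewrite normrM; apply: le_trans h; rewrite -[leRHS]mulr1; apply: ler_pM => //.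
- by rewrite ger0_norm.
- exact: cos_abs_le1.
- exact: sinh_abs_le.
- exact: sin_abs_le1.
Qed.

Lemma ccosh_mul x y t : ccosh ((x +i* y) * t%:C) =
  (cosh (x * t) * cos (y * t)) +i* (sinh (x * t) * sin (y * t)).
Proof. by rewrite -ccoshE; congr ccosh; simpc. Qed.

(** The bound 2 leaves room for the order nu + 1 in the kernel. *)
Lemma macdonaldK_lap x y u : `|x| <= 2 -> 0 < u ->
  macdonaldK (x +i* y) (u / 2) =
  lap (fun t => cosh (x * t) * cos (y * t)) u +i*
  lap (fun t => sinh (x * t) * sin (y * t)) u.
Proof.
move=> x2 u0.
have dx t := derM (derC x t) (derX t); have dy t := derM (derC y t) (derX t).
have c1 : continuous (fun t => cosh (x * t) * cos (y * t)).
  by move=> t; have := derM (der_cosh (dx t)) (der_cos (dy t)) => /der_cont; exact.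
have c2 : continuous (fun t => sinh (x * t) * sin (y * t)).
  by move=> t; have := derM (der_sinh (dx t)) (der_sin (dy t)) => /der_cont; exact.
have i1 := lap_integrable u c1 (fun t => (macdonald_bound x y t x2).1) u0.
have i2 := lap_integrable u c2 (fun t => (macdonald_bound x y t x2).2) u0.
rewrite /macdonaldK /cintegral /lap; congr (_ +i* _).
- rewrite -(halfline_even (kernM_cont u c1) i1); last first.
    by move=> t; rewrite /kern coshN !mulrN coshN cosN.
  by apply: eq_Rintegral => t _; rewrite ccosh_mul /=; simpc.
- rewrite -(halfline_even (kernM_cont u c2) i2); last first.
    by move=> t; rewrite /kern coshN !mulrN sinhN sinN mulrNN.
  by apply: eq_Rintegral => t _; rewrite ccosh_mul /=; simpc.
Qed.

(** Integration by parts: the source of the recurrence for K_(nu + 1), whose mode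
    cosh ((nu + 1) t) splits as cosh t cosh (nu t) + sinh t sinh (nu t). *)
Lemma lap_sinh {a c : R -> R} {L : R} u : continuous c -> (forall t, has_der a t (L * c t)) ->
  (forall t, `|c t| <= cosh (t / 2)) -> (forall t, `|a t| <= cosh (t / 2)) -> 0 < u ->
  lap (fun t => sinh t * a t) u = 2 * L / u * lap c u.
Proof.
move=> cc da c_le a_le u0.
have u20 : 0 <= u / 2 by rewrite divr_ge0// ltW.
have ca : continuous a by move=> t; exact: der_cont (da t).
have le3 (f : R -> R) t : `|f t| <= cosh (t / 2) -> `|f t| <= 1 * cosh t ^+ 3.
  move=> h; apply: le_trans h _; rewrite mul1r; apply: le_trans (cosh_half_le t) _.
  exact: (cosh_powS_le 1 3).
have s3 t : `|sinh t * a t| <= 1 * cosh t ^+ 3.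
  rewrite normrM mul1r (exprS _ 2); apply: ler_pM => //; first exact: sinh_abs_le.
  by apply: le_trans (a_le t) _; apply: le_trans (cosh_half_le t) _; exact: (cosh_powS_le 1 2).
have cs : continuous (fun t => sinh t * a t).
  by move=> t; apply: cvgM; [exact: sinh_cont|exact: ca].
have cL : continuous (fun t => L * c t) by move=> t; apply: cvgM; [exact: cvg_cst|exact: cc].
have bL t : `|L * c t| <= `|L| * cosh t ^+ 3.
  by rewrite normrM ler_wpM2l//; have := le3 c t (c_le t); rewrite mul1r.
have bS t : `|- (u / 2) * (sinh t * a t)| <= u / 2 * cosh t ^+ 3.
  rewrite normrM normrN (ger0_norm u20) ler_wpM2l//.
  by have := s3 t; rewrite mul1r.
have cS : continuous (fun t => - (u / 2) * (sinh t * a t)).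
  by move=> t; apply: cvgM; [exact: cvg_cst|exact: cs].
have : lap (fun t => L * c t - u / 2 * (sinh t * a t)) u = 0.
  apply: (lap_parts (a := a) (a1 := fun t => L * c t) (M := 1) (N := `|L| + u / 2)) => //.
    by move=> t; exact: le3.
  move=> t; rewrite mulrDl -mulNr; apply: le_trans (ler_normD _ _) _.
  by apply: lerD.
have -> : (fun t => L * c t - u / 2 * (sinh t * a t)) =
          (fun t => L * c t + - (u / 2) * (sinh t * a t)) by apply/funext => t; rewrite mulNr.
rewrite (lapD u cL bL cS bS u0) (lapZ L u cc (fun t => le3 c t (c_le t)) u0).
rewrite (lapZ _ u cs s3 u0) => h.
have h1 : L * lap c u = u / 2 * lap (fun t => sinh t * a t) u by lra.
have -> : 2 * L / u * lap c u = 2 / u * (L * lap c u) by ring.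
by rewrite h1; field; exact: lt0r_neq0.
Qed.

(** What the kernel needs to know about the order nu: K_nu and its cosine are
    real, and the recurrence K_(nu + 1) = - K_nu' + (nu / x) K_nu, at x = u / 2. *)
Record order_data (nu : R[i]) (c : R -> R) (C : R) : Prop := OrderData {
  order_K : forall u, 0 < u -> macdonaldK nu (u / 2) = (mac (c := c) u)%:C;
  order_K1 : forall u, 0 < u -> macdonaldK (nu + 1) (u / 2) =
    (- 2 * mac1 (c := c) u)%:C + nu * (2 / u * mac (c := c) u)%:C;
  order_cos : ccos (pi%:C * nu) = C%:C }.

Lemma lap0 u : lap (fun=> 0) u = 0 :> R.
Proof.
rewrite /lap; under eq_Rintegral do rewrite mulr0.
by rewrite Rintegral_cst// mul0r mulr0.
Qed.

Lemma order_real r : 0 <= r <= 2^-1 ->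
  order_data r%:C (fun t => cosh (r * t)) (cos (pi * r)).
Proof.
move=> r01; have /andP[r0 r2] := r01; have mc := mode_cosh r r01.
have rle : `|r| <= 2^-1 by rewrite ger0_norm.
split.
- move=> u u0; rewrite (macdonaldK_lap r 0)//; last by lra.
  rewrite (_ : (fun t => sinh (r * t) * sin (0 * t)) = fun=> 0); last first.
    by apply/funext => t; rewrite mul0r sin0 mulr0.
  rewrite (_ : (fun t => cosh (r * t) * cos (0 * t)) = fun t => cosh (r * t)); last first.
    by apply/funext => t; rewrite mul0r cos0 mulr1.
  by rewrite lap0.
- move=> u u0; have -> : r%:C + 1 = (r + 1) +i* 0 :> R[i] by simpc.
  rewrite macdonaldK_lap//; last by rewrite ger0_norm; lra.
  rewrite (_ : (fun t => sinh ((r + 1) * t) * sin (0 * t)) = fun=> 0); last first.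
    by apply/funext => t; rewrite mul0r sin0 mulr0.
  rewrite (_ : (fun t => cosh ((r + 1) * t) * cos (0 * t)) =
     fun t => cosh t * cosh (r * t) + sinh t * sinh (r * t)); last first.
    by apply/funext => t; rewrite mul0r cos0 mulr1 mulrDl mul1r coshD; ring.
  have cs : continuous (fun t => sinh t * sinh (r * t)).
    by move=> t; apply: cvgM; [exact: sinh_cont|exact: sinhr_cont].
  have bs t : `|sinh t * sinh (r * t)| <= 1 * cosh t ^+ 3.
    rewrite normrM mul1r (exprS _ 2); apply: ler_pM => //; first exact: sinh_abs_le.
    apply: le_trans (sinhr_le rle t) _; apply: le_trans (cosh_half_le t) _.
    exact: (cosh_powS_le 1 2).
  rewrite (lapD u (coshc_cont mc) (fun t => coshc_le mc t 1%N) cs bs u0) lap0.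
  rewrite (lap_sinh (c := fun t => cosh (r * t)) (L := r))//.
  + rewrite /mac1 /mac -rmorphM -rmorphD; congr (_%:C); by field; exact: lt0r_neq0.
  + exact: coshr_cont.
  + move=> t; apply: has_der_eq; first exact: (der_sinh (derM (derC r t) (derX t))).
    by rewrite /=; ring.
  + exact: (coshr_abs_le rle).
  + exact: sinhr_le.
- have -> : ccos (pi%:C * r%:C) = ccosh (0 +i* (pi * r)) :> R[i].
    by rewrite /ccos -/(ccosh _); congr ccosh; simpc.
  by rewrite ccoshE cosh0 sinh0 mul1r mul0r.
Qed.

Lemma order_imag s : order_data ('i%C * s%:C) (fun t => cos (s * t)) (cosh (pi * s)).
Proof.
have mc := mode_cos s.
have nuE : 'i%C * s%:C = 0 +i* s :> R[i] by simpc.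
split.
- move=> u u0; rewrite nuE macdonaldK_lap ?normr0//.
  rewrite (_ : (fun t => sinh (0 * t) * sin (s * t)) = fun=> 0); last first.
    by apply/funext => t; rewrite mul0r sinh0 mul0r.
  rewrite (_ : (fun t => cosh (0 * t) * cos (s * t)) = fun t => cos (s * t)); last first.
    by apply/funext => t; rewrite mul0r cosh0 mul1r.
  by rewrite lap0.
- move=> u u0; rewrite nuE; have -> : (0 +i* s) + 1 = 1 +i* s :> R[i] by simpc.
  rewrite macdonaldK_lap ?normr1//; last by lra.
  rewrite (_ : (fun t => cosh (1 * t) * cos (s * t)) = fun t => cosh t * cos (s * t)); last first.
    by apply/funext => t; rewrite mul1r.
  rewrite (_ : (fun t => sinh (1 * t) * sin (s * t)) = fun t => sinh t * sin (s * t)); last first.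
    by apply/funext => t; rewrite mul1r.
  have hle (z : R) x : `|z| <= 1 -> `|z| <= cosh (x / 2) by move=> /le_trans; apply; exact: cosh_ge1.
  rewrite (lap_sinh (c := fun t => cos (s * t)) (L := s))//.
  + rewrite /mac1 /mac; simpc; congr (_ +i* _).
      by field.
    by ring.
  + exact: cosm_cont.
  + move=> t; apply: has_der_eq; first exact: (der_sin (derM (derC s t) (derX t))).
    by rewrite /=; ring.
  + by move=> t; apply: hle; exact: cos_abs_le1.
  + by move=> t; apply: hle; exact: sin_abs_le1.
- have -> : ccos (pi%:C * ('i%C * s%:C)) = ccosh ((- (pi * s)) +i* 0) :> R[i].
    by rewrite /ccos -/(ccosh _); congr ccosh; simpc.
  by rewrite ccoshE cos0 sin0 mulr1 mulr0 coshN.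
Qed.

End MacdonaldFunction.

(** The terms with nu cancel in the antisymmetric combination. *)
Lemma macdonald_cross {R : realType} (nu : R[i]) (u v A B a b : R) : 0 < u -> 0 < v ->
  u%:C * ((- 2 * a)%:C + nu * (2 / u * A)%:C) * B%:C -
  v%:C * ((- 2 * b)%:C + nu * (2 / v * B)%:C) * A%:C =
  (2 * (v * b * A - u * a * B))%:C.
Proof.
move=> u0 v0.
case: nu => n1 n2; simpc.
by congr (_ +i* _); field; rewrite !lt0r_neq0.
Qed.

Section KernelFormula.
Context {R : realType} {nu : R[i]} {c c1 : R -> R} {k M C : R}.
Hypothesis mc : mode c c1 k M.
Hypothesis od : order_data nu c C.
Implicit Types (u v : R).

Notation Phi := (@Phi R (@phi R c)).
Notation Phi1 := (@Phi1 R (@phi R c) (@phi1 R c)).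
Notation Phi2 := (@Phi2 R (@phi R c) (k - 4^-1)).

Let wf := mode_wave mc.

Definition kernel_scale : R := C / (2 * pi ^+ 2).

Lemma kernel_offdiagE u v : 0 < u -> 0 < v -> u != v ->
  macdonald_kernel_offdiag nu u v = (kernel_scale * Phi u v)%:C.
Proof.
move=> u0 v0 uv; rewrite /macdonald_kernel_offdiag.
rewrite !(order_K _ _ _ od)// !(order_K1 _ _ _ od)// (order_cos _ _ _ od).
set A := mac u; set B := mac v; set a := mac1 u; set b := mac1 v.
rewrite macdonald_cross//.
have uv2 : u ^+ 2 - v ^+ 2 != 0.
  rewrite subr_sqr mulf_neq0 ?subr_eq0// gt_eqF// addr_gt0//.
rewrite -!rmorphXn -rmorphB -!fmorphV -!rmorphM; congr (_%:C).
have W := Phi_wron wf u v u0 v0.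
have E : v * (phi (c := c) u * phi1 (c := c) v) -
    u * (phi1 (c := c) u * phi (c := c) v) = Num.sqrt (u * v) * (v * b * A - u * a * B).
  rewrite sqrtrM ?(ltW u0)// /phi1 /phi -/A -/B -/a -/b.
  by field; rewrite !lt0r_neq0.
have {}W : (u ^+ 2 - v ^+ 2) / 4 * Phi u v = Num.sqrt (u * v) * (v * b * A - u * a * B).
  by rewrite W.
have -> : Num.sqrt (u * v) * C / pi ^+ 2 * (2 * (v * b * A - u * a * B) / (u ^+ 2 - v ^+ 2)) =
  C / pi ^+ 2 * 2 / (u ^+ 2 - v ^+ 2) * (Num.sqrt (u * v) * (v * b * A - u * a * B)).
  by ring.
have pn : pi != 0 :> R by rewrite lt0r_neq0// pi_gt0.
rewrite -W /kernel_scale; move: uv2 (Phi u v) pn; move: (u ^+ 2 - v ^+ 2) (pi : R) => d p d0 P p0.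
by field; rewrite d0 p0.
Qed.

(** On the diagonal the kernel is a limit, which is the value of Phi because Phi
    is continuous. *)
Lemma kernelE u v : 0 < u -> 0 < v ->
  macdonald_kernel nu u v = (kernel_scale * Phi u v)%:C.
Proof.
move=> u0 v0; rewrite /macdonald_kernel; case: eqVneq => [<-{v v0}|uv]; last exact: kernel_offdiagE.
apply: (@cvg_lim (R[i]^o)); first exact: norm_hausdorff.
have cP : kernel_scale * Phi u w @[w --> u^'] --> kernel_scale * Phi u u.
  apply: cvgMr; have [cu _ _] := Phi_cont2 wf u u u0 u0.
  by apply: cvg_within_filter; exact: cu.
apply: cvg_trans (cvg_realC cP); apply: near_eq_cvg; near=> w.
have w0 : 0 < w.
  by near: w; apply: nbhs_dnbhs; exact: lt_nbhsr.
have wu : w != u by near: w; exact: nbhs_dnbhs_neq.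
by rewrite kernel_offdiagE// eq_sym.
Unshelve. all: by end_near. Qed.

Lemma kernel_lift {g : R -> R[i]} v : 0 < v ->
  (forall x, 0 < x -> g x = (kernel_scale * Phi x v)%:C) ->
  ctwice_derivable_on D0 g /\
  forall u, 0 < u -> macdonald_diffop g u =
    (kernel_scale * (- (u ^+ 2 * Phi2 u v + 2 * u * Phi1 u v) +
       u ^+ 2 / 4 * Phi u v))%:C.
Proof.
move=> v0 gE.
have d1 x : 0 < x -> has_der (fun x => kernel_scale * Phi x v) x (kernel_scale * Phi1 x v).
  move=> x0; apply: has_der_eq; first exact: (derM (derC kernel_scale x) (der_Phi wf x v x0 v0)).
  by rewrite /=; ring.
have d2 x : 0 < x -> has_der (fun x => kernel_scale * Phi1 x v) x (kernel_scale * Phi2 x v).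
  move=> x0; apply: has_der_eq; first exact: (derM (derC kernel_scale x) (der_Phi1 wf x v x0 v0)).
  by rewrite /=; ring.
have [h1 _ h3] := real_lift gE d1 d2.
by split=> // u u0; rewrite h3//; congr (_%:C); ring.
Qed.

Lemma kernel_commutes :
  [/\ (forall v, 0 < v -> ctwice_derivable_on D0 (fun x => macdonald_kernel nu x v)),
      (forall u, 0 < u -> ctwice_derivable_on D0 (fun y => macdonald_kernel nu u y)) &
      (forall u v, 0 < u -> 0 < v ->
         macdonald_diffop (fun x => macdonald_kernel nu x v) u =
         macdonald_diffop (fun y => macdonald_kernel nu u y) v)].
Proof.
have el v x : 0 < v -> 0 < x -> macdonald_kernel nu x v = (kernel_scale * Phi x v)%:C.
  by move=> v0 x0; exact: kernelE.
have er u y : 0 < u -> 0 < y -> macdonald_kernel nu u y = (kernel_scale * Phi y u)%:C.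
  by move=> u0 y0; rewrite (kernelE u y u0 y0) Phi_sym.
split=> [v v0|u u0|u v u0 v0].
- exact: (kernel_lift v v0 (fun x => el v x v0)).1.
- exact: (kernel_lift u u0 (fun y => er u y u0)).1.
apply: etrans ((kernel_lift v v0 (fun x => el v x v0)).2 u u0) _.
apply: etrans (esym ((kernel_lift u u0 (fun y => er u y u0)).2 v v0)).
have P := Phi_commute wf u v u0 v0.
exact: (congr1 (fun z : R => (kernel_scale * z)%:C) P).
Qed.

End KernelFormula.

(** * The Whittaker function *)

Section Whittaker.
Context {R : realType} {m : R}.
Implicit Types (u : R) (W : R -> R[i]).

Local Notation mu := ('i%C * m%:C : R[i]).
Local Notation h := (@phi R (fun t => cos (m * t))).
Local Notation h1 := (@phi1 R (fun t => cos (m * t))).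
Local Notation b := (- m ^+ 2 - 4^-1).

Let wh := mode_wave (mode_cos m).

Lemma whittaker_coef u : 0 < u ->
  4^-1 - 0 / u%:C - (4^-1 - mu ^+ 2) / u%:C ^+ 2 = (4^-1 + b / u ^+ 2)%:C.
Proof.
move=> u0.
have four : (4^-1 : R[i]) = (4^-1)%:C by rewrite fmorphV rmorph_nat.
have -> : mu ^+ 2 = (- m ^+ 2)%:C.
  by rewrite exprMn sqr_i mulN1r rmorphN rmorphXn.
rewrite mul0r subr0 four -rmorphB -rmorphXn -fmorphV -rmorphM -rmorphB.
by congr (_%:C); ring.
Qed.

Definition whittaker_real : R -> R[i] :=
  fun u => if 0 < u then (h u / halfC)%:C else 0.

Lemma whittaker_realE u : 0 < u -> whittaker_real u = (halfC^-1 * h u)%:C.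
Proof. by rewrite /whittaker_real => ->; rewrite mulrC. Qed.

Lemma whittaker_denE u :
  cexp (0 * (ln u)%:C) * (expR (- (u / 2)))%:C = (expR (- (u / 2)))%:C :> R[i].
Proof.
have -> : 0 * (ln u)%:C = 0 +i* 0 :> R[i] by simpc.
by rewrite cexpE expR0 cos0 sin0 mulr1 mulr0 complexr0 mul1r.
Qed.

Lemma whittaker_exists : is_whittakerW 0 mu whittaker_real.
Proof.
have d1 u : 0 < u -> has_der (fun u => halfC^-1 * h u) u (halfC^-1 * h1 u).
  move=> u0; apply: has_der_eq; first exact: (derM (derC halfC^-1 u) (wave_der _ _ _ _ wh u u0)).
  by rewrite /=; ring.
have d2 u : 0 < u -> has_der (fun u => halfC^-1 * h1 u) u (halfC^-1 * ((4^-1 + b / u ^+ 2) * h u)).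
  move=> u0; apply: has_der_eq; first exact: (derM (derC halfC^-1 u) (wave_der1 _ _ _ _ wh u u0)).
  by rewrite /=; ring.
have [t1 t2 _] := real_lift whittaker_realE d1 d2.
split => //.
- move=> u u0; rewrite whittaker_coef// t2// whittaker_realE// -rmorphM.
  by congr (_%:C); ring.
- have c1 : h u / decay u @[u --> +oo] --> (1 : R).
    by apply: (decay_ratio_cvg 1 (`|m| + m ^+ 2 + 3)) => u u0; rewrite mul1r; exact: (wave_asymp _ _ _ _ wh).
  apply: cvg_trans (cvg_realC c1); apply: near_eq_cvg; near=> u.
  have u0 : 0 < u by near: u; apply: nbhs_pinfty_gt; exact: num_real.
  rewrite whittaker_denE whittaker_realE// -fmorphV -rmorphM; congr (_%:C).
  by rewrite /decay; field; rewrite !lt0r_neq0 ?halfC_gt0 ?expR_gt0.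
- by move=> u u0; rewrite /whittaker_real ltNge u0.
Unshelve. all: by end_near. Qed.

(** Normalised at infinity, exp (- u / 2) and h differ by the factor halfC. *)
Lemma whittaker_limit_ratio (g : R -> R) (l : R) :
  g u / expR (- (u / 2)) @[u --> +oo] --> l ->
  g u / h u @[u --> +oo] --> l / halfC.
Proof.
move=> gl.
have c1 : h u / decay u @[u --> +oo] --> (1 : R).
  by apply: (decay_ratio_cvg 1 (`|m| + m ^+ 2 + 3)) => u u0; rewrite mul1r; exact: (wave_asymp _ _ _ _ wh).
have E : g u / expR (- (u / 2)) * halfC^-1 * (h u / decay u)^-1 @[u --> +oo] --> l / halfC * 1^-1.
  apply: cvgM; first by apply: cvgM => //; exact: cvg_cst.
  by apply: cvgV => //; exact: oner_neq0.
rewrite invr1 mulr1 in E; apply: cvg_trans E; apply: near_eq_cvg; near=> u.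
have Uu : @waveU R (`|m| + m ^+ 2 + 3) <= u.
  by near: u; apply: nbhs_pinfty_ge; exact: num_real.
have h0 := wave_gt0 wh u Uu; have H0 := @halfC_gt0 R; have e0 := expR_gt0 (- (u / 2)).
rewrite /decay; move: (expR _) e0 (h u) h0 (@halfC R) H0 (g u) => e e0 z z0 H H0 y.
by field; rewrite !lt0r_neq0.
Unshelve. all: by end_near. Qed.

(** Real and imaginary part of a solution with the prescribed behaviour at
    infinity are multiples of the recessive solution h. *)
Lemma whittaker_unique W : is_whittakerW 0 mu W ->
  forall u, 0 < u -> W u = (halfC^-1 * h u)%:C.
Proof.
move=> [tW odeW limW _] u u0.
have dW x : 0 < x -> cderivable W x /\ cderivable (cderive W) x.
  by move=> x0; apply: tW; rewrite /= in_itv/= x0.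
have der (g : R -> R) x : derivable g x 1 -> has_der g x (derive1 g x).
  by move=> dg; rewrite derive1E; exact: derivableP.
have lim : W u / (expR (- (u / 2)))%:C @[u --> +oo] --> (1 : R[i]^o).
  apply: cvg_trans limW; apply: near_eq_cvg; near=> x.
  by rewrite whittaker_denE.
have parts x (z : R[i]) : z / (expR (- (x / 2)))%:C =
    (complex.Re z / expR (- (x / 2))) +i* (complex.Im z / expR (- (x / 2))).
  by case: z => p q; rewrite -fmorphV; simpc.
have sooo : (n.+1%:R : R) @[n --> \oo] --> +oo := @cvgr_idSn R.
have RE : complex.Re (W u) = 1 / halfC * h u.
  apply: (wave_unique wh (y := fun x => complex.Re (W x)) (y1 := fun x => complex.Re (cderive W x))
    (s := fun n => n.+1%:R)) => //.
  - by move=> x /dW[[dR _] _]; exact: der.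
  - move=> x x0; have [_ [dR _]] := dW x x0.
    apply: has_der_eq; first exact: der dR.
    transitivity (complex.Re (cderive (cderive W) x)); first by [].
    rewrite odeW// whittaker_coef//; case: (W x) => p q.
    by rewrite /=; ring.
  - have c1 : complex.Re (W u) / expR (- (u / 2)) @[u --> +oo] --> (1 : R).
      apply: cvg_trans (cvg_Re lim); apply: near_eq_cvg; near=> x.
      by rewrite parts.
    exact: (cvg_comp _ _ sooo (whittaker_limit_ratio _ _ c1)).
have IM : complex.Im (W u) = 0 / halfC * h u.
  apply: (wave_unique wh (y := fun x => complex.Im (W x)) (y1 := fun x => complex.Im (cderive W x))
    (s := fun n => n.+1%:R)) => //.
  - by move=> x /dW[[_ dI] _]; exact: der.
  - move=> x x0; have [_ [_ dI]] := dW x x0.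
    apply: has_der_eq; first exact: der dI.
    transitivity (complex.Im (cderive (cderive W) x)); first by [].
    rewrite odeW// whittaker_coef//; case: (W x) => p q.
    by rewrite /=; ring.
  - have c1 : complex.Im (W u) / expR (- (u / 2)) @[u --> +oo] --> (0 : R).
      apply: cvg_trans (cvg_Im lim); apply: near_eq_cvg; near=> x.
      by rewrite parts.
    exact: (cvg_comp _ _ sooo (whittaker_limit_ratio _ _ c1)).
move: RE IM; case: (W u) => p q /= -> ->.
by rewrite div1r mul0r mul0r.
Unshelve. all: by end_near. Qed.

Lemma whittakerWE u : 0 < u -> whittakerW 0 mu u = (halfC^-1 * h u)%:C.
Proof.
apply: whittaker_unique; rewrite /whittakerW; case: xgetP => [W _ //|/(_ whittaker_real)].
by move=> /(_ whittaker_exists).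
Qed.

End Whittaker.

(** * Eigenfunctions of the integral operator *)

Section KernelEigenfunctions.
Context {R : realType} {nu : R[i]} {c c1 : R -> R} {k M C : R}.
Hypothesis mc : mode c c1 k M.
Hypothesis od : order_data nu c C.
Hypothesis C_ge0 : 0 <= C.
Hypothesis mac_value : forall m : R,
  \int_ [set` `]0%R, +oo[] (fun v => mac (c := c) v * mac (c := fun t => cos (m * t)) v) =
  pi ^+ 2 / (C + cosh (pi * m)).
Implicit Types (u v m : R).

(** The eigenvalue is kernel_scale * 2 times the integral of phi v h v / v, that
    is C / pi^2 times the integral of K_nu K_im. *)
Lemma eigenfunction m :
  let f := fun u : R => whittakerW 0 ('i%C * m%:C) u / u%:C in
  [/\ ctwice_derivable_on D0 f,
      (forall u, 0 < u -> macdonald_diffop f u = (m ^+ 2 + 4^-1)%:C * f u),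
      (forall u, 0 < u -> cintegrable D0 (fun v => macdonald_kernel nu u v * f v)) &
      (forall u, 0 < u -> macdonald_op nu f u =
         C%:C / (C%:C + (cosh (pi * m))%:C) * f u)].
Proof.
move=> f; have mm := mode_cos m; have wh := mode_wave mm; have wf := mode_wave mc.
pose h := @phi R (fun t => cos (m * t)); pose h1 := @phi1 R (fun t => cos (m * t)).
pose F u := halfC^-1 * (h u / u).
pose F1 u := halfC^-1 * (h1 u / u - h u / u ^+ 2).
pose G u := (4^-1 + (- m ^+ 2 - 4^-1) / u ^+ 2) * h u.
pose F2 u := halfC^-1 * (G u / u - 2 * h1 u / u ^+ 2 + 2 * h u / u ^+ 3).
have fF u : 0 < u -> f u = (F u)%:C.
  move=> u0; rewrite /f (whittakerWE u u0) -fmorphV -rmorphM; congr (_%:C).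
  by rewrite /F /h -[LHS]mulrA.
have dh u : 0 < u -> has_der h u (h1 u) by exact: (wave_der _ _ _ _ wh).
have dh1 u : 0 < u -> has_der h1 u (G u) by exact: (wave_der1 _ _ _ _ wh).
have dV u : 0 < u -> has_der (fun u => u^-1) u (- u ^- 2).
  move=> u0; apply: has_der_eq; first exact: (derV (lt0r_neq0 u0) (derX u)).
  by rewrite /= mulNr mul1r.
have dF u : 0 < u -> has_der F u (F1 u).
  move=> u0; apply: has_der_eq.
    exact: (derM (derC halfC^-1 u) (derM (dh u u0) (dV u u0))).
  by rewrite /F1 /=; ring.
have dF1 u : 0 < u -> has_der F1 u (F2 u).
  move=> u0; have d2 : has_der (fun u => (u ^+ 2)^-1) u (- (2 * u) / (u ^+ 2) ^+ 2).
    by apply: (derV (f := fun u => u ^+ 2)); [rewrite expf_neq0// lt0r_neq0|exact: derX2].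
  apply: has_der_eq.
    exact: (derM (derC halfC^-1 u) (derD (derM (dh1 u u0) (dV u u0)) (derN (derM (dh u u0) d2)))).
  have H0 := lt0r_neq0 (@halfC_gt0 R).
  by rewrite /F2 /=; field; rewrite H0 lt0r_neq0.
have [t1 _ t3] := real_lift fF dF dF1.
have hC v : 0 < v -> `|h v| <= 3 * sech4_mass * qroot v.
  by apply: (phi_small mm) => t; exact: cos_abs_le1.
have h1C v : 0 < v -> `|v * h1 v| <= 3 * sech4_mass * qroot v.
  by apply: (phi1_small mm) => t; exact: cos_abs_le1.
have mD0 := @measurable_D0 R.
have kf u v : 0 < u -> 0 < v -> macdonald_kernel nu u v * f v =
    (@kernel_scale R C / halfC * (@Phi R (@phi R c) u v * (h v / v)))%:C.
  move=> u0 v0; rewrite (kernelE mc od u v u0 v0) fF// -rmorphM; congr (_%:C).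
  by rewrite /F; ring.
have ki u : 0 < u -> intble D0 (fun v => @Phi R (@phi R c) u v * (h v / v)).
  by move=> u0; have [] := Phi_int wf wh hC u u0.
split => //.
- move=> u u0; rewrite t3// fF// -rmorphM; congr (_%:C).
  rewrite /F1 /F2 /G /F; have H0 := lt0r_neq0 (@halfC_gt0 R).
  by field; rewrite H0 lt0r_neq0.
- move=> u u0; apply: (cintegrable_real mD0 (fun v Dv => kf u v u0 (inD0 v Dv))).
  by apply: intbleZ => //; exact: ki.
- move=> u u0; rewrite /macdonald_op (cintegral_real mD0 (fun v Dv => kf u v u0 (inD0 v Dv))).
  rewrite (Rint_scale _ mD0 (ki u u0)).
  have := eig_eq wf wh hC h1C u u0; rewrite /eig => ->.
  have -> : \int_ D0 (fun v => @phi R c v * (h v / v)) = pi ^+ 2 / (C + cosh (pi * m)).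
    rewrite -mac_value; apply: eq_Rintegral => v; rewrite inE => /inD0 v0.
    rewrite /h /phi; set A := mac v; set B := mac v.
    have -> : Num.sqrt v * A * (Num.sqrt v * B / v) = Num.sqrt v ^+ 2 / v * (A * B) by ring.
    by rewrite sqr_sqrtr ?ltW// divff ?mul1r// lt0r_neq0.
  rewrite fF// -rmorphD -fmorphV -!rmorphM; congr (_%:C).
  have D1 : 0 < C + cosh (pi * m) by rewrite ltr_wpDl ?cosh_gt0.
  have pn : pi != 0 :> R by rewrite lt0r_neq0// pi_gt0.
  have H0 := lt0r_neq0 (@halfC_gt0 R).
  rewrite /kernel_scale /F -/h; move: (C + _) (lt0r_neq0 D1) pn (h u) => d d0 pn z.
  move: (pi : R) pn => p p0; move: (@halfC R) H0 => H H0.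
  by field; rewrite d0 p0 H0 lt0r_neq0.
Qed.

End KernelEigenfunctions.

Theorem proposition5 (R : realType) (nu : R[i])
  (hnu : (exists2 r : R, 0 <= r < 2^-1 & nu = r%:C) \/
         (exists s : R, nu = 'i%C * s%:C)) :
  (* (1) *)
  [/\ (forall v : R, 0 < v ->
         ctwice_derivable_on `]0, +oo[ (fun x => macdonald_kernel nu x v)),
      (forall u : R, 0 < u ->
         ctwice_derivable_on `]0, +oo[ (fun y => macdonald_kernel nu u y)) &
      (forall u v : R, 0 < u -> 0 < v ->
         macdonald_diffop (fun x => macdonald_kernel nu x v) u =
         macdonald_diffop (fun y => macdonald_kernel nu u y) v)] /\
  (* (2) *)
  (forall m : R, 0 <= m ->
     let f := fun u : R => whittakerW 0 ('i%C * m%:C) u / u%:C in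
     [/\ ctwice_derivable_on `]0, +oo[ f,
         (forall u : R, 0 < u ->
            macdonald_diffop f u = (m ^+ 2 + 4^-1)%:C * f u),
         (forall u : R, 0 < u ->
            cintegrable `]0, +oo[ (fun v => macdonald_kernel nu u v * f v)) &
         (forall u : R, 0 < u ->
            macdonald_op nu f u =
            ccos (pi%:C * nu) / (ccos (pi%:C * nu) + (cosh (pi * m))%:C) *
            f u)]).
Proof.
case: hnu => [[r /andP[r0 r2] ->]|[s ->]].
- have r01 : 0 <= r <= 2^-1 by rewrite r0 ltW.
  have mc := mode_cosh r r01; have od := order_real r r01.
  have C0 : 0 <= cos (pi * r).
    rewrite cos_ge0_pihalf//; have := @pi_gt0 R => p0; apply/andP; split; nra.
  split; first exact: kernel_commutes mc od.
  move=> m _; rewrite (order_cos _ _ _ od); apply: (eigenfunction mc od C0) => n.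
  exact: mac_integral_real.
- have mc := mode_cos s; have od := order_imag s.
  split; first exact: kernel_commutes mc od.
  move=> m _; rewrite (order_cos _ _ _ od).
  apply: (eigenfunction mc od (ltW (cosh_gt0 _))) => n.
  exact: mac_integral_imag.
Qed.
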